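(* Let $H$ be a cocommutative weak Hopf algebra in $\mathsf{C}$, let $(B,\varphi_B)$ be a left weak $H$-module algebra and let $\sigma\in Reg^{+}_{\varphi_B}(H^{\otimes 2},B)$ satisfy the twisted condition. Let $\theta_\sigma$ be the obstruction of $\sigma$. Then $[\theta_\sigma]=0$ in $\mathcal{H}^{3+}_{\varphi_{Z(B)}}(H,Z(B))$ if and only if there exists a morphism $\alpha\in Reg^{+}_{\varphi_B}(H^{\otimes 2},B)$ that satisfies the twisted condition, the cocycle condition and the normal condition.
   Context: Category. $\mathsf{C}$ is a strict symmetric monoidal category with tensor product $\otimes$, unit object $K$ and symmetry $c$, in which every idempotent splits. For an object $M$ and a morphism $f$, $M\otimes f$ and $f\otimes M$ mean $id_M\otimes f$ and $f\otimes id_M$. Algebras $(A,\eta_A,\mu_A)$ are unital and associative, coalgebras $(D,\varepsilon_D,\delta_D)$ counital and coassociative; $\delta_{D\otimes E}=(D\otimes c_{D,E}\otimes E)\circ(\delta_D\otimes\delta_E)$. $D$ is cocommutative if $c_{D,D}\circ\delta_D=\delta_D$. For $f,g:D\to A$ the convolution is $f\ast g=\mu_A\circ(f\otimes g)\circ\delta_D$. Weak Hopf algebra. An object $H$ with algebra structure $(\eta_H,\mu_H)$ and coalgebra structure $(\varepsilon_H,\delta_H)$ such that: (a1) $\delta_H\circ\mu_H=(\mu_H\otimes\mu_H)\circ\delta_{H\otimes H}$; (a2) $\varepsilon_H\circ\mu_H\circ(\mu_H\otimes H)=((\varepsilon_H\circ\mu_H)\otimes(\varepsilon_H\circ\mu_H))\circ(H\otimes\delta_H\otimes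 H)=((\varepsilon_H\circ\mu_H)\otimes(\varepsilon_H\circ\mu_H))\circ(H\otimes(c_{H,H}\circ\delta_H)\otimes H)$; (a3) $(\delta_H\otimes H)\circ\delta_H\circ\eta_H=(H\otimes\mu_H\otimes H)\circ((\delta_H\circ\eta_H)\otimes(\delta_H\circ\eta_H))=(H\otimes(\mu_H\circ c_{H,H})\otimes H)\circ((\delta_H\circ\eta_H)\otimes(\delta_H\circ\eta_H))$; and there is an antipode $\lambda_H:H\to H$ with (a4) $id_H\ast\lambda_H=\Pi_H^L:=((\varepsilon_H\circ\mu_H)\otimes H)\circ(H\otimes c_{H,H})\circ((\delta_H\circ\eta_H)\otimes H)$, (a5) $\lambda_H\ast id_H=\Pi_H^R:=(H\otimes(\varepsilon_H\circ\mu_H))\circ(c_{H,H}\otimes H)\circ(H\otimes(\delta_H\circ\eta_H))$, (a6) $\lambda_H\ast id_H\ast\lambda_H=\lambda_H$. Actions. For an algebra $B$, a measuring is a morphism $\varphi_B:H\otimes B\to B$ with (b1) $\varphi_B\circ(H\otimes\mu_B)=\mu_B\circ(\varphi_B\otimes\varphi_B)\circ(H\otimes c_{H,B}\otimes B)\circ(\delta_H\otimes B\otimes B)$. Put $u_1^{\varphi_B}=\varphi_B\circ(H\otimes\eta_B)$. $(B,\varphi_B)$ is a left weak $H$-module algebra if moreover (b2) $\varphi_B\circ(\eta_H\otimes B)=id_B$ and (b3) $u_1^{\varphi_B}\circ\mu_H=\varphi_B\circ(H\otimes u_1^{\varphi_B})$; it is a left $H$-module algebra if (b3) is replaced by $\varphi_B\circ(\mu_H\otimes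 B)=\varphi_B\circ(H\otimes\varphi_B)$. For $n\ge 2$, $u_n^{\varphi_B}=u_1^{\varphi_B}\circ m_H^{\otimes n}$, where $m_H^{\otimes n}:H^{\otimes n}\to H$ is the iterated product. Regular morphisms. $Reg_{\varphi_B}(H^{\otimes n},B)$ is the group (under $\ast$, with unit $u_n^{\varphi_B}$) of morphisms $\sigma:H^{\otimes n}\to B$ for which there is $\sigma^{-1}:H^{\otimes n}\to B$ with $\sigma\ast\sigma^{-1}=\sigma^{-1}\ast\sigma=u_n^{\varphi_B}$, $\sigma\ast\sigma^{-1}\ast\sigma=\sigma$, $\sigma^{-1}\ast\sigma\ast\sigma^{-1}=\sigma^{-1}$. $Reg^{+}_{\varphi_B}(H^{\otimes (k+1)},B)$ ($k\geq 1$) is the subgroup of those $\sigma$ with $\sigma\circ(H^{\otimes i}\otimes\eta_H\otimes H^{\otimes(k-i)})=u_k^{\varphi_B}$ for $0\le i\le k$. Conditions on $\sigma:H\otimes H\to B$. Let $P_{\varphi_B}=(\varphi_B\otimes H)\circ(H\otimes c_{H,B})\circ(\delta_H\otimes B)$ and $F_\sigma=(\sigma\otimes\mu_H)\circ\delta_{H\otimes H}$. Twisted condition: $\mu_B\circ(B\otimes\sigma)\circ(P_{\varphi_B}\otimes H)\circ(H\otimes P_{\varphi_B})=\mu_B\circ(B\otimes\varphi_B)\circ(F_\sigma\otimes B)$. Cocycle condition: $\mu_B\circ(B\otimes\sigma)\circ(P_{\varphi_B}\otimes H)\circ(H\otimes F_\sigma)=\mu_B\circ(B\otimes\sigma)\circ(F_\sigma\otimes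 H)$. Normal condition: $\sigma\circ(\eta_H\otimes H)=\sigma\circ(H\otimes\eta_H)=u_1^{\varphi_B}$. Coface operators. For $k\ge1$, $\partial_{k,i}:Reg_{\varphi_B}(H^{\otimes k},B)\to Reg_{\varphi_B}(H^{\otimes(k+1)},B)$: $\partial_{k,0}(\sigma)=\varphi_B\circ(H\otimes\sigma)$; $\partial_{k,i}(\sigma)=\sigma\circ(H^{\otimes(i-1)}\otimes\mu_H\otimes H^{\otimes(k-i)})$ for $1\le i\le k$; $\partial_{k,k+1}(\sigma)=\sigma\circ(H^{\otimes(k-1)}\otimes(\mu_H\circ(H\otimes\Pi_H^L)))$. For a commutative left $H$-module algebra $(A,\varphi_A)$ ($H$ cocommutative), $D^k_{\varphi_A}=\partial_{k,0}\ast\partial_{k,1}^{-1}\ast\cdots\ast\partial_{k,k+1}^{(-1)^{k+1}}$; $D^{k+}_{\varphi_A}$ is its restriction to $Reg^{+}_{\varphi_A}(H^{\otimes k},A)$, with values in $Reg^{+}_{\varphi_A}(H^{\otimes(k+1)},A)$, and $\mathcal{H}^{3+}_{\varphi_A}(H,A)=Ker(D^{3+}_{\varphi_A})/Im(D^{2+}_{\varphi_A})$. Center. The center of $B$ is an object $Z(B)$ with a monomorphism $z_B:Z(B)\to B$ such that $\mu_B\circ(B\otimes z_B)=\mu_B\circ c_{B,B}\circ(B\otimes z_B)$ and every $f:A\to B$ with $\mu_B\circ(B\otimes f)=\mu_B\circ c_{B,B}\circ(B\otimes f)$ factors uniquely through $z_B$. It is assumed to exist; it is a commutative algebra and $z_B$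 is an algebra morphism. When $H$ is cocommutative and some $\sigma\in Reg_{\varphi_B}(H^{\otimes2},B)$ satisfies the twisted condition, there is a unique $\varphi_{Z(B)}:H\otimes Z(B)\to Z(B)$ with $z_B\circ\varphi_{Z(B)}=\varphi_B\circ(H\otimes z_B)$, and $(Z(B),\varphi_{Z(B)})$ is a left $H$-module algebra. Obstruction. The pre-obstruction of $\sigma\in Reg_{\varphi_B}(H^{\otimes 2},B)$ is $\omega_\sigma=\partial_{2,0}(\sigma)\ast\partial_{2,2}(\sigma)\ast\partial_{2,1}(\sigma)^{-1}\ast\partial_{2,3}(\sigma)^{-1}:H^{\otimes3}\to B$. If $\sigma$ satisfies the twisted condition, $\omega_\sigma$ factors through the center, and the obstruction $\theta_\sigma:H^{\otimes3}\to Z(B)$ is the unique morphism with $z_B\circ\theta_\sigma=\omega_\sigma$. For $\sigma\in Reg^{+}_{\varphi_B}(H^{\otimes 2},B)$ it lies in $Ker(D^{3+}_{\varphi_{Z(B)}})$, and $[\theta_\sigma]$ denotes its class; $[\theta_\sigma]=0$ means that this class is the trivial one. *)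

(* Defs.v *)
From mathcomp Require Import all_boot.
From Stdlib Require Import ClassicalEpsilon.
Set Implicit Arguments.
Unset Strict Implicit.
Unset Printing Implicit Defensive.

Declare Scope smc_scope.
Delimit Scope smc_scope with smc.

(* Strict symmetric monoidal categories, in Mac Lane's "arrows-only" style: all
   morphisms live in one type, with source and target maps.  Strictness is then
   a set of plain equations between objects and between morphisms, instead of
   equations up to transport along [A ⊠ (B ⊠ C) = (A ⊠ B) ⊠ C].
   The composite [mcomp g f] of g after f is a total operation, but it is only
   constrained when the target of f is the source of g; its other values carry
   no information.  [hom A B f] says that f is a morphism from A to B.  *)
Record smc := SMC {
  Ob : Type;
  Mor : Type;
  src : Mor -> Ob;
  tgt : Mor -> Ob;
  idm : Ob -> Mor;
  mcomp : Mor -> Mor -> Mor;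
  K : Ob;
  otens : Ob -> Ob -> Ob;
  mtens : Mor -> Mor -> Mor;
  braid : Ob -> Ob -> Mor;

  src_idm : forall A, src (idm A) = A;
  tgt_idm : forall A, tgt (idm A) = A;
  src_mcomp : forall g f, tgt f = src g -> src (mcomp g f) = src f;
  tgt_mcomp : forall g f, tgt f = src g -> tgt (mcomp g f) = tgt g;
  mcomp1m : forall f, mcomp (idm (tgt f)) f = f;
  mcompm1 : forall f, mcomp f (idm (src f)) = f;
  mcompA : forall h g f, tgt f = src g -> tgt g = src h ->
    mcomp h (mcomp g f) = mcomp (mcomp h g) f;

  otensA : forall A B D, otens A (otens B D) = otens (otens A B) D;
  otensKA : forall A, otens K A = A;
  otensAK : forall A, otens A K = A;
  src_mtens : forall f g, src (mtens f g) = otens (src f) (src g);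
  tgt_mtens : forall f g, tgt (mtens f g) = otens (tgt f) (tgt g);
  mtens_idm : forall A B, mtens (idm A) (idm B) = idm (otens A B);
  mtens_mcomp : forall g f g' f', tgt f = src g -> tgt f' = src g' ->
    mtens (mcomp g f) (mcomp g' f') = mcomp (mtens g g') (mtens f f');
  mtensA : forall f g h, mtens f (mtens g h) = mtens (mtens f g) h;
  mtensKm : forall f, mtens (idm K) f = f;
  mtensmK : forall f, mtens f (idm K) = f;

  src_braid : forall A B, src (braid A B) = otens A B;
  tgt_braid : forall A B, tgt (braid A B) = otens B A;
  braid_natural : forall f g,
    mcomp (braid (tgt f) (tgt g)) (mtens f g)
    = mcomp (mtens g f) (braid (src f) (src g));
  braidK : forall A B, mcomp (braid B A) (braid A B) = idm (otens A B);
  (* the other hexagon, and braid A K = idm A, follow from this and braidK *)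
  braid_hexagon : forall A B D,
    braid A (otens B D)
    = mcomp (mtens (idm B) (braid A D)) (mtens (braid A B) (idm D))
}.

Arguments src {s} _.
Arguments tgt {s} _.
Arguments idm {s} _.
Arguments mcomp {s} _ _.
Arguments K {s}.
Arguments otens {s} _ _.
Arguments mtens {s} _ _.
Arguments braid {s} _ _.

(* An object standing for a morphism denotes its identity: M ⊗ f is id_M ⊗ f. *)
Coercion idm : Ob >-> Mor.

Notation "A ⊠ B" := (otens A B) (at level 38, left associativity) : smc_scope.
Notation "f ⊗ g" := (mtens f%smc g%smc)
  (at level 38, left associativity) : smc_scope.
Notation "g ∘ f" := (mcomp g%smc f%smc)
  (at level 40, left associativity) : smc_scope.
Local Open Scope smc_scope.

Section Categories.
Variable C : smc.
Implicit Types (A B D E : Ob C) (f g : Mor C).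

Definition hom A B f := src f = A /\ tgt f = B.

Definition idempotents_split :=
  forall A e, hom A A e -> e ∘ e = e ->
  exists B i p, [/\ hom A B p, hom B A i, i ∘ p = e & p ∘ i = idm B].

Definition mono f :=
  forall g h, tgt g = src f -> tgt h = src f -> src g = src h ->
  f ∘ g = f ∘ h -> g = h.

(* A^{⊗n}; note that tpow A 1 is A ⊠ K, which equals A by otensAK *)
Definition tpow A n : Ob C := iter n (otens A) K.

Definition tensor_comul D E (deltaD deltaE : Mor C) :=
  (D ⊗ braid D E ⊗ E) ∘ (deltaD ⊗ deltaE).

Definition convol (delta mu f g : Mor C) := mu ∘ (f ⊗ g) ∘ delta.

End Categories.

Record algebra (C : smc) := Algebra {
  alg_ob :> Ob C;
  unit_of : Mor C;
  mul_of : Mor C;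
  hom_unit : hom K alg_ob unit_of;
  hom_mul : hom (alg_ob ⊠ alg_ob) alg_ob mul_of;
  mul_unitl : mul_of ∘ (unit_of ⊗ alg_ob) = idm alg_ob;
  mul_unitr : mul_of ∘ (alg_ob ⊗ unit_of) = idm alg_ob;
  mul_assoc : mul_of ∘ (mul_of ⊗ alg_ob) = mul_of ∘ (alg_ob ⊗ mul_of)
}.

(* Pi^L and Pi^R, for an object with raw structure morphisms *)
Definition Pi_left (C : smc) (H : Ob C) (eta mu eps delta : Mor C) : Mor C :=
  ((eps ∘ mu) ⊗ H) ∘ (H ⊗ braid H H) ∘ ((delta ∘ eta) ⊗ H).
Definition Pi_right (C : smc) (H : Ob C) (eta mu eps delta : Mor C) : Mor C :=
  (H ⊗ (eps ∘ mu)) ∘ (braid H H ⊗ H) ∘ (H ⊗ (delta ∘ eta)).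

Record weak_hopf (C : smc) := WeakHopf {
  wh_alg :> algebra C;
  counit : Mor C;
  comul : Mor C;
  antipode : Mor C;

  hom_counit : hom wh_alg K counit;
  hom_comul : hom wh_alg (wh_alg ⊠ wh_alg) comul;
  comul_counitl : (counit ⊗ wh_alg) ∘ comul = idm wh_alg;
  comul_counitr : (wh_alg ⊗ counit) ∘ comul = idm wh_alg;
  comul_coassoc : (comul ⊗ wh_alg) ∘ comul = (wh_alg ⊗ comul) ∘ comul;

  wh_comul_mul :
    comul ∘ mul_of wh_alg
    = (mul_of wh_alg ⊗ mul_of wh_alg)
      ∘ tensor_comul wh_alg wh_alg comul comul;

  wh_counit_mul :
    counit ∘ mul_of wh_alg ∘ (mul_of wh_alg ⊗ wh_alg)
    = ((counit ∘ mul_of wh_alg) ⊗ (counit ∘ mul_of wh_alg))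
      ∘ (wh_alg ⊗ comul ⊗ wh_alg);
  wh_counit_mul_braid :
    counit ∘ mul_of wh_alg ∘ (mul_of wh_alg ⊗ wh_alg)
    = ((counit ∘ mul_of wh_alg) ⊗ (counit ∘ mul_of wh_alg))
      ∘ (wh_alg ⊗ (braid wh_alg wh_alg ∘ comul) ⊗ wh_alg);

  wh_comul_unit :
    (comul ⊗ wh_alg) ∘ comul ∘ unit_of wh_alg
    = (wh_alg ⊗ mul_of wh_alg ⊗ wh_alg)
      ∘ ((comul ∘ unit_of wh_alg) ⊗ (comul ∘ unit_of wh_alg));
  wh_comul_unit_braid :
    (comul ⊗ wh_alg) ∘ comul ∘ unit_of wh_alg
    = (wh_alg ⊗ (mul_of wh_alg ∘ braid wh_alg wh_alg) ⊗ wh_alg)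
      ∘ ((comul ∘ unit_of wh_alg) ⊗ (comul ∘ unit_of wh_alg));

  hom_antipode : hom wh_alg wh_alg antipode;
  wh_antipode_right :
    convol comul (mul_of wh_alg) wh_alg antipode
    = Pi_left wh_alg (unit_of wh_alg) (mul_of wh_alg) counit comul;
  wh_antipode_left :
    convol comul (mul_of wh_alg) antipode wh_alg
    = Pi_right wh_alg (unit_of wh_alg) (mul_of wh_alg) counit comul;
  wh_antipode_mid :
    convol comul (mul_of wh_alg)
      (convol comul (mul_of wh_alg) antipode wh_alg) antipode
    = antipode
}.

Section WeakHopf.
Variables (C : smc) (H : weak_hopf C).

Definition cocommutative := braid H H ∘ comul H = comul H.

Definition PiL : Mor C :=
  Pi_left H (unit_of H) (mul_of H) (counit H) (comul H).

Definition comul2 : Mor C := tensor_comul H H (comul H) (comul H).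

(* the coalgebra structure of H^{⊗n}; K is a coalgebra through idm K *)
Fixpoint comuln (n : nat) : Mor C :=
  if n is m.+1 then tensor_comul H (tpow H m) (comul H) (comuln m) else idm K.

Fixpoint muln_of (n : nat) : Mor C :=
  match n with
  | 0 => unit_of H
  | 1 => idm H
  | m.+1 => mul_of H ∘ (H ⊗ muln_of m)
  end.

Variables (B : algebra C) (phi : Mor C).
Implicit Types (sigma tau : Mor C).

Definition u1 : Mor C := phi ∘ (H ⊗ unit_of B).

Definition measuring :=
  hom (H ⊠ B) B phi /\
  phi ∘ (H ⊗ mul_of B)
  = mul_of B ∘ (phi ⊗ phi) ∘ (H ⊗ braid H B ⊗ B) ∘ (comul H ⊗ B ⊗ B).

Definition weak_module_algebra :=
  [/\ measuring, phi ∘ (unit_of H ⊗ B) = idm B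
    & u1 ∘ mul_of H = phi ∘ (H ⊗ u1)].

Definition u_ (n : nat) : Mor C := u1 ∘ muln_of n.

Definition conv (n : nat) sigma tau : Mor C :=
  convol (comuln n) (mul_of B) sigma tau.

Definition reg_inverse (n : nat) sigma tau :=
  [/\ hom (tpow H n) B tau,
      conv n sigma tau = u_ n, conv n tau sigma = u_ n,
      conv n (conv n sigma tau) sigma = sigma
    & conv n (conv n tau sigma) tau = tau].

Definition Reg (n : nat) sigma :=
  hom (tpow H n) B sigma /\ exists tau, reg_inverse n sigma tau.

(* sigma^{-1} in Reg(H^{⊗n}, B): it is unique when it exists, and the value is
   arbitrary when sigma is not regular *)
Definition reg_inv (n : nat) sigma : Mor C :=
  epsilon (inhabits sigma) (reg_inverse n sigma).

(* Reg^+(H^{⊗n}, B), for n >= 2 *)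
Definition RegPlus (n : nat) sigma :=
  Reg n sigma /\
  forall i, i < n ->
    sigma ∘ (tpow H i ⊗ unit_of H ⊗ tpow H (n.-1 - i)) = u_ n.-1.

Definition P_mor : Mor C := (phi ⊗ H) ∘ (H ⊗ braid H B) ∘ (comul H ⊗ B).
Definition F_mor sigma : Mor C := (sigma ⊗ mul_of H) ∘ comul2.

Definition twisted sigma :=
  mul_of B ∘ (B ⊗ sigma) ∘ (P_mor ⊗ H) ∘ (H ⊗ P_mor)
  = mul_of B ∘ (B ⊗ phi) ∘ (F_mor sigma ⊗ B).

Definition cocycle_condition sigma :=
  mul_of B ∘ (B ⊗ sigma) ∘ (P_mor ⊗ H) ∘ (H ⊗ F_mor sigma)
  = mul_of B ∘ (B ⊗ sigma) ∘ (F_mor sigma ⊗ H).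

Definition normal_condition sigma :=
  sigma ∘ (unit_of H ⊗ H) = u1 /\ sigma ∘ (H ⊗ unit_of H) = u1.

(* partial_{k,i}; all indices i > k give partial_{k,k+1} *)
Definition coface (k i : nat) sigma : Mor C :=
  if i is j.+1 then
    if i <= k then sigma ∘ (tpow H j ⊗ mul_of H ⊗ tpow H (k - i))
    else sigma ∘ (tpow H k.-1 ⊗ (mul_of H ∘ (H ⊗ PiL)))
  else phi ∘ (H ⊗ sigma).

(* partial_{k,i}(sigma)^{(-1)^i} *)
Definition signed_coface (k i : nat) sigma : Mor C :=
  if odd i then reg_inv k.+1 (coface k i sigma) else coface k i sigma.

Definition Dk (k : nat) sigma : Mor C :=
  foldl (fun acc i => conv k.+1 acc (signed_coface k i sigma))
        (signed_coface k 0 sigma) (iota 1 k.+1).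

(* Ker(D^{k+}) and Im(D^{k+}) *)
Definition KerDplus (k : nat) theta := RegPlus k theta /\ Dk k theta = u_ k.+1.
Definition ImDplus (k : nat) theta :=
  exists2 tau, RegPlus k tau & theta = Dk k tau.

(* [theta] = [theta'] in H^{k+} = Ker(D^{k+}) / Im(D^{(k-1)+}) *)
Definition same_class (k : nat) theta theta' :=
  [/\ KerDplus k theta, KerDplus k theta'
    & exists2 beta, ImDplus k.-1 beta & theta = conv k theta' beta].

Definition class_trivial (k : nat) theta := same_class k theta (u_ k).

Definition pre_obstruction sigma : Mor C :=
  conv 3 (conv 3 (conv 3 (coface 2 0 sigma) (coface 2 2 sigma))
                 (reg_inv 3 (coface 2 1 sigma)))
         (reg_inv 3 (coface 2 3 sigma)).

End WeakHopf.

Definition central (C : smc) (B : algebra C) (f : Mor C) :=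
  mul_of B ∘ (B ⊗ f) = mul_of B ∘ braid B B ∘ (B ⊗ f).

(* The center z_B : Z(B) -> B, with the algebra structure for which z_B is an
   algebra morphism (unique since z_B is a monomorphism). *)
Record center (C : smc) (B : algebra C) := Center {
  center_alg :> algebra C;
  center_mor : Mor C;
  hom_center : hom center_alg B center_mor;
  mono_center : mono center_mor;
  central_center : central B center_mor;
  center_factor : forall (A : Ob C) (f : Mor C), hom A B f -> central B f ->
    exists! g : Mor C, hom A center_alg g /\ center_mor ∘ g = f;
  center_unit : center_mor ∘ unit_of center_alg = unit_of B;
  center_mul : center_mor ∘ mul_of center_alg
               = mul_of B ∘ (center_mor ⊗ center_mor)
}.

Definition center_action (C : smc) (H : weak_hopf C) (B : algebra C)
    (phi : Mor C) (Z : center B) (phiZ : Mor C) :=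
  hom (H ⊠ Z) Z phiZ /\ center_mor Z ∘ phiZ = phi ∘ (H ⊗ center_mor Z).

Definition obstruction (C : smc) (H : weak_hopf C) (B : algebra C)
    (phi : Mor C) (Z : center B) (sigma theta : Mor C) :=
  hom (tpow H 3) Z theta /\
  center_mor Z ∘ theta = pre_obstruction H B phi sigma.

Section Typing.
Variable C : smc.
Implicit Types (A B D E : Ob C) (f g : Mor C).

Lemma hom_idm A : hom A A (idm A).
Proof. by split; rewrite ?src_idm ?tgt_idm. Qed.

Lemma hom_mcomp A B B' D f g :
  hom A B f -> hom B' D g -> B = B' -> hom A D (g ∘ f).
Proof.
move=> [<- <-] [<- <-] e.
by split; rewrite ?src_mcomp ?tgt_mcomp.
Qed.

Lemma hom_mtens A B D E f g :
  hom A B f -> hom D E g -> hom (A ⊠ D) (B ⊠ E) (f ⊗ g).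
Proof. by move=> [<- <-] [<- <-]; split; rewrite ?src_mtens ?tgt_mtens. Qed.

Lemma hom_braid A B : hom (A ⊠ B) (B ⊠ A) (braid A B).
Proof. by split; rewrite ?src_braid ?tgt_braid. Qed.

Lemma hom_eq A B A' B' f : hom A' B' f -> A' = A -> B' = B -> hom A B f.
Proof. by move=> h <- <-. Qed.

Lemma tpowD A m n : tpow A (m + n) = tpow A m ⊠ tpow A n.
Proof.
elim: m => [|m IH]; first by rewrite add0n /= otensKA.
by rewrite addSn /= IH otensA.
Qed.

End Typing.

Ltac ob_eq :=
  rewrite /tpow /= ?(otensA, otensKA, otensAK); reflexivity.
Ltac hom_raw :=
  lazymatch goal with
  | |- hom _ _ (mcomp _ _) => eapply hom_mcomp; [hom_raw | hom_raw | ob_eq]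
  | |- hom _ _ (mtens _ _) => eapply hom_mtens; [hom_raw | hom_raw]
  | |- hom _ _ (idm _) => apply: hom_idm
  | |- hom _ _ (braid _ _) => apply: hom_braid
  | |- hom _ _ (unit_of _) => apply: hom_unit
  | |- hom _ _ (mul_of _) => apply: hom_mul
  | |- hom _ _ (counit _) => apply: hom_counit
  | |- hom _ _ (comul _) => apply: hom_comul
  | |- hom _ _ (antipode _) => apply: hom_antipode
  | |- _ => eassumption
  end.
Ltac hom_tac := eapply hom_eq; [hom_raw | ob_eq | ob_eq].

Section TypingHopf.
Variables (C : smc) (H : weak_hopf C) (B : algebra C) (phi : Mor C).
Hypothesis hphi : hom (H ⊠ B) B phi.
Implicit Types (sigma tau : Mor C).

Lemma hom_PiL : hom H H (PiL H).
Proof. by rewrite /PiL /Pi_left; hom_tac. Qed.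

Lemma hom_Pi_right :
  hom H H (Pi_right H (unit_of H) (mul_of H) (counit H) (comul H)).
Proof. by rewrite /Pi_right; hom_tac. Qed.

Lemma hom_comul2 : hom (H ⊠ H) (H ⊠ H ⊠ (H ⊠ H)) (comul2 H).
Proof. by rewrite /comul2 /tensor_comul; hom_tac. Qed.

Lemma hom_comuln n : hom (tpow H n) (tpow H n ⊠ tpow H n) (comuln H n).
Proof.
elim: n => [|n IH] /=; first by hom_tac.
rewrite /tensor_comul -/(tpow H n); hom_tac.
Qed.

Lemma hom_muln n : hom (tpow H n) H (muln_of H n).
Proof.
elim: n => [|[|n] IH]; first exact: hom_unit.
  by rewrite /muln_of; hom_tac.
change (hom (H ⊠ tpow H n.+1) H (mul_of H ∘ (H ⊗ muln_of H n.+1))).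
hom_tac.
Qed.

Lemma hom_u1 : hom H B (u1 H B phi).
Proof. by rewrite /u1; hom_tac. Qed.

Lemma hom_u n : hom (tpow H n) B (u_ H B phi n).
Proof. rewrite /u_; move: (hom_muln n) hom_u1 => h1 h2; hom_tac. Qed.

Lemma hom_conv n sigma tau :
  hom (tpow H n) B sigma -> hom (tpow H n) B tau ->
  hom (tpow H n) B (conv H B n sigma tau).
Proof.
move=> h1 h2; rewrite /conv /convol; move: (hom_comuln n) => h3; hom_tac.
Qed.

Lemma hom_reg_inv n sigma :
  Reg H B phi n sigma -> hom (tpow H n) B (reg_inv H B phi n sigma).
Proof.
move=> [_ ex]; rewrite /reg_inv.
by case: (epsilon_spec (inhabits sigma) (reg_inverse H B phi n sigma) ex).
Qed.

Lemma hom_P_mor : hom (H ⊠ B) (B ⊠ H) (P_mor H B phi).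
Proof. by rewrite /P_mor; hom_tac. Qed.

Lemma hom_F_mor sigma :
  hom (tpow H 2) B sigma -> hom (H ⊠ H) (B ⊠ H) (F_mor H sigma).
Proof.
move=> h1; rewrite /F_mor; move: hom_comul2 => h2; hom_tac.
Qed.

Lemma hom_degeneracy n i : i < n ->
  hom (tpow H n.-1) (tpow H n) (tpow H i ⊗ unit_of H ⊗ tpow H (n.-1 - i)).
Proof.
case: n => // n; rewrite ltnS /= => lin.
eapply hom_eq; first by hom_raw.
  by rewrite otensAK -tpowD subnKC.
by rewrite -otensA -[_ ⊠ tpow H (n - i)]/(tpow H (n - i).+1) -tpowD
           addnS subnKC.
Qed.

Lemma hom_coface k i sigma : 0 < k ->
  hom (tpow H k) B sigma -> hom (tpow H k.+1) B (coface H phi k i sigma).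
Proof.
case: k => // k _ hs; case: i => [|i].
  by rewrite /coface -[tpow H k.+2]/(H ⊠ tpow H k.+1); hom_tac.
rewrite /coface; case: ifP => [le_ik|_].
  have e : i + (k.+1 - i.+1) = k by rewrite subSS subnKC.
  eapply hom_eq; last reflexivity.
    eapply hom_mcomp; [hom_raw | exact: hs |].
    by rewrite -otensA -[_ ⊠ tpow H _]/(tpow H (k.+1 - i.+1).+1) -tpowD
               addnS e.
  rewrite -!otensA -[H ⊠ (H ⊠ tpow H _)]/(tpow H (k.+1 - i.+1).+2) -tpowD.
  by rewrite !addnS e.
move: hom_PiL => h.
have eS m : tpow H m.+1 = tpow H m ⊠ H
  by rewrite -addn1 tpowD /tpow /= otensAK.
eapply hom_eq; last reflexivity.
  by eapply hom_mcomp; [hom_raw | exact: hs | rewrite eS].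
by rewrite !eS -otensA.
Qed.

End TypingHopf.

(* Submission.v *)
Require Import Defs.
From HB Require Import structures.
From mathcomp Require Import all_boot.
From Stdlib Require Import ProofIrrelevance ClassicalEpsilon.
Set Implicit Arguments.
Unset Strict Implicit.
Unset Printing Implicit Defensive.
Local Open Scope smc_scope.

(** Write h, k for group-like elements of H, that is, elements with
    Δ(h) = h ⊗ h. If every morphism out of a power of H could be tested on such
    elements, convolution would be the product of values in B, each value s(h, k)
    would be an ordinary element, and the theorem would be the classical
    argument about obstructions to crossed products over a groupoid: in a
    cocommutative weak Hopf algebra the group-like elements compose like arrows,
    with identities Π^L(h), inverses λ(h), and ε(h k) telling whether h and k are
    composable.

    This reduction is legitimate. For a cocommutative comonoid G the coKleisli
    category of G ⊗ - is again a strict symmetric monoidal category (generic), C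
    embeds in it preserving all the structure, and G acquires there a group-like
    element at which a morphism takes itself as value (kval_at_gelt). With a
    power of H for G one gets generic tuples of group-like elements (tuple_ext),
    so that an equation proved for group-like elements in all categories holds
    between morphisms. The unit of H is not group-like, but inserting it into an
    argument of a regular morphism amounts to inserting the identity of a
    neighbouring argument (unit_right, unit_left).

    On elements the twisted condition reads
    (h.(k.b)) s(h, k) = s(h, k) ((h k).b). Consequently the ratio of two regular
    morphisms satisfying it is central (twisted_ratio_at), a central factor may
    be added to such a morphism (twisted_mul_central_at), and the action on the
    center is associative (center_act_at). The cocycle condition means that the
    pre-obstruction is trivial (cocycle_iff), and multiplying s by a central
    cochain t multiplies its pre-obstruction by the coboundary of t
    (pre_obstruction_mul).

    If the obstruction of sigma is the coboundary of t, then sigma times the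
    inverse of t has trivial obstruction, hence is the required alpha.
    Conversely, if alpha exists, the central cochain t with sigma = alpha t has
    the obstruction of sigma as its coboundary. It then remains to see that a
    coboundary is a normalized cocycle: this is the cancellation of the twenty
    factors of a double coboundary in pairs (cobound3_cobound2), and the
    cancellation of the two cofaces that survive a degeneracy
    (normalized_cobound2). *)

(** * Planar equations in a strict monoidal category *)

Section Planar.
Variable C : smc.
Implicit Types (A B D E : Ob C) (f g : Mor C).

Lemma composable A B B' D f g :
  hom A B f -> hom B' D g -> B = B' -> tgt f = src g.
Proof. by move=> [_ <-] [<- _]. Qed.

Lemma comp1m A B f : hom A B f -> B ∘ f = f.
Proof. by move=> [_ <-]; rewrite mcomp1m. Qed.

Lemma compm1 A B f : hom A B f -> f ∘ A = f.
Proof. by move=> [<- _]; rewrite mcompm1. Qed.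

(** Object expressions keep their bracketing, so that a denotation is
    convertible to the term it was read from. *)
Inductive oexp := OK | OA of nat | OT of oexp & oexp.

Fixpoint flat e :=
  match e with OK => [::] | OA i => [:: i] | OT a b => flat a ++ flat b end.

Variable oe : seq (Ob C).

Fixpoint den_o e : Ob C :=
  match e with OK => K | OA i => nth K oe i | OT a b => den_o a ⊠ den_o b end.

Definition ob_of (w : seq nat) : Ob C := foldr (fun i => otens (nth K oe i)) K w.

Lemma ob_cat u v : ob_of (u ++ v) = ob_of u ⊠ ob_of v.
Proof. by elim: u => [|i u IH] /=; rewrite ?otensKA // IH otensA. Qed.

Lemma den_flat e : den_o e = ob_of (flat e).
Proof. by elim: e => //= [i|a -> b ->]; rewrite ?otensAK ?ob_cat. Qed.

Record gen := Gen {
  gmor : Mor C; gsrc : oexp; gtgt : oexp;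
  gen_hom : hom (den_o gsrc) (den_o gtgt) gmor }.

Variable ge : seq gen.

Definition gen0 : gen := @Gen (idm K) OK OK (hom_idm K).
Definition gn i := nth gen0 ge i.
Definition gs i := flat (gsrc (gn i)).
Definition gt i := flat (gtgt (gn i)).

Inductive tm := TI of oexp | TG of nat | TC of tm & tm | TT of tm & tm.

Fixpoint den t : Mor C :=
  match t with
  | TI e => idm (den_o e)
  | TG i => gmor (gn i)
  | TC t1 t2 => den t1 ∘ den t2
  | TT t1 t2 => den t1 ⊗ den t2
  end.

Fixpoint ty t : option (seq nat * seq nat) :=
  match t with
  | TI e => Some (flat e, flat e)
  | TG i => Some (gs i, gt i)
  | TC t1 t2 =>
    if (ty t1, ty t2) is (Some (b', d), Some (a, b)) then
      if b == b' then Some (a, d) else None else None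
  | TT t1 t2 =>
    if (ty t1, ty t2) is (Some (a, b), Some (a', b'))
    then Some (a ++ a', b ++ b') else None
  end.

(** (l, i, r) stands for id_l ⊗ g_i ⊗ id_r, and a word of layers is listed in
    the order of application. *)
Definition layer := (seq nat * nat * seq nat)%type.
Definition lsrc (x : layer) := x.1.1 ++ gs x.1.2 ++ x.2.
Definition ltgt (x : layer) := x.1.1 ++ gt x.1.2 ++ x.2.
Definition dl (x : layer) : Mor C :=
  ob_of x.1.1 ⊗ gmor (gn x.1.2) ⊗ ob_of x.2.

Lemma hom_dl x : hom (ob_of (lsrc x)) (ob_of (ltgt x)) (dl x).
Proof.
rewrite /lsrc /ltgt !ob_cat !otensA /gs /gt -!den_flat.
by do 2?apply: hom_mtens; do ?apply: hom_idm; apply: gen_hom.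
Qed.

Fixpoint dls a (s : seq layer) : Mor C :=
  if s is x :: s' then dls (ltgt x) s' ∘ dl x else idm (ob_of a).

Fixpoint okl a (s : seq layer) b : bool :=
  if s is x :: s' then (a == lsrc x) && okl (ltgt x) s' b else a == b.

Lemma hom_dls a s b : okl a s b -> hom (ob_of a) (ob_of b) (dls a s).
Proof.
elim: s a => [|x s IH] a /=; first by move/eqP=> ->; apply: hom_idm.
by case/andP=> /eqP-> /IH h; apply: hom_mcomp (hom_dl x) h _.
Qed.

Lemma okl_cat a b d s t : okl a s b -> okl b t d -> okl a (s ++ t) d.
Proof.
elim: s a => [|x s IH] a /=; first by move/eqP=> ->.
by case/andP=> -> /= /IH h /h.
Qed.

Lemma dls_cat a b d s t : okl a s b -> okl b t d ->
  dls a (s ++ t) = dls b t ∘ dls a s.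
Proof.
move=> + ht; elim: s a => [|x s IH] a /=.
  by move/eqP=> ->; rewrite (compm1 (hom_dls ht)).
case/andP=> _ h; rewrite (IH _ h) mcompA //.
  exact: composable (hom_dl x) (hom_dls h) _.
exact: composable (hom_dls h) (hom_dls ht) _.
Qed.

Definition wh l r (x : layer) : layer := (l ++ x.1.1, x.1.2, x.2 ++ r).

Lemma okl_wh l r a b s :
  okl a s b -> okl (l ++ a ++ r) (map (wh l r) s) (l ++ b ++ r).
Proof.
elim: s a => [|x s IH] a /=; first by move/eqP=> ->.
case/andP=> /eqP-> /IH; rewrite /lsrc /ltgt /= -!catA => ->.
by rewrite eqxx.
Qed.

Lemma dls_wh l r a b s : okl a s b ->
  dls (l ++ a ++ r) (map (wh l r) s) = ob_of l ⊗ dls a s ⊗ ob_of r.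
Proof.
elim: s a => [|x s IH] a /=.
  by rewrite !ob_cat !mtens_idm otensA.
case/andP=> _ h.
have e1 : (ltgt (wh l r x)) = l ++ ltgt x ++ r by rewrite /ltgt /= -!catA.
have e2 : dl (wh l r x) = ob_of l ⊗ dl x ⊗ ob_of r.
  by rewrite /dl /= !ob_cat -!mtens_idm !mtensA.
have hx := hom_dl x; have hs := hom_dls h.
have c1 := composable hx hs erefl.
rewrite e1 (IH _ h) e2 -mtens_mcomp; first last.
- by rewrite src_idm tgt_idm.
- by rewrite tgt_mtens src_mtens c1 tgt_idm src_idm.
rewrite (comp1m (hom_idm _)) -mtens_mcomp ?(comp1m (hom_idm _)) //.
by rewrite src_idm tgt_idm.
Qed.

Fixpoint nf t : seq layer :=
  match t with
  | TI e => [::]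
  | TG i => [:: ([::], i, [::])]
  | TC t1 t2 => nf t2 ++ nf t1
  | TT t1 t2 =>
    if (ty t1, ty t2) is (Some (a, b), Some (a', b'))
    then map (wh [::] a') (nf t1) ++ map (wh b [::]) (nf t2) else [::]
  end.

Lemma nf_sound t a b : ty t = Some (a, b) ->
  okl a (nf t) b /\ den t = dls a (nf t).
Proof.
elim: t a b => [e|i|g IHg f IHf|f IHf g IHg] a b.
- by case=> <- <- /=; rewrite eqxx den_flat.
- case=> <- <- /=; rewrite /lsrc /ltgt /= !cats0 !eqxx; split=> //.
  have h : hom (ob_of (gs i)) (ob_of (gt i)) (gmor (gn i)).
    by rewrite -!den_flat; apply: gen_hom.
  by rewrite /dl /= mtensmK mtensKm (comp1m h).
- move=> /=; case: (ty g) IHg => // -[b' d] /(_ _ _ erefl) [og eg].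
  case: (ty f) IHf => // -[a' c] /(_ _ _ erefl) [of' ef].
  case: eqP => // ec [<- <-]; subst c.
  by split; [apply: okl_cat of' og | rewrite (dls_cat of' og) ef eg].
- move=> /=.
  case ef: (ty f) IHf => [[a1 b1]|] // /(_ _ _ erefl) [of' df].
  case eg: (ty g) IHg => [[a2 b2]|] // /(_ _ _ erefl) [og dg].
  case=> <- <-.
  have h1 := okl_wh [::] a2 of'; have h2 := okl_wh b1 [::] og.
  rewrite !cats0 /= in h1 h2.
  split; first exact: okl_cat h1 h2.
  have hf := hom_dls of'; have hg := hom_dls og.
  rewrite (dls_cat h1 h2); have := dls_wh [::] a2 of'; rewrite /= mtensKm => ->.
  have := dls_wh b1 [::] og; rewrite !cats0 /= mtensmK => ->.
  rewrite -mtens_mcomp.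
  + by rewrite (comp1m hf) (compm1 hg) df dg.
  + by rewrite src_idm; case: hf.
  by rewrite tgt_idm; case: hg.
Qed.

(** The interchange law, oriented so that the layer acting further to the left
    comes first; iterating it sorts the independent layers of a word. *)
Definition exch (x y : layer) : option (layer * layer) :=
  let: (l1, i, r1) := x in let: (l2, j, r2) := y in
  let p := l2 ++ gs j in
  let m := drop (size p) l1 in
  if (l1 == p ++ m) && (r2 == m ++ gt i ++ r1) then
    Some ((l2, j, m ++ gs i ++ r1), (l2 ++ gt j ++ m, i, r1))
  else None.

Lemma exch_sound x y x' y' : exch x y = Some (y', x') -> ltgt x = lsrc y ->
  [/\ lsrc y' = lsrc x, ltgt y' = lsrc x', ltgt x' = ltgt y
    & dl y ∘ dl x = dl x' ∘ dl y'].
Proof.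
case: x y => [[l1 i] r1] [[l2 j] r2]; rewrite /exch.
set m := drop _ _; case: andP => // -[/eqP e1 /eqP e2] [<- <-] _.
move: m e1 e2 => m -> ->.
rewrite /lsrc /ltgt /= -!catA; split=> //.
rewrite /dl /= !ob_cat -!mtens_idm !mtensA.
set gi := gmor (gn i); set gj := gmor (gn j).
have hi : hom (ob_of (gs i)) (ob_of (gt i)) gi.
  by rewrite -!den_flat; apply: gen_hom.
have hj : hom (ob_of (gs j)) (ob_of (gt j)) gj.
  by rewrite -!den_flat; apply: gen_hom.
have [si ti] := hi; have [sj tj] := hj.
have idE (A : Ob C) : idm A ∘ idm A = idm A by rewrite (comp1m (hom_idm A)).
rewrite -!mtens_mcomp ?(src_mtens, tgt_mtens, src_idm, tgt_idm, si, ti, sj, tj) //.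
by rewrite !idE (comp1m hi) (comp1m hj) (compm1 hi) (compm1 hj).
Qed.

Fixpoint bubble (s : seq layer) : seq layer :=
  if s is x :: s' then
    if bubble s' is y :: s'' then
      if exch x y is Some (y', x') then y' :: x' :: s'' else x :: y :: s''
    else [:: x]
  else [::].

Lemma bubble_sound a s b :
  okl a s b -> okl a (bubble s) b /\ dls a s = dls a (bubble s).
Proof.
elim: s a => //= x s IH a /andP[/eqP-> /IH [ok ->]].
case: (bubble s) ok => [|y s'] /=; first by rewrite eqxx.
case/andP=> /eqP exy ok.
case E: (exch x y) => [[y' x']|] /=; last by rewrite exy !eqxx.
have [-> e1 e2 e3] := exch_sound E exy; rewrite e1 !eqxx e2; split=> //.
have hs := hom_dls ok.
rewrite -!mcompA ?e3 //.
- exact: composable (hom_dl y') (hom_dl x') (f_equal _ e1).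
- by apply: composable (hom_dl x') hs _; rewrite e2.
- exact: composable (hom_dl x) (hom_dl y) (f_equal _ exy).
- exact: composable (hom_dl y) hs _.
Qed.

Lemma iter_bubble_sound n a s b : okl a s b ->
  okl a (iter n bubble s) b /\ dls a s = dls a (iter n bubble s).
Proof.
move=> ok; elim: n => //= n [ok' ->].
by have [? ->] := bubble_sound ok'.
Qed.

Definition planar_eq t1 t2 : bool :=
  let n1 := nf t1 in let n2 := nf t2 in
  if (ty t1, ty t2) is (Some p, Some q) then
    (p == q) && (iter (size n1) bubble n1 == iter (size n2) bubble n2)
  else false.

(** Each exchange is an instance of the interchange law, so a word and its
    sorted form denote the same morphism. *)
Lemma planar_sound t1 t2 : planar_eq t1 t2 -> den t1 = den t2.
Proof.
rewrite /planar_eq.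
case E1: (ty t1) => [[a b]|] //; case E2: (ty t2) => [q|] //.
case/andP=> /eqP ?; subst q => /eqP e.
have [o1 ->] := nf_sound E1; have [o2 ->] := nf_sound E2.
have [_ ->] := iter_bubble_sound (size (nf t1)) o1.
have [_ ->] := iter_bubble_sound (size (nf t2)) o2.
by rewrite e.
Qed.

End Planar.

Create HintDb homs.
#[export] Hint Resolve hom_PiL hom_Pi_right hom_comul2 hom_comuln hom_muln
  hom_counit hom_comul hom_antipode hom_unit hom_mul hom_u1 hom_u hom_P_mor
  hom_braid hom_center : homs.

Ltac ob_strict := rewrite /= ?(otensA, otensKA, otensAK); reflexivity.
Ltac hom_leaf := first [eassumption | solve [eauto 3 with homs nocore]].
Ltac hom_infer :=
  lazymatch goal with
  | |- hom _ _ (mcomp _ _) => eapply hom_mcomp; [hom_infer | hom_infer | ob_strict]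
  | |- hom _ _ (mtens _ _) => eapply hom_mtens; [hom_infer | hom_infer]
  | |- hom _ _ (idm _) => apply: hom_idm
  | |- hom _ _ (braid _ _) => apply: hom_braid
  | |- _ => hom_leaf
  end.
Ltac typecheck := eapply hom_eq; [hom_infer | ob_strict | ob_strict].
Ltac compose_ok := eapply composable; [hom_infer | hom_infer | ob_strict].

(* Composition is a total operation, hence its laws have side conditions; these
   hints let done discharge them. *)
#[export] Hint Extern 0 (hom _ _ _) => solve [typecheck] : core.
#[export] Hint Extern 0 (tgt _ = src _) => solve [compose_ok] : core.

(** The reader finds the source and the target of an atom in the context. *)
Ltac pose_homs t :=
  lazymatch t with
  | mcomp ?g ?f => pose_homs g; pose_homs f
  | mtens ?g ?f => pose_homs g; pose_homs f
  | idm _ => idtac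
  | ?g => lazymatch goal with
          | _ : hom _ _ g |- _ => idtac
          | |- _ => let X := fresh "hgen" in
                    eassert (X : hom _ _ g) by hom_infer
          end
  end.

Ltac mem_add x l :=
  lazymatch l with
  | nil => constr:(cons x nil)
  | cons x _ => l
  | cons ?y ?l' => let l2 := mem_add x l' in constr:(cons y l2)
  end.
Ltac index_of x l :=
  lazymatch l with
  | cons x _ => constr:(0)
  | cons _ ?l' => let n := index_of x l' in constr:(S n)
  end.
Ltac add_ob A l :=
  lazymatch A with
  | otens ?X ?Y => let l1 := add_ob X l in add_ob Y l1
  | K => l
  | _ => mem_add A l
  end.
Ltac reify_ob A l :=
  lazymatch A with
  | otens ?X ?Y => let a := reify_ob X l in let b := reify_ob Y l in
                   constr:(OT a b)
  | K => constr:(OK)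
  | _ => let n := index_of A l in constr:(OA n)
  end.
Ltac add_obs t l :=
  lazymatch t with
  | mcomp ?g ?f => let l1 := add_obs g l in add_obs f l1
  | mtens ?g ?f => let l1 := add_obs g l in add_obs f l1
  | idm ?A => add_ob A l
  | ?g => lazymatch goal with
          | _ : hom ?A ?B g |- _ => let l1 := add_ob A l in add_ob B l1 end
  end.
Ltac add_gens t l :=
  lazymatch t with
  | mcomp ?g ?f => let l1 := add_gens g l in add_gens f l1
  | mtens ?g ?f => let l1 := add_gens g l in add_gens f l1
  | idm _ => l
  | ?g => mem_add g l
  end.
Ltac mk_gens C l ol :=
  lazymatch l with
  | nil => constr:(@nil (@gen C ol))
  | cons ?g ?l' =>
    let r := mk_gens C l' ol in
    lazymatch goal with
    | X : hom ?A ?B g |- _ =>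
      let a := reify_ob A ol in let b := reify_ob B ol in
      constr:(cons (@Gen C ol g a b X) r)
    end
  end.
Ltac reify t gl ol :=
  lazymatch t with
  | mcomp ?g ?f => let a := reify g gl ol in let b := reify f gl ol in
                   constr:(TC a b)
  | mtens ?g ?f => let a := reify g gl ol in let b := reify f gl ol in
                   constr:(TT a b)
  | idm ?A => let a := reify_ob A ol in constr:(TI a)
  | ?g => let n := index_of g gl in constr:(TG n)
  end.
(** Proves the equations that hold in every strict monoidal category, with the
    braidings and all structure morphisms as opaque generators. *)
Ltac planar :=
  lazymatch goal with
  | |- @eq (Mor ?C) ?t1 ?t2 =>
    pose_homs t1; pose_homs t2;
    let ol := add_obs t1 (@nil (Ob C)) in
    let ol := add_obs t2 ol in
    let gl := add_gens t1 (@nil (Mor C)) in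
    let gl := add_gens t2 gl in
    let ge := mk_gens C gl ol in
    let a := reify t1 gl ol in
    let b := reify t2 gl ol in
    refine (@planar_sound C ol ge a b _); vm_compute; reflexivity
  end.

(** * Coherence of the symmetry *)

Section Symmetry.
Variable C : smc.
Implicit Types (A B D E X : Ob C) (f g x : Mor C).

Lemma braid_nat A A' X X' f g : hom A A' f -> hom X X' g ->
  braid A' X' ∘ (f ⊗ g) = (g ⊗ f) ∘ braid A X.
Proof. by move=> [<- <-] [<- <-]; apply: braid_natural. Qed.

Lemma braid_natl A A' X f : hom A A' f ->
  braid A' X ∘ (f ⊗ X) = (X ⊗ f) ∘ braid A X.
Proof. by move=> h; apply: braid_nat. Qed.

Lemma braid_natr A X X' g : hom X X' g ->
  braid A X' ∘ (A ⊗ g) = (g ⊗ A) ∘ braid A X.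
Proof. by move=> h; apply: braid_nat. Qed.

(** A braiding is inverse to the opposite one, so this is the inverse of the
    given hexagon. *)
Lemma braid_hexagon' A B D :
  braid (A ⊠ B) D = (braid A D ⊗ B) ∘ (A ⊗ braid B D).
Proof.
have e : braid D (A ⊠ B) ∘ ((braid A D ⊗ B) ∘ (A ⊗ braid B D))
         = idm (A ⊠ B ⊠ D).
  rewrite braid_hexagon.
  transitivity ((A ⊗ braid D B) ∘ ((braid D A ∘ braid A D) ⊗ B)
                ∘ (A ⊗ braid B D)); first by planar.
  rewrite braidK; transitivity (A ⊗ (braid D B ∘ braid B D)); first by planar.
  by rewrite braidK; planar.
transitivity (braid (A ⊠ B) D ∘ (braid D (A ⊠ B) ∘
                ((braid A D ⊗ B) ∘ (A ⊗ braid B D)))).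
  by rewrite e; planar.
rewrite mcompA // braidK; planar.
Qed.

(** The hexagon makes this braiding idempotent, and it is invertible. *)
Lemma braid_A_K A : braid A K = A.
Proof.
have e : braid A K ∘ braid A K = braid A K.
  transitivity (braid A (K ⊠ K)); last by rewrite otensKA.
  by rewrite braid_hexagon; planar.
have b := braidK A K; rewrite otensAK in b.
transitivity (braid K A ∘ (braid A K ∘ braid A K)).
  by rewrite mcompA // b; planar.
by rewrite e.
Qed.

Lemma braid_K_A A : braid K A = A.
Proof.
have b := braidK K A; rewrite braid_A_K otensKA in b.
by rewrite -b; planar.
Qed.

(** Braidings disappear from computations with elements K -> X, because those
    involving the unit object are identities. *)
Lemma braid_elr A X x : hom K X x -> braid A X ∘ (A ⊗ x) = x ⊗ A.
Proof. by move=> h; rewrite (braid_natr A h) braid_A_K; planar. Qed.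

Lemma braid_ell A X x : hom K X x -> braid X A ∘ (x ⊗ A) = A ⊗ x.
Proof. by move=> h; rewrite (braid_natl A h) braid_K_A; planar. Qed.

Lemma braid_el X Y x y : hom K X x -> hom K Y y -> braid X Y ∘ (x ⊗ y) = y ⊗ x.
Proof.
move=> hx hy; rewrite (braid_nat hx hy) braid_A_K; planar.
Qed.

End Symmetry.

(** * Cocommutative comonoids *)

Record comonoid (C : smc) := Comonoid {
  com_ob :> Ob C;
  eps : Mor C;
  del : Mor C;
  hom_eps : hom com_ob K eps;
  hom_del : hom com_ob (com_ob ⊠ com_ob) del;
  epsl : (eps ⊗ com_ob) ∘ del = com_ob;
  epsr : (com_ob ⊗ eps) ∘ del = com_ob;
  delA : (del ⊗ com_ob) ∘ del = (com_ob ⊗ del) ∘ del;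
  delC : braid com_ob com_ob ∘ del = del
}.
#[export] Hint Resolve hom_eps hom_del : homs.

Section TensorComonoid.
Variable C : smc.

Variables D E : comonoid C.
Notation dD := (del D).
Notation dE := (del E).
Let dDE := tensor_comul D E dD dE.
Let eDE := eps D ⊗ eps E.

Let hom_eDE : hom (D ⊠ E) K eDE. Proof. by rewrite /eDE; typecheck. Qed.
Let hom_dDE : hom (D ⊠ E) (D ⊠ E ⊠ (D ⊠ E)) dDE.
Proof. by rewrite /dDE /tensor_comul; typecheck. Qed.

Let tepsl : (eDE ⊗ (D ⊠ E)) ∘ dDE = D ⊠ E.
Proof.
rewrite /dDE /tensor_comul /eDE.
transitivity ((eps D ⊗ ((eps E ⊗ D) ∘ braid D E) ⊗ E) ∘ (dD ⊗ dE)); first by planar.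
rewrite -(braid_natr D (hom_eps E)) braid_A_K.
transitivity (((eps D ⊗ D) ∘ dD) ⊗ ((eps E ⊗ E) ∘ dE)); first by planar.
by rewrite !epsl; planar.
Qed.

Let tepsr : ((D ⊠ E) ⊗ eDE) ∘ dDE = D ⊠ E.
Proof.
rewrite /dDE /tensor_comul /eDE.
transitivity ((D ⊗ ((E ⊗ eps D) ∘ braid D E) ⊗ eps E) ∘ (dD ⊗ dE)); first by planar.
rewrite -(braid_natl E (hom_eps D)) braid_K_A.
transitivity (((D ⊗ eps D) ∘ dD) ⊗ ((E ⊗ eps E) ∘ dE)); first by planar.
by rewrite !epsr; planar.
Qed.

Let tdelA : (dDE ⊗ (D ⊠ E)) ∘ dDE = ((D ⊠ E) ⊗ dDE) ∘ dDE.
Proof.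
rewrite /dDE /tensor_comul.
transitivity ((D ⊗ braid D E ⊗ E ⊗ D ⊗ E) ∘
  (dD ⊗ ((dE ⊗ D) ∘ braid D E) ⊗ E) ∘ (dD ⊗ dE)); first by planar.
rewrite -(braid_natr D (hom_del E)) braid_hexagon.
transitivity ((D ⊗ braid D E ⊗ E ⊗ D ⊗ E) ∘ (D ⊗ D ⊗ E ⊗ braid D E ⊗ E) ∘
   (D ⊗ D ⊗ braid D E ⊗ E ⊗ E) ∘ (((dD ⊗ D) ∘ dD) ⊗ ((dE ⊗ E) ∘ dE))).
  by planar.
rewrite !delA.
transitivity ((D ⊗ E ⊗ D ⊗ braid D E ⊗ E) ∘
  (D ⊗ ((E ⊗ dD) ∘ braid D E) ⊗ dE) ∘ (dD ⊗ dE)); last by planar.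
rewrite -(braid_natl E (hom_del D)) braid_hexagon'.
by planar.
Qed.

Let tdelC : braid (D ⊠ E) (D ⊠ E) ∘ dDE = dDE.
Proof.
rewrite /dDE /tensor_comul braid_hexagon' !braid_hexagon.
transitivity ((D ⊗ braid D E ⊗ E) ∘ (braid D D ⊗ braid E E)
  ∘ (D ⊗ (braid E D ∘ braid D E) ⊗ E) ∘ (dD ⊗ dE)).
  by planar.
rewrite braidK.
transitivity ((D ⊗ braid D E ⊗ E) ∘ ((braid D D ∘ dD) ⊗ (braid E E ∘ dE))).
  by planar.
by rewrite !delC.
Qed.

Definition tensor_comonoid : comonoid C :=
  Comonoid hom_eDE hom_dDE tepsl tepsr tdelA tdelC.

End TensorComonoid.

(** * Adjoining a generic element *)

Section CoKleisli.
Variables (C : smc) (G : comonoid C).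
Implicit Types (A B D X Y : Ob C) (f g h : Mor C).

(** The operations of the coKleisli category of G ⊗ -: a morphism from A to B
    is a morphism from G ⊗ A to B in C, and the comultiplication hands G out
    to the factors. The tensor product is the composite of the two whiskerings,
    in either order. *)
Definition kcomp A g f := g ∘ (G ⊗ f) ∘ (del G ⊗ A).
Definition kwhr f X := f ⊗ X.
Definition kwhl A g X := (A ⊗ g) ∘ (braid G A ⊗ X).
Definition ktens A f X g := (f ⊗ g) ∘ (G ⊗ braid G A ⊗ X) ∘ (del G ⊗ A ⊗ X).

Lemma hom_kcomp A B D g f :
  hom (G ⊠ A) B f -> hom (G ⊠ B) D g -> hom (G ⊠ A) D (kcomp A g f).
Proof. by rewrite /kcomp => hf hg; typecheck. Qed.

Lemma hom_kwhl A X Y g :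
  hom (G ⊠ X) Y g -> hom (G ⊠ (A ⊠ X)) (A ⊠ Y) (kwhl A g X).
Proof. by rewrite /kwhl => hg; typecheck. Qed.

Lemma hom_ktens A A' X X' f g :
  hom (G ⊠ A) A' f -> hom (G ⊠ X) X' g ->
  hom (G ⊠ (A ⊠ X)) (A' ⊠ X') (ktens A f X g).
Proof. by rewrite /ktens => hf hg; typecheck. Qed.

Lemma kcompA A B D E f g h :
  hom (G ⊠ A) B f -> hom (G ⊠ B) D g -> hom (G ⊠ D) E h ->
  kcomp A h (kcomp A g f) = kcomp A (kcomp B h g) f.
Proof.
rewrite /kcomp => hf hg hh.
transitivity (h ∘ (G ⊗ g) ∘ (G ⊗ G ⊗ f) ∘ (((G ⊗ del G) ∘ del G) ⊗ A)).
  by planar.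
by rewrite -delA; planar.
Qed.

Lemma kcomp1m A B f : hom (G ⊠ A) B f -> kcomp A (eps G ⊗ B) f = f.
Proof.
rewrite /kcomp => hf; transitivity (f ∘ (((eps G ⊗ G) ∘ del G) ⊗ A)); first planar.
by rewrite epsl; planar.
Qed.

Lemma kcompm1 A B f : hom (G ⊠ A) B f -> kcomp A f (eps G ⊗ A) = f.
Proof.
rewrite /kcomp => hf; transitivity (f ∘ (((G ⊗ eps G) ∘ del G) ⊗ A)); first planar.
by rewrite epsr; planar.
Qed.

Lemma kcomp_const A B D f g : hom A B f -> hom (G ⊠ B) D g ->
  kcomp A g (eps G ⊗ f) = g ∘ (G ⊗ f).
Proof.
rewrite /kcomp => hf hg.
transitivity (g ∘ (G ⊗ f) ∘ (((G ⊗ eps G) ∘ del G) ⊗ A)); first planar.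
by rewrite epsr; planar.
Qed.

Lemma kconst_comp A B D f g : hom (G ⊠ A) B f -> hom B D g ->
  kcomp A (eps G ⊗ g) f = g ∘ f.
Proof.
rewrite /kcomp => hf hg.
transitivity (g ∘ f ∘ (((eps G ⊗ G) ∘ del G) ⊗ A)); first planar.
by rewrite epsl; planar.
Qed.

(** The two orders of whiskering agree because G is cocommutative. *)
Lemma ktensE A A' X X' f g : hom (G ⊠ A) A' f -> hom (G ⊠ X) X' g ->
  kcomp (A ⊠ X) (kwhl A' g X) (kwhr f X) = ktens A f X g.
Proof.
rewrite /kcomp /kwhl /kwhr /ktens => hf hg.
transitivity ((A' ⊗ g) ∘ ((braid G A' ∘ (G ⊗ f)) ⊗ X) ∘ (del G ⊗ A ⊗ X)).
  by planar.
rewrite (braid_natr G hf) braid_hexagon.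
transitivity ((f ⊗ g) ∘ (G ⊗ braid G A ⊗ X) ∘ ((braid G G ∘ del G) ⊗ A ⊗ X)).
  by planar.
by rewrite delC.
Qed.

Lemma ktensE' A A' X X' f g : hom (G ⊠ A) A' f -> hom (G ⊠ X) X' g ->
  kcomp (A ⊠ X) (kwhr f X') (kwhl A g X) = ktens A f X g.
Proof. by rewrite /kcomp /kwhl /kwhr /ktens => hf hg; planar. Qed.

Lemma kwhr_comp A B D f g X : hom (G ⊠ A) B f -> hom (G ⊠ B) D g ->
  kwhr (kcomp A g f) X = kcomp (A ⊠ X) (kwhr g X) (kwhr f X).
Proof. by rewrite /kcomp /kwhr => hf hg; planar. Qed.

Lemma kwhl_comp A X Y Z f g : hom (G ⊠ X) Y f -> hom (G ⊠ Y) Z g ->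
  kwhl A (kcomp X g f) X = kcomp (A ⊠ X) (kwhl A g Y) (kwhl A f X).
Proof.
rewrite /kcomp /kwhl => hf hg.
transitivity ((A ⊗ g) ∘ (A ⊗ G ⊗ f) ∘ (((A ⊗ del G) ∘ braid G A) ⊗ X)).
  by planar.
rewrite -(braid_natl A (hom_del G)) braid_hexagon'; planar.
Qed.

(** Whiskering is functorial, so only the two middle factors have to be
    exchanged. *)
Lemma ktens_comp A A' A2 X X' X2 f f' g g' :
  hom (G ⊠ A) A' f -> hom (G ⊠ A') A2 g ->
  hom (G ⊠ X) X' f' -> hom (G ⊠ X') X2 g' ->
  ktens A (kcomp A g f) X (kcomp X g' f')
  = kcomp (A ⊠ X) (ktens A' g X' g') (ktens A f X f').
Proof.
move=> hf hg hf' hg'.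
have [h1 h2] := (hom_kcomp hf hg, hom_kcomp hf' hg').
rewrite -(ktensE h1 h2) (kwhr_comp X hf hg) (kwhl_comp A2 hf' hg').
rewrite -(ktensE hf hf') -(ktensE hg hg').
have a1 : hom (G ⊠ (A ⊠ X)) (A' ⊠ X) (kwhr f X) by rewrite /kwhr; typecheck.
have a2 : hom (G ⊠ (A' ⊠ X)) (A2 ⊠ X) (kwhr g X) by rewrite /kwhr; typecheck.
have a3 : hom (G ⊠ (A' ⊠ X')) (A2 ⊠ X') (kwhr g X') by rewrite /kwhr; typecheck.
have b1 := hom_kwhl A2 hg'; have b2 := hom_kwhl A2 hf'; have b3 := hom_kwhl A' hf'.
rewrite -(kcompA (hom_kcomp a1 a2) b2 b1) (kcompA a1 a2 b2).
rewrite (ktensE hg hf') -(ktensE' hg hf').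
rewrite -(kcompA a1 b3 a3) (kcompA (hom_kcomp a1 b3) a3 b1).
by [].
Qed.

Lemma ktensA A A' X X' Y Y' f g h :
  hom (G ⊠ A) A' f -> hom (G ⊠ X) X' g -> hom (G ⊠ Y) Y' h ->
  ktens A f (X ⊠ Y) (ktens X g Y h) = ktens (A ⊠ X) (ktens A f X g) Y h.
Proof.
rewrite /ktens => hf hg hh.
transitivity ((f ⊗ g ⊗ h) ∘ (G ⊗ A ⊗ G ⊗ X ⊗ G ⊗ Y)
  ∘ (G ⊗ A ⊗ G ⊗ braid G X ⊗ Y)
  ∘ (G ⊗ ((A ⊗ del G) ∘ braid G A) ⊗ X ⊗ Y) ∘ (del G ⊗ A ⊗ X ⊗ Y)).
  by planar.
rewrite -(braid_natl A (hom_del G)) braid_hexagon' braid_hexagon.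
transitivity ((f ⊗ g ⊗ h)
  ∘ (G ⊗ A ⊗ G ⊗ braid G X ⊗ Y)
  ∘ (G ⊗ braid G A ⊗ G ⊗ X ⊗ Y)
  ∘ (G ⊗ G ⊗ braid G A ⊗ X ⊗ Y) ∘ (((G ⊗ del G) ∘ del G) ⊗ A ⊗ X ⊗ Y)).
  by planar.
rewrite -delA; planar.
Qed.

Lemma ktensKm X Y g : hom (G ⊠ X) Y g -> ktens K (eps G ⊗ K) X g = g.
Proof.
rewrite /ktens => h; rewrite braid_A_K.
transitivity (g ∘ (((eps G ⊗ G) ∘ del G) ⊗ X)); first by planar.
by rewrite epsl; planar.
Qed.

Lemma ktensmK X Y g : hom (G ⊠ X) Y g -> ktens X g K (eps G ⊗ K) = g.
Proof.
rewrite /ktens => h.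
transitivity (g ∘ (G ⊗ ((X ⊗ eps G) ∘ braid G X)) ∘ (del G ⊗ X)); first by planar.
rewrite -(braid_natl X (hom_eps G)) braid_K_A.
transitivity (g ∘ (((G ⊗ eps G) ∘ del G) ⊗ X)); first by planar.
by rewrite epsr; planar.
Qed.

Lemma ktens_const A A' X X' f g : hom A A' f -> hom X X' g ->
  ktens A (eps G ⊗ f) X (eps G ⊗ g) = eps G ⊗ (f ⊗ g).
Proof.
rewrite /ktens => hf hg.
transitivity ((eps G ⊗ f ⊗ g) ∘ (G ⊗ ((A ⊗ eps G) ∘ braid G A) ⊗ X)
   ∘ (del G ⊗ A ⊗ X)); first by planar.
rewrite -(braid_natl A (hom_eps G)) braid_K_A.
transitivity (((f ⊗ g) ∘ (((eps G ⊗ eps G) ∘ del G) ⊗ A ⊗ X))); first by planar.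
have -> : (eps G ⊗ eps G) ∘ del G = eps G.
  transitivity (eps G ∘ ((eps G ⊗ G) ∘ del G)); first by planar.
  by rewrite epsl; planar.
by planar.
Qed.

Lemma kbraid_nat A A' X X' f g : hom (G ⊠ A) A' f -> hom (G ⊠ X) X' g ->
  kcomp (A ⊠ X) (eps G ⊗ braid A' X') (ktens A f X g)
  = kcomp (A ⊠ X) (ktens X g A f) (eps G ⊗ braid A X).
Proof.
move=> hf hg; have h1 := hom_ktens hf hg; have h2 := hom_ktens hg hf.
rewrite (kconst_comp h1 (hom_braid _ _)) (kcomp_const (hom_braid _ _) h2).
rewrite /ktens.
transitivity (braid A' X' ∘ (f ⊗ g) ∘ (G ⊗ braid G A ⊗ X) ∘ (del G ⊗ A ⊗ X)).
  by planar.
rewrite (braid_nat hf hg) braid_hexagon' !braid_hexagon.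
transitivity ((g ⊗ f) ∘ (G ⊗ braid G X ⊗ A) ∘ (braid G G ⊗ braid A X)
  ∘ (G ⊗ (braid A G ∘ braid G A) ⊗ X) ∘ (del G ⊗ A ⊗ X)); first by planar.
rewrite braidK.
transitivity ((g ⊗ f) ∘ (G ⊗ braid G X ⊗ A) ∘ ((braid G G ∘ del G) ⊗ braid A X)).
  by planar.
by rewrite delC; planar.
Qed.

Record kmor := KMor {
  ksrc : Ob C; ktgt : Ob C; kval : Mor C; khom : hom (G ⊠ ksrc) ktgt kval }.

Lemma kmor_eq (f g : kmor) :
  ksrc f = ksrc g -> ktgt f = ktgt g -> kval f = kval g -> f = g.
Proof.
case: f g => [a b f hf] [a' b' g hg] /= e1 e2 e3.
by subst a' b' g; rewrite (proof_irrelevance _ hf hg).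
Qed.

Lemma hom_kid A : hom (G ⊠ A) A (eps G ⊗ A). Proof. by typecheck. Qed.
Definition kid A : kmor := KMor (hom_kid A).

Lemma hom_const f : hom (G ⊠ src f) (tgt f) (eps G ⊗ f).
Proof. by have h : hom (src f) (tgt f) f by []; typecheck. Qed.
Definition const f : kmor := KMor (hom_const f).

Lemma hom_kmcomp (g f : kmor) : ktgt f = ksrc g ->
  hom (G ⊠ ksrc f) (ktgt g) (kcomp (ksrc f) (kval g) (kval f)).
Proof.
move=> e; apply: hom_kcomp (khom f) _; rewrite e; exact: khom g.
Qed.

(** Composites of non-composable morphisms carry no information. *)
Definition kmcomp (g f : kmor) : kmor :=
  match excluded_middle_informative (ktgt f = ksrc g) with
  | left e => KMor (hom_kmcomp e)
  | right _ => f
  end.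

Lemma kmcompP (g f : kmor) : ktgt f = ksrc g ->
  [/\ ksrc (kmcomp g f) = ksrc f, ktgt (kmcomp g f) = ktgt g
    & kval (kmcomp g f) = kcomp (ksrc f) (kval g) (kval f)].
Proof. by rewrite /kmcomp; case: excluded_middle_informative. Qed.

Definition kmtens (f g : kmor) : kmor := KMor (hom_ktens (khom f) (khom g)).

Lemma khomE (f : kmor) A B : ksrc f = A -> ktgt f = B -> hom (G ⊠ A) B (kval f).
Proof. by move=> <- <-; apply: khom. Qed.

(** The coKleisli category, in which G acquires a global element K -> G.
    Computations with that element take the place of string diagrams. *)
Definition generic : smc.
Proof.
refine (@SMC (Ob C) kmor ksrc ktgt kid kmcomp K (@otens C) kmtens
  (fun A B => const (braid A B)) _ _ _ _ _ _ _ _ _ _ _ _ _ _ _ _ _ _ _ _ _ _).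
- by [].
- by [].
- by move=> g f /kmcompP[].
- by move=> g f /kmcompP[].
- move=> f; have [|e1 e2 e3] := @kmcompP (kid (ktgt f)) f; first by [].
  by apply: kmor_eq => //; rewrite e3 /= (kcomp1m (khom f)).
- move=> f; have [|e1 e2 e3] := @kmcompP f (kid (ksrc f)); first by [].
  by apply: kmor_eq => //; rewrite e3 /= (kcompm1 (khom f)).
- move=> h g f e1 e2.
  have [a1 a2 a3] := kmcompP e1; have [b1 b2 b3] := kmcompP e2.
  have [|c1 c2 c3] := @kmcompP h (kmcomp g f); first by rewrite a2.
  have [|d1 d2 d3] := @kmcompP (kmcomp h g) f; first by rewrite b1.
  apply: kmor_eq; rewrite ?c1 ?c2 ?d1 ?d2 //.
  rewrite c3 d3 a1 a3 b3 -e1.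
  apply: (kcompA (khom f) (D := ktgt g) (E := ktgt h)).
    exact: khomE.
  exact: khomE.
- exact: otensA.
- exact: otensKA.
- exact: otensAK.
- by [].
- by [].
- move=> A B; apply: kmor_eq => //=.
  by rewrite (ktens_const (hom_idm A) (hom_idm B)) mtens_idm.
- move=> g f g' f' e e'.
  have [a1 a2 a3] := kmcompP e; have [b1 b2 b3] := kmcompP e'.
  have [|c1 c2 c3] := @kmcompP (kmtens g g') (kmtens f f').
    by rewrite /= e e'.
  apply: kmor_eq; rewrite ?c1 ?c2 ?c3 /= ?a1 ?b1 ?a2 ?b2 // a3 b3 -e -e'.
  by apply: (ktens_comp (khom f) _ (khom f') _); apply: khomE => //.
- move=> f g h; apply: kmor_eq; rewrite /= ?otensA //.
  exact: ktensA (khom f) (khom g) (khom h).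
- move=> f; apply: kmor_eq; rewrite /= ?otensKA //.
  exact: ktensKm (khom f).
- move=> f; apply: kmor_eq; rewrite /= ?otensAK //.
  exact: ktensmK (khom f).
- by move=> A B /=; rewrite src_braid.
- by move=> A B /=; rewrite tgt_braid.
- move=> f g.
  have [|a1 a2 a3] := @kmcompP (const (braid (ktgt f) (ktgt g))) (kmtens f g).
    by rewrite /= src_braid.
  have [|b1 b2 b3] := @kmcompP (kmtens g f) (const (braid (ksrc f) (ksrc g))).
    by rewrite /= tgt_braid.
  apply: kmor_eq; rewrite ?a1 ?a2 ?a3 ?b1 ?b2 ?b3 /= ?src_braid ?tgt_braid //.
  exact: kbraid_nat (khom f) (khom g).
- move=> A B.
  have [|a1 a2 a3] := @kmcompP (const (braid B A)) (const (braid A B)).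
    by rewrite /= src_braid tgt_braid.
  apply: kmor_eq; rewrite ?a1 ?a2 ?a3 /= ?src_braid ?tgt_braid //.
  rewrite (kcomp_const (B := B ⊠ A) (D := A ⊠ B)) //.
  by rewrite -braidK; planar.
- move=> A B D.
  have [|a1 a2 a3] := @kmcompP (kmtens (kid B) (const (braid A D)))
      (kmtens (const (braid A B)) (kid D)).
    by rewrite /= src_braid tgt_braid otensA.
  apply: kmor_eq; rewrite ?a1 ?a2 ?a3 /= ?src_braid ?tgt_braid ?otensA //.
  rewrite (ktens_const (hom_idm B) (hom_braid A D)).
  rewrite (ktens_const (hom_braid A B) (hom_idm D)).
  rewrite (kcomp_const (B := B ⊠ A ⊠ D) (D := B ⊠ D ⊠ A)) //.
  by rewrite braid_hexagon; planar.
Defined.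

End CoKleisli.

Section Constants.
Variables (C : smc) (G : comonoid C).
Implicit Types (A B D X Y : Ob C) (f g h : Mor C).
Local Notation GC := (generic G).

Definition embed : Mor C -> Mor GC := @const C G.
Local Notation I := embed.

Lemma kvalM (g f : Mor GC) : tgt f = src g ->
  kval (g ∘ f) = kcomp G (src f : Ob C) (kval g) (kval f).
Proof. by move=> e; have [] := @kmcompP C G g f e. Qed.

Lemma embed_hom A B f : hom A B f -> hom (A : Ob GC) (B : Ob GC) (I f).
Proof. by []. Qed.

Lemma embed_idm A : I (idm A) = idm (A : Ob GC).
Proof. by apply: kmor_eq; rewrite /= ?src_idm ?tgt_idm. Qed.

Lemma embed_comp g f : tgt f = src g -> I (g ∘ f) = I g ∘ I f.
Proof.
move=> e; have e' : tgt (I f) = src (I g) by [].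
apply: kmor_eq; rewrite ?src_mcomp ?tgt_mcomp //.
  by have [-> _ _] := @kmcompP C G _ _ e'; rewrite /= src_mcomp.
  by have [_ -> _] := @kmcompP C G _ _ e'; rewrite /= tgt_mcomp.
rewrite kvalM //= (kcomp_const (A := src f) (B := tgt f) (D := tgt g)) //.
  have hf : hom (src f) (tgt f) f by [].
  have hg : hom (tgt f) (tgt g) g by [].
  by planar.
by rewrite e; apply: hom_const.
Qed.

Lemma embed_tens f g : I (f ⊗ g) = I f ⊗ I g.
Proof.
apply: kmor_eq; rewrite /= ?src_mtens ?tgt_mtens //.
by rewrite (ktens_const G (A := src f) (A' := tgt f) (X := src g) (X' := tgt g)).
Qed.

Lemma hom_gelt : hom (G ⊠ K) G (idm G).
Proof. by typecheck. Qed.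
Definition gelt : Mor GC := KMor hom_gelt.

Lemma hom_gelt' : hom (K : Ob GC) (com_ob G : Ob GC) gelt.
Proof. by []. Qed.

(** The generic element is the identity of G, so evaluating at it loses
    nothing: this is how computations with elements prove equations between
    morphisms. *)
Lemma kval_at_gelt A X f : hom (G ⊠ A) X f ->
  kval (I f ∘ (gelt ⊗ (A : Ob GC))) = f.
Proof.
move=> hf; rewrite kvalM; last first.
  by rewrite tgt_mtens tgt_idm /=; case: hf.
rewrite src_mtens src_idm /= otensKA.
rewrite (kconst_comp (A := A) (B := G ⊠ A) (D := X)) //.
  by rewrite /ktens braid_A_K; transitivity (f ∘ (((G ⊗ eps G) ∘ del G) ⊗ A));
    [planar | rewrite epsr; planar].
by rewrite /ktens; typecheck.
Qed.

Lemma gelt_ext A X f g : hom (G ⊠ A) X f -> hom (G ⊠ A) X g ->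
  I f ∘ (gelt ⊗ (A : Ob GC)) = I g ∘ (gelt ⊗ (A : Ob GC)) -> f = g.
Proof.
by move=> hf hg e; rewrite -(kval_at_gelt hf) -(kval_at_gelt hg) e.
Qed.

(** Tensoring two morphisms duplicates G along its comultiplication. *)
Lemma gelt_grouplike : I (del G) ∘ gelt = gelt ⊗ gelt.
Proof.
have hd := hom_del G.
have e : tgt gelt = src (I (del G)) by rewrite /=; case: hd.
have [a1 a2 a3] := @kmcompP C G _ _ e.
apply: kmor_eq.
- by rewrite a1 /= otensKA.
- by rewrite a2 /=; case: hd.
rewrite a3 /= (kconst_comp (A := K) (B := G) (D := G ⊠ G)) //.
by rewrite /ktens braid_A_K; planar.
Qed.

Lemma embed_eq1 f g : f = g -> I f = I g. Proof. by move=> ->. Qed.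

Ltac push E := move: (embed_eq1 E);
  rewrite ?/tensor_comul ?/convol ?/Pi_left ?/Pi_right;
  rewrite ?(embed_comp, embed_tens, embed_idm) //.

Section Algebra.
Variable B : algebra C.
Lemma embed_unitl :
  I (mul_of B) ∘ (I (unit_of B) ⊗ idm (alg_ob B : Ob GC)) = idm (alg_ob B : Ob GC).
Proof. by push (mul_unitl B). Qed.
Lemma embed_unitr :
  I (mul_of B) ∘ (idm (alg_ob B : Ob GC) ⊗ I (unit_of B)) = idm (alg_ob B : Ob GC).
Proof. by push (mul_unitr B). Qed.
Lemma embed_assoc :
  I (mul_of B) ∘ (I (mul_of B) ⊗ idm (alg_ob B : Ob GC))
  = I (mul_of B) ∘ (idm (alg_ob B : Ob GC) ⊗ I (mul_of B)).
Proof. by push (mul_assoc B). Qed.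
Definition embed_alg : algebra GC :=
  @Algebra GC (alg_ob B) (I (unit_of B)) (I (mul_of B))
    (embed_hom (hom_unit B)) (embed_hom (hom_mul B))
    embed_unitl embed_unitr embed_assoc.
End Algebra.

Definition embed_wh (H : weak_hopf C) : weak_hopf GC.
Proof.
refine (@WeakHopf GC (embed_alg H) (I (counit H)) (I (comul H)) (I (antipode H))
  (embed_hom (hom_counit H)) (embed_hom (hom_comul H)) _ _ _ _ _ _ _ _
  (embed_hom (hom_antipode H)) _ _ _).
- by push (comul_counitl H).
- by push (comul_counitr H).
- by push (comul_coassoc H).
- by push (wh_comul_mul H).
- by push (wh_counit_mul H).
- by push (wh_counit_mul_braid H).
- by push (wh_comul_unit H).
- by push (wh_comul_unit_braid H).
- by push (wh_antipode_right H).
- by push (wh_antipode_left H).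
- by push (wh_antipode_mid H).
Defined.

Section Definitions.
Variables (H : weak_hopf C) (B : algebra C) (phi : Mor C).
Local Notation IH := (embed_wh H).
Local Notation IB := (embed_alg B).
Local Notation Iphi := (I phi).

Lemma embed_hom_power n s : hom (tpow H n) B s ->
  hom (tpow IH n) (alg_ob IB) (I s).
Proof. exact: embed_hom. Qed.

Lemma embed_cocomm : cocommutative H -> cocommutative IH.
Proof. by move=> h; rewrite /cocommutative; push h. Qed.

Lemma embed_PiL : I (PiL H) = PiL IH.
Proof. by rewrite /PiL /Pi_left ?(embed_comp, embed_tens, embed_idm). Qed.

Lemma embed_comul2 : I (comul2 H) = comul2 IH.
Proof. by rewrite /comul2 /tensor_comul ?(embed_comp, embed_tens, embed_idm). Qed.

Lemma embed_comuln n : I (comuln H n) = comuln IH n.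
Proof.
elim: n => [|n IHn]; first exact: embed_idm.
have h := hom_comuln H n.
rewrite /= -IHn /tensor_comul ?(embed_comp, embed_tens, embed_idm) //.
Qed.

Lemma embed_muln n : I (muln_of H n) = muln_of IH n.
Proof.
elim: n => [|[|n] IHn]; [by []|exact: embed_idm|].
have h := hom_muln H n.+1.
rewrite [LHS](_ : _ = I (mul_of H ∘ (H ⊗ muln_of H n.+1))) //.
by rewrite embed_comp // embed_tens embed_idm IHn.
Qed.

Lemma embed_conv n s t : hom (tpow H n) B s -> hom (tpow H n) B t ->
  I (conv H B n s t) = conv IH IB n (I s) (I t).
Proof.
move=> hs ht'; have h := hom_comuln H n.
by rewrite /conv /convol ?(embed_comp, embed_tens, embed_idm, embed_comuln).
Qed.

Hypothesis hphi : hom (H ⊠ B) B phi.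

Lemma embed_u n : I (u_ H B phi n) = u_ IH IB Iphi n.
Proof.
have h := hom_muln H n.
by rewrite /u_ /u1 ?(embed_comp, embed_tens, embed_idm, embed_muln).
Qed.

Lemma embed_P : I (P_mor H B phi) = P_mor IH IB Iphi.
Proof. by rewrite /P_mor ?(embed_comp, embed_tens, embed_idm). Qed.

Lemma embed_F s : hom (tpow H 2) B s -> I (F_mor H s) = F_mor IH (I s).
Proof.
rewrite /tpow /= => hs.
by rewrite /F_mor ?(embed_comp, embed_tens, embed_idm, embed_comul2).
Qed.

Lemma embed_wma :
  weak_module_algebra H B phi -> weak_module_algebra IH IB Iphi.
Proof.
case=> -[_ h1] h2 h3; split.
- by split; [exact: embed_hom | push h1].
- by push h2.
- by rewrite /u1; move: h3; rewrite /u1 => h3; push h3.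
Qed.

Lemma embed_coface k i s : 0 < k -> hom (tpow H k) B s ->
  I (coface H phi k i s) = coface IH Iphi k i (I s).
Proof.
case: k => // k _ hs; case: i => [|i].
  by rewrite /coface /= embed_comp ?embed_tens ?embed_idm.
rewrite /coface; case: ifP => [le_ik|_].
  have e : i + (k.+1 - i.+1) = k by rewrite subSS subnKC.
  rewrite embed_comp ?embed_tens ?embed_idm //.
  eapply composable; [hom_infer | exact: hs |].
  by rewrite -otensA -[_ ⊠ tpow H _]/(tpow H (k.+1 - i.+1).+1) -tpowD addnS e.
have eS m : tpow H m.+1 = tpow H m ⊠ H.
  by rewrite -addn1 tpowD /tpow /= otensAK.
rewrite embed_comp ?embed_tens ?embed_comp ?embed_tens ?embed_idm ?embed_PiL //.
by eapply composable; [hom_infer | exact: hs | rewrite eS].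
Qed.

Lemma embed_twisted s : hom (tpow H 2) B s ->
  twisted H B phi s -> twisted IH IB Iphi (I s).
Proof.
move=> hs; have hF := hom_F_mor hs; rewrite /twisted -embed_P -embed_F //.
move: hs hF; rewrite /tpow /= => hs hF h; have hP := hom_P_mor hphi.
by push h.
Qed.

End Definitions.
End Constants.

(** * Group-like elements of a cocommutative weak Hopf algebra *)

Lemma el_mulA (C : smc) (A : algebra C) (x y z : Mor C) :
  hom K A x -> hom K A y -> hom K A z ->
  mul_of A ∘ ((mul_of A ∘ (x ⊗ y)) ⊗ z) = mul_of A ∘ (x ⊗ (mul_of A ∘ (y ⊗ z))).
Proof.
move=> hx hy hz.
transitivity (mul_of A ∘ (mul_of A ⊗ A) ∘ (x ⊗ y ⊗ z)); first by planar.
by rewrite mul_assoc; planar.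
Qed.

Section GroupLike.
Variables (C : smc) (H : weak_hopf C) (hcc : cocommutative H).
Implicit Types (h k x y : Mor C).
Local Notation m := (mul_of H).
Local Notation η := (unit_of H).
Local Notation ε := (counit H).
Local Notation Δ := (comul H).
Local Notation c := (braid H H).

(** Δ(1), which in general differs from 1 ⊗ 1: the unit of H is not group-like
    but behaves like a sum of group-like identities. *)
Definition unit2 : Mor C := Δ ∘ η.
Lemma hom_unit2 : hom K (H ⊠ H) unit2. Proof. by rewrite /unit2; typecheck. Qed.
Local Hint Resolve hom_unit2 : homs.
Local Notation d := unit2.

Lemma unit2C : c ∘ d = d.
Proof. by rewrite /unit2 mcompA // hcc. Qed.

Lemma unit2_epsr : (H ⊗ ε) ∘ d = η.
Proof. by rewrite /unit2 mcompA // comul_counitr; planar. Qed.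

Lemma unit2A : (Δ ⊗ H) ∘ d = (H ⊗ Δ) ∘ d.
Proof. by rewrite /unit2 !mcompA // comul_coassoc. Qed.

Lemma unit3 : (H ⊗ m ⊗ H) ∘ (d ⊗ d) = (Δ ⊗ H) ∘ d.
Proof. by rewrite /unit2 mcompA // wh_comul_unit. Qed.

(** This is wh_comul_unit with its legs permuted cyclically, which is harmless
    because Δ(1) is symmetric. *)
Lemma unit3l : (m ⊗ H ⊗ H) ∘ (H ⊗ d ⊗ H) ∘ d = (Δ ⊗ H) ∘ d.
Proof.
transitivity (braid H (H ⊠ H) ∘ ((H ⊗ m ⊗ H) ∘ (d ⊗ d))).
  transitivity ((braid H (H ⊠ H) ∘ (H ⊗ (m ⊗ H))) ∘ (d ⊗ d)); last by planar.
  rewrite (@braid_natr C H (H ⊠ H ⊠ H) (H ⊠ H) (m ⊗ H)) //.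
  rewrite -otensA braid_hexagon.
  transitivity ((m ⊗ H ⊗ H) ∘ (H ⊗ (braid H (H ⊠ H) ∘ (H ⊗ d))) ∘ (c ∘ d)).
    by rewrite (braid_elr H hom_unit2) unit2C; planar.
  by planar.
rewrite unit3 {1}unit2A mcompA // (@braid_natr C H H (H ⊠ H) Δ) //.
by rewrite -mcompA // unit2C.
Qed.

Lemma unit3r : (H ⊗ H ⊗ m) ∘ (H ⊗ d ⊗ H) ∘ d = (H ⊗ Δ) ∘ d.
Proof.
transitivity (braid (H ⊠ H) H ∘ ((H ⊗ m ⊗ H) ∘ (d ⊗ d))).
  transitivity ((braid (H ⊠ H) H ∘ ((H ⊗ m) ⊗ H)) ∘ (d ⊗ d)); last by planar.
  rewrite (@braid_natl C (H ⊠ H ⊠ H) (H ⊠ H) H (H ⊗ m)) //.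
  rewrite braid_hexagon'.
  transitivity ((H ⊗ H ⊗ m) ∘ ((braid (H ⊠ H) H ∘ (d ⊗ H)) ⊗ H) ∘ (c ∘ d)).
    by rewrite (braid_ell H hom_unit2) unit2C; planar.
  by planar.
rewrite unit3 mcompA // (@braid_natl C H (H ⊠ H) H Δ) //.
by rewrite -mcompA // unit2C.
Qed.

(** The symmetry of Δ(1) removes the braiding from the definition: Π^L sends x
    to 1_1 ε(1_2 x), and Π^R sends it to ε(x 1_1) 1_2. *)
Lemma PiLE : PiL H = (H ⊗ (ε ∘ m)) ∘ (d ⊗ H).
Proof.
rewrite /PiL /Pi_left -/unit2.
have e : (ε ∘ m) ⊗ H = (H ⊗ (ε ∘ m)) ∘ ((c ⊗ H) ∘ (H ⊗ c)).
  rewrite -braid_hexagon' -(@braid_natl C (H ⊠ H) K H (ε ∘ m)) // braid_K_A.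
  by planar.
rewrite e.
transitivity ((H ⊗ (ε ∘ m)) ∘ (c ⊗ H) ∘ (H ⊗ (c ∘ c)) ∘ (d ⊗ H)); first by planar.
rewrite braidK; transitivity ((H ⊗ (ε ∘ m)) ∘ ((c ∘ d) ⊗ H)); first by planar.
by rewrite unit2C.
Qed.

Lemma PiRE : Pi_right H η m ε Δ = ((ε ∘ m) ⊗ H) ∘ (H ⊗ d).
Proof.
rewrite /Pi_right -/unit2.
have e : H ⊗ (ε ∘ m) = ((ε ∘ m) ⊗ H) ∘ ((H ⊗ c) ∘ (c ⊗ H)).
  rewrite -braid_hexagon -(@braid_natr C H (H ⊠ H) K (ε ∘ m)) // braid_A_K.
  by planar.
rewrite e.
transitivity (((ε ∘ m) ⊗ H) ∘ (H ⊗ c) ∘ ((c ∘ c) ⊗ H) ∘ (H ⊗ d)); first by planar.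
rewrite braidK; transitivity (((ε ∘ m) ⊗ H) ∘ (H ⊗ (c ∘ d))); first by planar.
by rewrite unit2C.
Qed.

Definition PiR : Mor C := Pi_right H η m ε Δ.
Lemma hom_PiR : hom H H PiR. Proof. exact: hom_Pi_right. Qed.
Local Hint Resolve hom_PiR : homs.

(** Group-like elements behave like the arrows of a groupoid. They form a set
    closed under products only because ε(h) = 1 is not asked for: ε(h k) tells
    whether h and k are composable. *)
Definition grouplike h := hom K H h /\ Δ ∘ h = h ⊗ h.

Definition rt h : Mor C := m ∘ (H ⊗ h).
Definition lt h : Mor C := m ∘ (h ⊗ H).
Lemma hom_rt h : hom K H h -> hom H H (rt h).
Proof. by rewrite /rt => hh; typecheck. Qed.
Lemma hom_lt h : hom K H h -> hom H H (lt h).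
Proof. by rewrite /lt => hh; typecheck. Qed.
Local Hint Resolve hom_rt hom_lt : homs.

Lemma rt_mul h k : hom K H h -> hom K H k -> rt (m ∘ (h ⊗ k)) = rt k ∘ rt h.
Proof.
rewrite /rt => hh hk.
transitivity (m ∘ (H ⊗ m) ∘ (H ⊗ h ⊗ k)); first by planar.
by rewrite -mul_assoc; planar.
Qed.

Lemma lt_mul h k : hom K H h -> hom K H k -> lt (m ∘ (h ⊗ k)) = lt h ∘ lt k.
Proof.
rewrite /lt => hh hk.
transitivity (m ∘ (m ⊗ H) ∘ (h ⊗ k ⊗ H)); first by planar.
by rewrite mul_assoc; planar.
Qed.

Lemma comul_rt h : grouplike h -> Δ ∘ rt h = (rt h ⊗ rt h) ∘ Δ.
Proof.
case=> hh gh; rewrite /rt mcompA // wh_comul_mul /tensor_comul.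
transitivity ((m ⊗ m) ∘ (H ⊗ c ⊗ H) ∘ (Δ ⊗ (Δ ∘ h))); first by planar.
rewrite gh; transitivity ((m ⊗ m) ∘ (H ⊗ (c ∘ (H ⊗ h)) ⊗ h) ∘ Δ); first by planar.
by rewrite (braid_elr H hh); planar.
Qed.

Lemma comul_lt h : grouplike h -> Δ ∘ lt h = (lt h ⊗ lt h) ∘ Δ.
Proof.
case=> hh gh; rewrite /lt mcompA // wh_comul_mul /tensor_comul.
transitivity ((m ⊗ m) ∘ (H ⊗ c ⊗ H) ∘ ((Δ ∘ h) ⊗ Δ)); first by planar.
rewrite gh; transitivity ((m ⊗ m) ∘ (h ⊗ (c ∘ (h ⊗ H)) ⊗ H) ∘ Δ); first by planar.
by rewrite (braid_ell H hh); planar.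
Qed.

Lemma grouplike_mul h k : grouplike h -> grouplike k -> grouplike (m ∘ (h ⊗ k)).
Proof.
move=> gh [hk gk]; have [hh _] := gh; split; first by typecheck.
transitivity (Δ ∘ lt h ∘ k); first by rewrite /lt; planar.
rewrite comul_lt // -mcompA // gk /lt; planar.
Qed.

(** In terms of arrows, x h y is composable as soon as x h and h y are. *)
Lemma counit_mid h : grouplike h ->
  ε ∘ m ∘ (m ⊗ H) ∘ (H ⊗ h ⊗ H) = (ε ∘ rt h) ⊗ (ε ∘ lt h).
Proof.
case=> hh gh; rewrite wh_counit_mul /rt /lt.
transitivity (((ε ∘ m) ⊗ (ε ∘ m)) ∘ (H ⊗ (Δ ∘ h) ⊗ H)); first by planar.
by rewrite gh; planar.
Qed.

Lemma counit_rt_mul h : hom K H h ->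
  ε ∘ rt h ∘ m = ((ε ∘ m) ⊗ (ε ∘ rt h)) ∘ (H ⊗ Δ).
Proof.
move=> hh; rewrite /rt.
transitivity (ε ∘ m ∘ (m ⊗ H) ∘ (H ⊗ H ⊗ h)); first by planar.
by rewrite wh_counit_mul; planar.
Qed.

Lemma counit_lt_mul h : hom K H h ->
  ε ∘ lt h ∘ m = ((ε ∘ lt h) ⊗ (ε ∘ m)) ∘ (Δ ⊗ H).
Proof.
move=> hh; rewrite /lt.
transitivity (ε ∘ (m ∘ (H ⊗ m)) ∘ (h ⊗ H ⊗ H)); first by planar.
rewrite -mul_assoc; transitivity (ε ∘ m ∘ (m ⊗ H) ∘ (h ⊗ H ⊗ H)); first by planar.
by rewrite wh_counit_mul; planar.
Qed.

Lemma rt_unit h : hom K H h -> rt h ∘ η = h.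
Proof.
move=> hh; rewrite /rt; transitivity (m ∘ (η ⊗ H) ∘ h); first by planar.
by rewrite mul_unitl; planar.
Qed.

Lemma lt_unit h : hom K H h -> lt h ∘ η = h.
Proof.
move=> hh; rewrite /lt; transitivity (m ∘ (H ⊗ η) ∘ h); first by planar.
by rewrite mul_unitr; planar.
Qed.

(** The argument x of Π^R(x) h = ε(x h) h stays arbitrary because it will be a
    leg of Δ(1). Write h ⊗ h as Δ(1 h) and split ε(x 1_1 h) with
    wh_counit_mul. *)
Lemma PiR_mul h : grouplike h -> rt h ∘ PiR = (ε ∘ rt h) ⊗ h.
Proof.
move=> gh; have [hh eh] := gh.
have e2 : h ⊗ h = (rt h ⊗ rt h) ∘ d.
  by rewrite /unit2 mcompA // -comul_rt // -mcompA // rt_unit.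
transitivity (((ε ∘ m) ∘ (H ⊗ h)) ⊗ h); last by rewrite /rt; planar.
transitivity (((ε ∘ m) ⊗ H) ∘ (H ⊗ (h ⊗ h))); last by planar.
rewrite e2.
transitivity (((ε ∘ rt h ∘ m) ⊗ rt h) ∘ (H ⊗ d)); last first.
  rewrite /rt.
  transitivity (((ε ∘ (m ∘ (m ⊗ H)) ∘ (H ⊗ H ⊗ h)) ⊗ (m ∘ (H ⊗ h))) ∘ (H ⊗ d)).
    by planar.
  by rewrite mul_assoc; planar.
rewrite counit_rt_mul //.
transitivity (((ε ∘ m) ⊗ (ε ∘ rt h) ⊗ rt h) ∘ (H ⊗ ((Δ ⊗ H) ∘ d))); last by planar.
rewrite unit2A.
transitivity (((ε ∘ m) ⊗ ((ε ⊗ H) ∘ ((rt h ⊗ rt h) ∘ Δ))) ∘ (H ⊗ d)); last by planar.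
rewrite -comul_rt // mcompA // comul_counitl.
by rewrite /PiR PiRE; planar.
Qed.

Lemma mul_PiL h : grouplike h -> lt h ∘ PiL H = h ⊗ (ε ∘ lt h).
Proof.
move=> gh; have [hh eh] := gh.
have e2 : h ⊗ h = (lt h ⊗ lt h) ∘ d.
  by rewrite /unit2 mcompA // -comul_lt // -mcompA // lt_unit.
transitivity (h ⊗ ((ε ∘ m) ∘ (h ⊗ H))); last by rewrite /lt; planar.
transitivity ((H ⊗ (ε ∘ m)) ∘ ((h ⊗ h) ⊗ H)); last by planar.
rewrite e2.
transitivity ((lt h ⊗ (ε ∘ lt h ∘ m)) ∘ (d ⊗ H)); last first.
  rewrite /lt.
  transitivity (((m ∘ (h ⊗ H)) ⊗ (ε ∘ (m ∘ (H ⊗ m)) ∘ (h ⊗ H ⊗ H))) ∘ (d ⊗ H)).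
    by planar.
  by rewrite -mul_assoc; planar.
rewrite counit_lt_mul //.
transitivity ((lt h ⊗ (ε ∘ lt h) ⊗ (ε ∘ m)) ∘ (((H ⊗ Δ) ∘ d) ⊗ H)); last by planar.
rewrite -unit2A.
transitivity ((((H ⊗ ε) ∘ ((lt h ⊗ lt h) ∘ Δ)) ⊗ (ε ∘ m)) ∘ (d ⊗ H)); last by planar.
rewrite -comul_lt // mcompA // comul_counitr.
by rewrite PiLE; planar.
Qed.

Lemma PiL_el h : hom K H h -> PiL H ∘ h = (H ⊗ (ε ∘ rt h)) ∘ d.
Proof. by move=> hh; rewrite PiLE /rt; planar. Qed.

Lemma PiR_el h : hom K H h -> PiR ∘ h = ((ε ∘ lt h) ⊗ H) ∘ d.
Proof. by move=> hh; rewrite /PiR PiRE /lt; planar. Qed.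

Lemma unit2_PiR : (H ⊗ PiR) ∘ d = d.
Proof.
transitivity ((H ⊗ ε ⊗ H) ∘ ((H ⊗ m ⊗ H) ∘ (d ⊗ d))).
  by rewrite /PiR PiRE; planar.
rewrite unit3; transitivity ((((H ⊗ ε) ∘ Δ) ⊗ H) ∘ d); first by planar.
by rewrite comul_counitr; planar.
Qed.

Lemma unit2_PiL : (PiL H ⊗ H) ∘ d = d.
Proof.
transitivity ((H ⊗ ε ⊗ H) ∘ ((H ⊗ m ⊗ H) ∘ (d ⊗ d))).
  by rewrite PiLE; planar.
rewrite unit3; transitivity ((((H ⊗ ε) ∘ Δ) ⊗ H) ∘ d); first by planar.
by rewrite comul_counitr; planar.
Qed.

(** In Π^L(h) ⊗ Π^L(h) = 1_1 ⊗ 1'_1 ε(1_2 h) ε(1'_2 h) the product of the two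
    counits is ε(1'_2 Π^R(1_2) h), and Π^R fixes the second leg of Δ(1); then
    wh_comul_unit applies. *)
Lemma grouplike_PiL h : grouplike h -> grouplike (PiL H ∘ h).
Proof.
move=> gh; have [hh eh] := gh; split; first by typecheck.
have -> : (PiL H ∘ h) ⊗ (PiL H ∘ h) = (H ⊗ H ⊗ (ε ∘ (rt h ∘ m)))
  ∘ ((H ⊗ H ⊗ H ⊗ PiR) ∘ (H ⊗ d ⊗ H) ∘ d).
  transitivity ((H ⊗ (PiL H ∘ h) ⊗ (ε ∘ rt h)) ∘ d).
    by rewrite {1}PiL_el //; planar.
  rewrite PiL_el //.
  transitivity ((H ⊗ H ⊗ (ε ∘ m ∘ (H ⊗ (rt h ∘ PiR)))) ∘ (H ⊗ d ⊗ H) ∘ d).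
    by rewrite PiR_mul //; rewrite /rt; planar.
  rewrite /rt.
  transitivity ((H ⊗ H ⊗ (ε ∘ (m ∘ (H ⊗ m)) ∘ (H ⊗ H ⊗ h) ∘ (H ⊗ PiR)))
     ∘ (H ⊗ d ⊗ H) ∘ d); first by planar.
  by rewrite -mul_assoc; planar.
transitivity ((H ⊗ H ⊗ (ε ∘ rt h)) ∘ ((H ⊗ H ⊗ m) ∘ (H ⊗ d ⊗ H)
   ∘ ((H ⊗ PiR) ∘ d))); last by planar.
rewrite unit2_PiR unit3r -unit2A PiL_el //; planar.
Qed.

Lemma grouplike_PiR h : grouplike h -> grouplike (PiR ∘ h).
Proof.
move=> gh; have [hh eh] := gh; split; first by typecheck.
have -> : (PiR ∘ h) ⊗ (PiR ∘ h) = ((ε ∘ (lt h ∘ m)) ⊗ H ⊗ H)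
  ∘ ((PiL H ⊗ H ⊗ H ⊗ H) ∘ (H ⊗ d ⊗ H) ∘ d).
  transitivity (((ε ∘ lt h) ⊗ (PiR ∘ h) ⊗ H) ∘ d).
    by rewrite {2}PiR_el //; planar.
  rewrite PiR_el //.
  transitivity (((ε ∘ m ∘ ((lt h ∘ PiL H) ⊗ H)) ⊗ H ⊗ H) ∘ (H ⊗ d ⊗ H) ∘ d).
    by rewrite mul_PiL //; rewrite /lt; planar.
  rewrite /lt.
  transitivity (((ε ∘ (m ∘ (m ⊗ H)) ∘ (h ⊗ H ⊗ H) ∘ (PiL H ⊗ H)) ⊗ H ⊗ H)
     ∘ (H ⊗ d ⊗ H) ∘ d); first by planar.
  by rewrite mul_assoc; planar.
transitivity (((ε ∘ lt h) ⊗ H ⊗ H) ∘ ((m ⊗ H ⊗ H) ∘ (H ⊗ d ⊗ H)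
   ∘ ((PiL H ⊗ H) ∘ d))); last by planar.
rewrite unit2_PiL unit3l unit2A PiR_el //; planar.
Qed.

(** Π^L(h) is like an identity arrow and 1 like the sum of all of them:
    multiplying a leg of Δ(1) by Π^L(h) selects one summand. *)
Lemma unit2_rt_PiL h : grouplike h ->
  (rt (PiL H ∘ h) ⊗ H) ∘ d = (PiL H ∘ h) ⊗ (PiL H ∘ h).
Proof.
move=> gh; have [hh _] := gh; have [_ <-] := grouplike_PiL gh.
rewrite /rt PiL_el //.
transitivity ((H ⊗ (ε ∘ rt h) ⊗ H) ∘ ((m ⊗ H ⊗ H) ∘ (H ⊗ d ⊗ H) ∘ d)).
  by planar.
rewrite unit3l unit2A.
rewrite -{1}unit2C.
transitivity ((H ⊗ (((ε ∘ rt h) ⊗ H) ∘ Δ)) ∘ d); first by rewrite unit2C; planar.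
rewrite -{1}hcc.
transitivity ((H ⊗ ((((ε ∘ rt h) ⊗ H) ∘ c) ∘ Δ)) ∘ d); first by planar.
rewrite -(@braid_natr C H H K (ε ∘ rt h)) // braid_A_K.
transitivity ((H ⊗ H ⊗ (ε ∘ rt h)) ∘ ((H ⊗ Δ) ∘ d)); first by planar.
by rewrite -unit2A; planar.
Qed.

Lemma unit2_rt_PiL' h : grouplike h ->
  (H ⊗ rt (PiL H ∘ h)) ∘ d = (PiL H ∘ h) ⊗ (PiL H ∘ h).
Proof.
move=> gh; have [hh _] := gh; have hp : hom K H (PiL H ∘ h) by typecheck.
rewrite -{1}unit2C mcompA // -(@braid_natl C H H H (rt (PiL H ∘ h))) //.
rewrite -mcompA // unit2_rt_PiL //.
by rewrite (braid_el hp hp).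
Qed.

Local Notation λ := (antipode H).
Local Notation "h · k" := (m ∘ (h ⊗ k)) (at level 39, left associativity).

Lemma mul_antipode h : grouplike h -> h · (λ ∘ h) = PiL H ∘ h.
Proof.
case=> hh gh; rewrite -[PiL H]wh_antipode_right /convol.
transitivity (m ∘ (H ⊗ λ) ∘ (Δ ∘ h)); last by planar.
by rewrite gh; planar.
Qed.

Lemma antipode_mul h : grouplike h -> (λ ∘ h) · h = PiR ∘ h.
Proof.
case=> hh gh; rewrite /PiR -wh_antipode_left /convol.
transitivity (m ∘ (λ ⊗ H) ∘ (Δ ∘ h)); last by planar.
by rewrite gh; planar.
Qed.

Lemma antipode_mid h : grouplike h -> (PiR ∘ h) · (λ ∘ h) = λ ∘ h.
Proof.
move=> gh; have [hh e] := gh; rewrite -antipode_mul // -{3}[λ](wh_antipode_mid H).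
rewrite /convol.
transitivity (m ∘ ((m ∘ (λ ⊗ H)) ⊗ λ) ∘ (Δ ⊗ H) ∘ (Δ ∘ h)); last by planar.
rewrite e.
transitivity (m ∘ ((m ∘ (λ ⊗ H)) ⊗ λ) ∘ ((Δ ∘ h) ⊗ h)); last by planar.
by rewrite e; planar.
Qed.

Lemma PiL_mul_self h : grouplike h -> (PiL H ∘ h) · h = h.
Proof.
move=> gh; have [hh e] := gh; rewrite PiL_el //.
transitivity ((H ⊗ ε) ∘ ((rt h ⊗ rt h) ∘ Δ) ∘ η); first by rewrite /unit2 /rt; planar.
rewrite -comul_rt //.
transitivity ((H ⊗ ε) ∘ Δ ∘ (rt h ∘ η)); first by planar.
by rewrite rt_unit // comul_counitr; planar.
Qed.

Lemma mul_PiR_self h : grouplike h -> h · (PiR ∘ h) = h.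
Proof.
move=> gh; have [hh e] := gh; rewrite PiR_el //.
transitivity ((ε ⊗ H) ∘ ((lt h ⊗ lt h) ∘ Δ) ∘ η); first by rewrite /unit2 /lt; planar.
rewrite -comul_lt //.
transitivity ((ε ⊗ H) ∘ Δ ∘ (lt h ∘ η)); first by planar.
by rewrite lt_unit // comul_counitl; planar.
Qed.

(** Generalized inverses are unique, and both Δ(λ(h)) and λ(h) ⊗ λ(h) are
    inverse to h ⊗ h. *)
Lemma grouplike_antipode h : grouplike h -> grouplike (λ ∘ h).
Proof.
move=> gh; have [hh _] := gh; have hl : hom K H (λ ∘ h) by typecheck.
split=> //.
have gr := grouplike_PiR gh; have [hom_infer er] := gr.
have [hp ep] := grouplike_PiL gh.
have e1 : λ ∘ h = lt (PiR ∘ h) ∘ (λ ∘ h).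
  by rewrite -{1}antipode_mid // /lt; planar.
have e2 : lt (λ ∘ h) ∘ (PiL H ∘ h) = λ ∘ h.
  rewrite -mul_antipode // -[RHS]antipode_mid // -antipode_mul // el_mulA //.
  by rewrite /lt; planar.
rewrite {1}e1 mcompA // comul_lt // -antipode_mul // lt_mul //.
transitivity ((lt (λ ∘ h) ⊗ lt (λ ∘ h)) ∘ (((lt h ⊗ lt h) ∘ Δ) ∘ (λ ∘ h))).
  by planar.
rewrite -comul_lt // -mcompA //.
have -> : lt h ∘ (λ ∘ h) = PiL H ∘ h by rewrite -mul_antipode // /lt; planar.
rewrite ep; transitivity ((lt (λ ∘ h) ∘ (PiL H ∘ h)) ⊗ (lt (λ ∘ h) ∘ (PiL H ∘ h))).
  by planar.
by rewrite e2.
Qed.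

Lemma mul_PiL_el h k : grouplike h -> hom K H k ->
  h · (PiL H ∘ k) = h ⊗ (ε ∘ (h · k)).
Proof.
move=> gh hk; have [hh _] := gh.
transitivity (lt h ∘ PiL H ∘ k); first by rewrite /lt; planar.
by rewrite mul_PiL // /lt; planar.
Qed.

Lemma PiL_mul h k : grouplike h -> hom K H k ->
  PiL H ∘ (h · k) = (PiL H ∘ h) ⊗ (ε ∘ (h · k)).
Proof.
move=> gh hk; have [hh _] := gh.
rewrite PiL_el // rt_mul // PiL_el //.
transitivity ((H ⊗ ((ε ∘ m ∘ (m ⊗ H) ∘ (H ⊗ h ⊗ H)) ∘ (H ⊗ k))) ∘ d).
  by rewrite /rt; planar.
by rewrite counit_mid // /lt; planar.
Qed.

Lemma PiL_mul_PiL h k : grouplike h -> hom K H k ->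
  PiL H ∘ (h · (PiL H ∘ k)) = PiL H ∘ (h · k).
Proof.
move=> gh hk; have [hh _] := gh; rewrite mul_PiL_el // PiL_mul //.
by planar.
Qed.

Lemma PiL_unit : PiL H ∘ η = η.
Proof.
rewrite PiL_el // -[RHS]unit2_epsr /rt.
transitivity ((H ⊗ (ε ∘ (m ∘ (H ⊗ η)))) ∘ d); first by planar.
by rewrite mul_unitr; planar.
Qed.

End GroupLike.
#[export] Hint Resolve hom_unit2 hom_PiR hom_rt hom_lt : homs.

(** * The action of group-like elements *)

Section Action.
Variables (C : smc) (H : weak_hopf C) (hcc : cocommutative H).
Variables (B : algebra C) (φ : Mor C) (hB : weak_module_algebra H B φ).
Implicit Types (h k x y a b : Mor C).
Local Notation η := (unit_of H).
Local Notation Δ := (comul H).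
Local Notation μ := (mul_of B).
Local Notation "h · k" := (mul_of H ∘ (h ⊗ k)) (at level 39, left associativity).
Local Notation "a ⋆ b" := (μ ∘ (a ⊗ b)) (at level 39, left associativity).
Local Notation "h ▹ b" := (φ ∘ (h ⊗ b)) (at level 37, right associativity).
Local Notation u := (u1 H B φ).
Local Notation P h := (PiL H ∘ h).

Let hφ : hom (H ⊠ B) B φ. Proof. by case: hB => -[]. Qed.

Definition lm a : Mor C := μ ∘ (a ⊗ B).
Definition rm a : Mor C := μ ∘ (B ⊗ a).
Definition ac h : Mor C := φ ∘ (h ⊗ B).
Lemma hom_lm a : hom K B a -> hom B B (lm a).
Proof. by rewrite /lm => hh; typecheck. Qed.
Lemma hom_rm a : hom K B a -> hom B B (rm a).
Proof. by rewrite /rm => hh; typecheck. Qed.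
Lemma hom_ac h : hom K H h -> hom B B (ac h).
Proof. by rewrite /ac => hh; typecheck. Qed.
Local Hint Resolve hom_lm hom_rm hom_ac : homs.

Lemma lm_mul a b : hom K B a -> hom K B b -> lm (a ⋆ b) = lm a ∘ lm b.
Proof.
rewrite /lm => ha hb; transitivity (μ ∘ (μ ⊗ B) ∘ (a ⊗ b ⊗ B)); first by planar.
by rewrite mul_assoc; planar.
Qed.

Lemma rm_mul a b : hom K B a -> hom K B b -> rm (a ⋆ b) = rm b ∘ rm a.
Proof.
rewrite /rm => ha hb; transitivity (μ ∘ (B ⊗ μ) ∘ (B ⊗ a ⊗ b)); first by planar.
by rewrite -mul_assoc; planar.
Qed.

Lemma lm_rm a b : hom K B a -> hom K B b -> lm a ∘ rm b = rm b ∘ lm a.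
Proof.
rewrite /lm /rm => ha hb.
transitivity (μ ∘ (B ⊗ μ) ∘ (a ⊗ B ⊗ b)); first by planar.
by rewrite -mul_assoc; planar.
Qed.

Lemma ac_mul h : grouplike H h -> ac h ∘ μ = μ ∘ (ac h ⊗ ac h).
Proof.
case=> hh gh; case: hB => -[_ e] _ _.
transitivity (φ ∘ (H ⊗ μ) ∘ (h ⊗ B ⊗ B)); first by rewrite /ac; planar.
rewrite e.
transitivity (μ ∘ (φ ⊗ φ) ∘ (H ⊗ braid H B ⊗ B) ∘ ((Δ ∘ h) ⊗ B ⊗ B)).
  by planar.
rewrite gh.
transitivity (μ ∘ (φ ⊗ φ) ∘ (h ⊗ (braid H B ∘ (h ⊗ B)) ⊗ B)); first by planar.
by rewrite (braid_ell B hh) /ac; planar.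
Qed.

Lemma act_mul h a b : grouplike H h -> hom K B a -> hom K B b ->
  h ▹ (a ⋆ b) = (h ▹ a) ⋆ (h ▹ b).
Proof.
move=> gh ha hb; have [hh _] := gh.
transitivity (ac h ∘ μ ∘ (a ⊗ b)); first by rewrite /ac; planar.
by rewrite ac_mul // /ac; planar.
Qed.

Lemma ac_lm h a : grouplike H h -> hom K B a ->
  ac h ∘ lm a = lm (h ▹ a) ∘ ac h.
Proof.
move=> gh ha; have [hh _] := gh.
transitivity (ac h ∘ μ ∘ (a ⊗ B)); first by rewrite /lm; planar.
by rewrite ac_mul // /ac /lm; planar.
Qed.

Lemma ac_rm h a : grouplike H h -> hom K B a ->
  ac h ∘ rm a = rm (h ▹ a) ∘ ac h.
Proof.
move=> gh ha; have [hh _] := gh.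
transitivity (ac h ∘ μ ∘ (B ⊗ a)); first by rewrite /rm; planar.
by rewrite ac_mul // /ac /rm; planar.
Qed.

Lemma u_mulm : u ∘ mul_of H = φ ∘ (H ⊗ u).
Proof. by case: hB. Qed.

Lemma u_mul h k : hom K H h -> hom K H k -> u ∘ (h · k) = h ▹ (u ∘ k).
Proof.
move=> hh hk; rewrite mcompA // u_mulm; planar.
Qed.

Lemma act1 a : hom K B a -> η ▹ a = a.
Proof.
move=> ha; case: hB => _ e _.
transitivity (φ ∘ (η ⊗ B) ∘ a); first by planar.
by rewrite e; planar.
Qed.

Lemma uE h : hom K H h -> u ∘ h = h ▹ unit_of B.
Proof. by move=> hh; rewrite /u1; planar. Qed.

Lemma act_u_mul h a : grouplike H h -> hom K B a -> (u ∘ h) ⋆ (h ▹ a) = h ▹ a.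
Proof.
move=> gh ha; have [hh _] := gh; rewrite uE // -act_mul //.
have -> : unit_of B ⋆ a = a by
  transitivity (μ ∘ (unit_of B ⊗ B) ∘ a); [planar | rewrite mul_unitl; planar].
by [].
Qed.

Lemma act_mul_u h a : grouplike H h -> hom K B a -> (h ▹ a) ⋆ (u ∘ h) = h ▹ a.
Proof.
move=> gh ha; have [hh _] := gh; rewrite uE // -act_mul //.
have -> : a ⋆ unit_of B = a by
  transitivity (μ ∘ (B ⊗ unit_of B) ∘ a); [planar | rewrite mul_unitr; planar].
by [].
Qed.

(** Both values are idempotents, and each absorbs the other one. *)
Lemma u_PiL h : grouplike H h -> u ∘ P h = u ∘ h.
Proof.
move=> gh; have [hh _] := gh; have gp := grouplike_PiL hcc gh; have [hp _] := gp.
have hl : hom K H (antipode H ∘ h) by typecheck.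
have e1 : (u ∘ h) ⋆ (u ∘ P h) = u ∘ P h.
  by rewrite -mul_antipode // u_mul // act_u_mul.
have e2 : (P h) ▹ (u ∘ h) = u ∘ h by rewrite -u_mul // PiL_mul_self.
by rewrite -e1 -{1}e2 act_mul_u // e2.
Qed.

(** Since 1 acts as the identity and is like the sum of the identity arrows,
    multiplication by u(h) = u(Π^L(h)) is the action of one of them. As the
    same holds on the right, u(h) is central. *)
Lemma lm_u h : grouplike H h -> lm (u ∘ h) = ac (P h).
Proof.
move=> gh; have [hh _] := gh; have gp := grouplike_PiL hcc gh; have [hp _] := gp.
rewrite -u_PiL //; case: hB => -[_ e] e1 _.
transitivity (φ ∘ (η ⊗ B) ∘ (μ ∘ ((u ∘ P h) ⊗ B))); first by rewrite e1 /lm; planar.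
transitivity (φ ∘ (H ⊗ μ) ∘ (η ⊗ (u ∘ P h) ⊗ B)); first by planar.
rewrite e.
transitivity (μ ∘ (φ ⊗ φ) ∘ (H ⊗ (braid H B ∘ (H ⊗ (u ∘ P h))) ⊗ B)
   ∘ (unit2 H ⊗ B)); first by rewrite /unit2; planar.
rewrite braid_elr //.
transitivity (μ ∘ ((φ ∘ (H ⊗ u) ∘ (H ⊗ P h)) ⊗ φ) ∘ (unit2 H ⊗ B)); first by planar.
rewrite -u_mulm.
transitivity (μ ∘ (u ⊗ φ) ∘ (((rt H (P h) ⊗ H) ∘ unit2 H) ⊗ B)).
  by rewrite /rt; planar.
rewrite unit2_rt_PiL //.
transitivity (lm (u ∘ P h) ∘ ac (P h)); first by rewrite /lm /ac; planar.
rewrite uE // -ac_lm //.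
by rewrite /lm mul_unitl; planar.
Qed.

Lemma rm_u h : grouplike H h -> rm (u ∘ h) = ac (P h).
Proof.
move=> gh; have [hh _] := gh; have gp := grouplike_PiL hcc gh; have [hp _] := gp.
rewrite -u_PiL //; case: hB => -[_ e] e1 _.
transitivity (φ ∘ (η ⊗ B) ∘ (μ ∘ (B ⊗ (u ∘ P h)))); first by rewrite e1 /rm; planar.
transitivity (φ ∘ (H ⊗ μ) ∘ (η ⊗ B ⊗ (u ∘ P h))); first by planar.
rewrite e.
transitivity (μ ∘ (φ ⊗ (φ ∘ (H ⊗ u) ∘ (H ⊗ P h))) ∘ (H ⊗ braid H B)
   ∘ (unit2 H ⊗ B)); first by rewrite /unit2; planar.
rewrite -u_mulm.
transitivity (μ ∘ (φ ⊗ u) ∘ (H ⊗ ((B ⊗ rt H (P h)) ∘ braid H B)) ∘ (unit2 H ⊗ B)).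
  by rewrite /rt; planar.
rewrite -(braid_natl B (hom_rt hp)).
transitivity (μ ∘ (φ ⊗ u) ∘ (H ⊗ braid H B) ∘ (((H ⊗ rt H (P h)) ∘ unit2 H) ⊗ B)).
  by planar.
rewrite unit2_rt_PiL' //.
transitivity (μ ∘ (φ ⊗ u) ∘ (P h ⊗ (braid H B ∘ (P h ⊗ B)))); first by planar.
rewrite (braid_ell B hp).
transitivity (rm (u ∘ P h) ∘ ac (P h)); first by rewrite /rm /ac; planar.
rewrite uE // -ac_rm //.
by rewrite /rm mul_unitr; planar.
Qed.

Lemma u_idem h : grouplike H h -> (u ∘ h) ⋆ (u ∘ h) = u ∘ h.
Proof. by move=> gh; have [hh _] := gh; rewrite {2 3}uE // act_u_mul. Qed.

End Action.
#[export] Hint Resolve hom_lm hom_rm hom_ac : homs.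

(** * Tuples of group-like elements *)

Section Powers.
Variables (C : smc) (H : weak_hopf C) (hcc : cocommutative H).

Definition comonoid_wh : comonoid C :=
  Comonoid (hom_counit H) (hom_comul H) (comul_counitl H) (comul_counitr H)
    (comul_coassoc H) hcc.

Fixpoint counitn n : Mor C := if n is n'.+1 then counit H ⊗ counitn n' else K.

Lemma power_laws n :
  [/\ hom (tpow H n) K (counitn n),
      (counitn n ⊗ tpow H n) ∘ comuln H n = tpow H n,
      (tpow H n ⊗ counitn n) ∘ comuln H n = tpow H n,
      (comuln H n ⊗ tpow H n) ∘ comuln H n = (tpow H n ⊗ comuln H n) ∘ comuln H n
    & braid (tpow H n) (tpow H n) ∘ comuln H n = comuln H n].
Proof.
elim: n => [|n [h1 h2 h3 h4 h5]].
  by split; rewrite ?braid_A_K //=; planar.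
have [D e1 e2] : exists2 D : comonoid C, com_ob D = tpow H n &
    del D = comuln H n /\ eps D = counitn n.
  by exists (Comonoid h1 (hom_comuln H n) h2 h3 h4 h5).
case: e2 => e2 e3.
pose E := tensor_comonoid comonoid_wh D.
split.
- by have := hom_eps E; rewrite /= e1 e3.
- by have := epsl E; rewrite /= e1 e2 e3.
- by have := epsr E; rewrite /= e1 e2 e3.
- by have := delA E; rewrite /= e1 e2.
- by have := delC E; rewrite /= e1 e2.
Qed.

Lemma hom_counitn n : hom (tpow H n) K (counitn n).
Proof. by case: (power_laws n). Qed.
Lemma counitnl n : (counitn n ⊗ tpow H n) ∘ comuln H n = tpow H n.
Proof. by case: (power_laws n). Qed.
Lemma counitnr n : (tpow H n ⊗ counitn n) ∘ comuln H n = tpow H n.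
Proof. by case: (power_laws n). Qed.
Lemma comulnA n :
  (comuln H n ⊗ tpow H n) ∘ comuln H n = (tpow H n ⊗ comuln H n) ∘ comuln H n.
Proof. by case: (power_laws n). Qed.
Lemma comulnC n : braid (tpow H n) (tpow H n) ∘ comuln H n = comuln H n.
Proof. by case: (power_laws n). Qed.

Definition power n : comonoid C :=
  Comonoid (hom_counitn n) (hom_comuln H n) (counitnl n) (counitnr n)
    (comulnA n) (comulnC n).

Definition grouplike_tuple n x := hom K (tpow H n) x /\ comuln H n ∘ x = x ⊗ x.
Local Notation gl := grouplike_tuple.

Lemma comuln1 : comuln H 1 = comul H.
Proof. by rewrite /= /tensor_comul braid_A_K; planar. Qed.

Lemma gl1 x : gl 1 x <-> grouplike H x.
Proof.
rewrite /gl /grouplike comuln1 /tpow /=.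
by split=> -[h e]; split=> //; move: h; rewrite otensAK.
Qed.

Lemma gl_cons n h y : grouplike H h -> gl n y -> gl n.+1 (h ⊗ y).
Proof.
case=> hh gh [hy gy]; split; first by rewrite -(otensKA K); apply: hom_mtens.
have hc := hom_comuln H n.
rewrite /= /tensor_comul.
transitivity ((H ⊗ braid H (tpow H n) ⊗ tpow H n) ∘ ((comul H ∘ h) ⊗ (comuln H n ∘ y))).
  by planar.
rewrite gh gy.
transitivity (h ⊗ (braid H (tpow H n) ∘ (h ⊗ y)) ⊗ y); first by planar.
by rewrite braid_el //; planar.
Qed.

(** The components are obtained with the counits of the other factors, and
    Δ(x) = x ⊗ x recovers x from them. *)
Lemma glP n x : gl n.+2 x ->
  exists h y, [/\ grouplike H h, gl n.+1 y & x = h ⊗ y].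
Proof.
case; rewrite -[tpow H n.+2]/(H ⊠ tpow H n.+1) -[comuln H n.+2]/(tensor_comul
  H (tpow H n.+1) (comul H) (comuln H n.+1)).
move: (n.+1) => {}n hx gx.
have hc := hom_comuln H n; have he := hom_counitn n.
exists ((H ⊗ counitn n) ∘ x), ((counit H ⊗ tpow H n) ∘ x); split.
- split; first by typecheck.
  have -> : ((H ⊗ counitn n) ∘ x) ⊗ ((H ⊗ counitn n) ∘ x)
          = (H ⊗ counitn n ⊗ H ⊗ counitn n) ∘ (x ⊗ x) by planar.
  rewrite -gx /tensor_comul.
  transitivity ((H ⊗ ((counitn n ⊗ H) ∘ braid H (tpow H n)) ⊗ counitn n)
     ∘ (comul H ⊗ comuln H n) ∘ x); last by planar.
  rewrite -(braid_natr H he) braid_A_K.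
  transitivity ((comul H ⊗ (counitn n ∘ ((counitn n ⊗ tpow H n) ∘ comuln H n))) ∘ x).
    by rewrite counitnl; planar.
  by planar.
- split; first by typecheck.
  have -> : ((counit H ⊗ tpow H n) ∘ x) ⊗ ((counit H ⊗ tpow H n) ∘ x)
          = (counit H ⊗ tpow H n ⊗ counit H ⊗ tpow H n) ∘ (x ⊗ x) by planar.
  rewrite -gx /tensor_comul.
  transitivity ((counit H ⊗ ((tpow H n ⊗ counit H) ∘ braid H (tpow H n)) ⊗ tpow H n)
     ∘ (comul H ⊗ comuln H n) ∘ x); last by planar.
  rewrite -(braid_natl (tpow H n) (hom_counit H)) braid_K_A.
  transitivity (((counit H ∘ ((counit H ⊗ H) ∘ comul H)) ⊗ comuln H n) ∘ x).
    by rewrite comul_counitl; planar.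
  by planar.
transitivity ((H ⊗ counitn n ⊗ counit H ⊗ tpow H n) ∘ (x ⊗ x)); last by planar.
rewrite -gx /tensor_comul.
transitivity ((H ⊗ ((counitn n ⊗ counit H) ∘ braid H (tpow H n)) ⊗ tpow H n)
   ∘ (comul H ⊗ comuln H n) ∘ x); last by planar.
rewrite -(braid_nat (hom_counit H) he) braid_K_A.
transitivity ((((H ⊗ counit H) ∘ comul H) ⊗ ((counitn n ⊗ tpow H n) ∘ comuln H n)) ∘ x).
  by rewrite counitnl comul_counitr; planar.
by planar.
Qed.

Lemma gl2P x : gl 2 x ->
  exists h k, [/\ grouplike H h, grouplike H k & x = h ⊗ k].
Proof. by move=> /glP [h [k [gh /gl1 gk ->]]]; exists h, k. Qed.

Lemma gl3P x : gl 3 x ->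
  exists h k l, [/\ grouplike H h, grouplike H k, grouplike H l & x = h ⊗ k ⊗ l].
Proof.
move=> /glP [h [y [gh /gl2P [k [l [gk gl ->]]] ->]]]; exists h, k, l.
by split=> //; rewrite mtensA.
Qed.

Lemma gl4P x : gl 4 x ->
  exists h k l m, [/\ grouplike H h, grouplike H k, grouplike H l, grouplike H m
    & x = h ⊗ k ⊗ l ⊗ m].
Proof.
move=> /glP [h [y [gh /gl3P [k [l [m [gk gl gm ->]]]] ->]]]; exists h, k, l, m.
by split=> //; rewrite !mtensA.
Qed.

Lemma gl2 h k : grouplike H h -> grouplike H k -> gl 2 (h ⊗ k).
Proof. by move=> gh gk; apply: gl_cons => //; apply/gl1. Qed.

Lemma gl3 h k l :
  grouplike H h -> grouplike H k -> grouplike H l -> gl 3 (h ⊗ k ⊗ l).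
Proof. by move=> gh gk gl; rewrite -mtensA; apply: gl_cons => //; apply: gl2. Qed.

End Powers.

Section TupleExt.
Variables (C : smc) (H : weak_hopf C) (hcc : cocommutative H).
Local Notation power := (power hcc).

(** Equations between morphisms out of a power of H may be checked on tuples
    of group-like elements, provided that this is done in all categories. *)
Lemma tuple_ext n A X f g :
  hom (tpow H n ⊠ A) X f -> hom (tpow H n ⊠ A) X g ->
  (forall x, @grouplike_tuple (generic (power n)) (embed_wh (power n) H) n x ->
    embed (power n) f ∘ (x ⊗ idm (A : Ob (generic (power n))))
    = embed (power n) g ∘ (x ⊗ idm (A : Ob (generic (power n))))) ->
  f = g.
Proof.
move=> hf hg e; apply: (gelt_ext (G := power n) hf hg); apply: e.
split; first exact: hom_gelt'.
by rewrite -embed_comuln (gelt_grouplike (power n)).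
Qed.

Lemma tuple_ext0 n X f g :
  hom (tpow H n) X f -> hom (tpow H n) X g ->
  (forall x, @grouplike_tuple (generic (power n)) (embed_wh (power n) H) n x ->
    embed (power n) f ∘ x = embed (power n) g ∘ x) ->
  f = g.
Proof.
move=> hf hg e; apply: (@tuple_ext n K X); rewrite ?otensAK // => x gx.
have -> : x ⊗ idm (K : Ob (generic (power n))) = x by exact: mtensmK.
exact: e.
Qed.

End TupleExt.
Arguments tuple_ext [C H] hcc [n] A [X f g].
Arguments tuple_ext0 [C H] hcc [n X f g].

Section Convolution.
Variables (C : smc) (H : weak_hopf C) (hcc : cocommutative H).
Local Notation gl := (grouplike_tuple H).
Variable B : algebra C.
Local Notation μ := (mul_of B).
Implicit Types (s t r : Mor C).

Lemma conv_at n s t x : hom (tpow H n) B s -> hom (tpow H n) B t -> gl n x ->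
  conv H B n s t ∘ x = μ ∘ ((s ∘ x) ⊗ (t ∘ x)).
Proof.
move=> hs ht' [hx gx]; have hc := hom_comuln H n.
rewrite /conv /convol; transitivity (μ ∘ (s ⊗ t) ∘ (comuln H n ∘ x)).
  by planar.
by rewrite gx; planar.
Qed.

Lemma convA n s t r :
  hom (tpow H n) B s -> hom (tpow H n) B t -> hom (tpow H n) B r ->
  conv H B n s (conv H B n t r) = conv H B n (conv H B n s t) r.
Proof.
move=> hs ht' hom_infer; have hc := hom_comuln H n; rewrite /conv /convol.
transitivity ((μ ∘ (B ⊗ μ)) ∘ (s ⊗ t ⊗ r) ∘ ((tpow H n ⊗ comuln H n) ∘ comuln H n)).
  by planar.
by rewrite -mul_assoc -(comulnA hcc); planar.
Qed.

Lemma conv_comm n s t : hom (tpow H n) B s -> hom (tpow H n) B t ->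
  μ ∘ (t ⊗ s) = μ ∘ braid B B ∘ (t ⊗ s) ->
  conv H B n s t = conv H B n t s.
Proof.
move=> hs ht' e; have hc := hom_comuln H n; rewrite /conv /convol e.
transitivity (μ ∘ (braid B B ∘ (t ⊗ s)) ∘ comuln H n); last by planar.
rewrite (braid_nat ht' hs).
transitivity (μ ∘ (s ⊗ t) ∘ (braid (tpow H n) (tpow H n) ∘ comuln H n)).
  by rewrite (comulnC hcc).
by planar.
Qed.

End Convolution.

(** * Cofaces and degeneracies on elements *)

Section CofaceElements.
Variables (C : smc) (H : weak_hopf C) (hcc : cocommutative H).
Variables (B : algebra C) (φ : Mor C) (hB : weak_module_algebra H B φ).
Implicit Types (h k l m x y a b s t : Mor C).
Local Notation η := (unit_of H).
Local Notation Δ := (comul H).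
Local Notation ε := (counit H).
Local Notation μ := (mul_of B).
Local Notation "h · k" := (mul_of H ∘ (h ⊗ k)) (at level 39, left associativity).
Local Notation "a ⋆ b" := (μ ∘ (a ⊗ b)) (at level 39, left associativity).
Local Notation "h ▹ b" := (φ ∘ (h ⊗ b)) (at level 37, right associativity).
Local Notation u := (u1 H B φ).
Local Notation P h := (PiL H ∘ h).
Local Notation gl := (grouplike_tuple H).
Local Notation grouplike := (grouplike H).
Local Notation cv := (conv H B).
Local Notation un := (u_ H B φ).
Local Notation rt := (rt H).
Local Notation lt := (lt H).

Let hφ : hom (H ⊠ B) B φ. Proof. by case: hB => -[]. Qed.
Lemma hom_tpow2 s : hom (tpow H 2) B s -> hom (H ⊠ H) B s.
Proof. by rewrite /tpow /= otensAK. Qed.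
Lemma hom_tpow3 s : hom (tpow H 3) B s -> hom (H ⊠ H ⊠ H) B s.
Proof. by rewrite /tpow /= otensAK otensA. Qed.

Lemma coface20 s h k l : hom (tpow H 2) B s -> hom K H h -> hom K H k -> hom K H l ->
  coface H φ 2 0 s ∘ (h ⊗ k ⊗ l) = h ▹ (s ∘ (k ⊗ l)).
Proof. by move=> /hom_tpow2 hs hh hk hl; rewrite /coface /=; planar. Qed.

Lemma coface21 s h k l : hom (tpow H 2) B s -> hom K H h -> hom K H k -> hom K H l ->
  coface H φ 2 1 s ∘ (h ⊗ k ⊗ l) = s ∘ ((h · k) ⊗ l).
Proof. by move=> /hom_tpow2 hs hh hk hl; rewrite /coface /=; planar. Qed.

Lemma coface22 s h k l : hom (tpow H 2) B s -> hom K H h -> hom K H k -> hom K H l ->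
  coface H φ 2 2 s ∘ (h ⊗ k ⊗ l) = s ∘ (h ⊗ (k · l)).
Proof. by move=> /hom_tpow2 hs hh hk hl; rewrite /coface /=; planar. Qed.

Lemma coface23 i s h k l :
  hom (tpow H 2) B s -> hom K H h -> hom K H k -> hom K H l ->
  coface H φ 2 i.+3 s ∘ (h ⊗ k ⊗ l) = s ∘ (h ⊗ (k · (P l))).
Proof. by move=> /hom_tpow2 hs hh hk hl; rewrite /coface /=; planar. Qed.

Lemma coface30 s h k l m :
  hom (tpow H 3) B s -> hom K H h -> hom K H k -> hom K H l -> hom K H m ->
  coface H φ 3 0 s ∘ (h ⊗ k ⊗ l ⊗ m) = h ▹ (s ∘ (k ⊗ l ⊗ m)).
Proof. by move=> /hom_tpow3 hs hh hk hl hm; rewrite /coface /=; planar. Qed.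

Lemma coface31 s h k l m :
  hom (tpow H 3) B s -> hom K H h -> hom K H k -> hom K H l -> hom K H m ->
  coface H φ 3 1 s ∘ (h ⊗ k ⊗ l ⊗ m) = s ∘ ((h · k) ⊗ l ⊗ m).
Proof. by move=> /hom_tpow3 hs hh hk hl hm; rewrite /coface /=; planar. Qed.

Lemma coface32 s h k l m :
  hom (tpow H 3) B s -> hom K H h -> hom K H k -> hom K H l -> hom K H m ->
  coface H φ 3 2 s ∘ (h ⊗ k ⊗ l ⊗ m) = s ∘ (h ⊗ (k · l) ⊗ m).
Proof. by move=> /hom_tpow3 hs hh hk hl hm; rewrite /coface /=; planar. Qed.

Lemma coface33 s h k l m :
  hom (tpow H 3) B s -> hom K H h -> hom K H k -> hom K H l -> hom K H m ->
  coface H φ 3 3 s ∘ (h ⊗ k ⊗ l ⊗ m) = s ∘ (h ⊗ k ⊗ (l · m)).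
Proof. by move=> /hom_tpow3 hs hh hk hl hm; rewrite /coface /=; planar. Qed.

Lemma coface34 i s h k l m :
  hom (tpow H 3) B s -> hom K H h -> hom K H k -> hom K H l -> hom K H m ->
  coface H φ 3 i.+4 s ∘ (h ⊗ k ⊗ l ⊗ m) = s ∘ (h ⊗ k ⊗ (l · (P m))).
Proof. by move=> /hom_tpow3 hs hh hk hl hm; rewrite /coface /=; planar. Qed.

Lemma muln_ofS n : muln_of H n.+2 = mul_of H ∘ (H ⊗ muln_of H n.+1).
Proof. by []. Qed.

Lemma muln_of1 h : hom K H h -> muln_of H 1 ∘ h = h.
Proof. by move=> hh; rewrite /=; planar. Qed.
Lemma muln_of2 h k : hom K H h -> hom K H k -> muln_of H 2 ∘ (h ⊗ k) = h · k.
Proof. by move=> hh hk; rewrite /=; planar. Qed.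
Lemma muln_of3 h k l : hom K H h -> hom K H k -> hom K H l ->
  muln_of H 3 ∘ (h ⊗ k ⊗ l) = h · (k · l).
Proof. by move=> hh hk hl; rewrite /=; planar. Qed.
Lemma muln_of4 h k l m : hom K H h -> hom K H k -> hom K H l -> hom K H m ->
  muln_of H 4 ∘ (h ⊗ k ⊗ l ⊗ m) = h · (k · (l · m)).
Proof. by move=> hh hk hl hm; rewrite /=; planar. Qed.

Lemma grouplike_muln n x : gl n.+1 x -> grouplike (muln_of H n.+1 ∘ x).
Proof.
elim: n x => [|n IH] x.
  by move=> /gl1 gx; have [hx _] := gx; rewrite muln_of1.
move=> /(glP hcc) [h [y [gh gy ->]]]; have gy' := IH _ gy.
have [hh _] := gh; have [hy _] := gy; have hm := hom_muln H n.+1.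
have -> : muln_of H n.+2 ∘ (h ⊗ y) = h · (muln_of H n.+1 ∘ y).
  by rewrite muln_ofS; planar.
exact: grouplike_mul.
Qed.

Lemma un_at n x : hom K (tpow H n) x -> un n ∘ x = u ∘ (muln_of H n ∘ x).
Proof. by move=> hx; have hm := hom_muln H n; rewrite /u_; planar. Qed.

Lemma u_mul_PiL h k : grouplike k -> hom K H h -> u ∘ (h · P k) = u ∘ (h · k).
Proof.
move=> gk hh; have [hk _] := gk.
by rewrite !(u_mul hB) // (u_PiL hcc hB).
Qed.

(** This is why cofaces respect convolution: a group-like element acts
    multiplicatively on B, and maps that preserve group-like tuples preserve
    convolution. *)
Lemma coface_at (n i : nat) x : (n == 2) || (n == 3) -> gl n.+1 x ->
  (exists h y, [/\ grouplike h, gl n y,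
     muln_of H n.+1 ∘ x = h · (muln_of H n ∘ y) &
     forall s, hom (tpow H n) B s -> coface H φ n i s ∘ x = h ▹ (s ∘ y)]) \/
  (exists y, [/\ gl n y,
     u ∘ (muln_of H n.+1 ∘ x) = u ∘ (muln_of H n ∘ y) &
     forall s, hom (tpow H n) B s -> coface H φ n i s ∘ x = s ∘ y]).
Proof.
case/orP=> /eqP->.
  move=> /(gl3P hcc) [h [k' [l [gh gk gl ->]]]].
  have [hh _] := gh; have [hk _] := gk; have [hl _] := gl.
  have gpl := grouplike_PiL hcc gl; have [hpl _] := gpl.
  have gkl := grouplike_mul gk gl; have [hkl _] := gkl.
  have ghk := grouplike_mul gh gk; have [hhk _] := ghk.
  have gkp := grouplike_mul gk gpl; have [hkp _] := gkp.
  case: i => [|[|[|i]]].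
  - left; exists h, (k' ⊗ l); split=> //; first exact: gl2.
      by rewrite muln_of3 // muln_of2.
    by move=> s hs; rewrite coface20.
  - right; exists ((h · k') ⊗ l); split; first exact: gl2.
      by rewrite muln_of3 // muln_of2 // el_mulA.
    by move=> s hs; rewrite coface21.
  - right; exists (h ⊗ (k' · l)); split; first exact: gl2.
      by rewrite muln_of3 // muln_of2.
    by move=> s hs; rewrite coface22.
  right; exists (h ⊗ (k' · P l)); split; first exact: gl2.
    by rewrite muln_of3 // muln_of2 // -!el_mulA // u_mul_PiL.
  by move=> s hs; rewrite coface23.
move=> /(gl4P hcc) [h [k' [l [m [gh gk gl gm ->]]]]].
have [hh _] := gh; have [hk _] := gk; have [hl _] := gl; have [hm _] := gm.
have gpm := grouplike_PiL hcc gm; have [hpm _] := gpm.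
have ghk := grouplike_mul gh gk; have [hhk _] := ghk.
have gkl := grouplike_mul gk gl; have [hkl _] := gkl.
have glm := grouplike_mul gl gm; have [hlm _] := glm.
have glp := grouplike_mul gl gpm; have [hlp _] := glp.
case: i => [|[|[|[|i]]]].
- left; exists h, (k' ⊗ l ⊗ m); split=> //; first exact: gl3.
    by rewrite muln_of4 // muln_of3.
  by move=> s hs; rewrite coface30.
- right; exists ((h · k') ⊗ l ⊗ m); split; first exact: gl3.
    by rewrite muln_of4 // muln_of3 // el_mulA.
  by move=> s hs; rewrite coface31.
- right; exists (h ⊗ (k' · l) ⊗ m); split; first exact: gl3.
    by rewrite muln_of4 // muln_of3 // el_mulA.
  by move=> s hs; rewrite coface32.
- right; exists (h ⊗ k' ⊗ (l · m)); split; first exact: gl3.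
    by rewrite muln_of4 // muln_of3.
  by move=> s hs; rewrite coface33.
right; exists (h ⊗ k' ⊗ (l · P m)); split; first exact: gl3.
  by rewrite muln_of4 // muln_of3 // -!el_mulA // u_mul_PiL.
by move=> s hs; rewrite coface34.
Qed.

Lemma coface_conv_at (n i : nat) s t x : (n == 2) || (n == 3) ->
  hom (tpow H n) B s -> hom (tpow H n) B t -> gl n.+1 x ->
  coface H φ n i (cv n s t) ∘ x
  = cv n.+1 (coface H φ n i s) (coface H φ n i t) ∘ x.
Proof.
move=> n23 hs ht' gx; have n0 : 0 < n by case/orP: n23 => /eqP->.
have hst := hom_conv hs ht'.
have hcs := hom_coface hφ i n0 hs; have hct := hom_coface hφ i n0 ht'.
rewrite conv_at //.
case: (coface_at i n23 gx) => [[h [y [gh gy _ e]]]|[y [gy _ e]]].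
  have [hh _] := gh; have [hy _] := gy.
  by rewrite !e // conv_at // (act_mul hB).
by rewrite !e // conv_at.
Qed.

Lemma coface_un_at (n i : nat) x : (n == 2) || (n == 3) -> gl n.+1 x ->
  coface H φ n i (un n) ∘ x = un n.+1 ∘ x.
Proof.
move=> n23 gx; have hu := hom_u hφ n; have [hx _] := gx; have hm := hom_muln H n.
rewrite (un_at hx).
case: (coface_at i n23 gx) => [[h [y [gh gy em e]]]|[y [gy em e]]].
  have [hh _] := gh; have [hy _] := gy.
  by rewrite !e // un_at // em (u_mul hB).
by have [hy _] := gy; rewrite !e // un_at.
Qed.

Lemma un_idem_at n x : gl n.+1 x -> cv n.+1 (un n.+1) (un n.+1) ∘ x = un n.+1 ∘ x.
Proof.
move=> gx; have [hx _] := gx; have hu := hom_u hφ n.+1.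
rewrite conv_at // un_at // (u_idem hB) //; exact: grouplike_muln.
Qed.

(** The hypothesis says that S is supported on the x composable with k, hence
    S(1) = S(1_1) ε(1_2 k) = S(Π^L(k)). The gain is that Π^L(k) is group-like,
    unlike 1. *)
Lemma unit_right S U k : grouplike k -> hom H B S -> hom H B U ->
  S = μ ∘ (S ⊗ (U ∘ rt k)) ∘ Δ -> S ∘ η = S ∘ P k.
Proof.
move=> gk hS hU e; have [hk _] := gk.
have e1 : U ∘ rt k = ((U ∘ rt k) ⊗ (ε ∘ rt k)) ∘ Δ.
  transitivity (U ∘ ((H ⊗ ε) ∘ ((rt k ⊗ rt k) ∘ Δ))); last by planar.
  by rewrite -comul_rt // [(H ⊗ ε) ∘ _]mcompA // comul_counitr; planar.
have e2 : S = (S ⊗ (ε ∘ rt k)) ∘ Δ.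
  rewrite {1}e e1.
  transitivity (μ ∘ (S ⊗ (U ∘ rt k) ⊗ (ε ∘ rt k)) ∘ ((H ⊗ Δ) ∘ Δ)); first by planar.
  rewrite -comul_coassoc.
  transitivity (((μ ∘ (S ⊗ (U ∘ rt k)) ∘ Δ) ⊗ (ε ∘ rt k)) ∘ Δ); first by planar.
  by rewrite -e.
rewrite {1}e2 PiL_el //.
by rewrite /unit2; planar.
Qed.

Lemma unit_left S U k : grouplike k -> hom H B S -> hom H B U ->
  S = μ ∘ (S ⊗ (U ∘ lt k)) ∘ Δ -> S ∘ η = S ∘ (PiR H ∘ k).
Proof.
move=> gk hS hU e; have [hk _] := gk.
have e1 : U ∘ lt k = ((U ∘ lt k) ⊗ (ε ∘ lt k)) ∘ Δ.
  transitivity (U ∘ ((H ⊗ ε) ∘ ((lt k ⊗ lt k) ∘ Δ))); last by planar.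
  by rewrite -comul_lt // [(H ⊗ ε) ∘ _]mcompA // comul_counitr; planar.
have e2 : S = (S ⊗ (ε ∘ lt k)) ∘ Δ.
  rewrite {1}e e1.
  transitivity (μ ∘ (S ⊗ (U ∘ lt k) ⊗ (ε ∘ lt k)) ∘ ((H ⊗ Δ) ∘ Δ)); first by planar.
  rewrite -comul_coassoc.
  transitivity (((μ ∘ (S ⊗ (U ∘ lt k)) ∘ Δ) ⊗ (ε ∘ lt k)) ∘ Δ); first by planar.
  by rewrite -e.
rewrite {1}e2 PiR_el // -(unit2C hcc).
rewrite [((ε ∘ lt k) ⊗ H) ∘ _]mcompA // -(@braid_natr C H H K (ε ∘ lt k)) //.
by rewrite braid_A_K /unit2; planar.
Qed.

(** Absorbing the unit of convolution means vanishing on the tuples that are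
    not composable. *)
Definition supported n s := hom (tpow H n) B s /\ cv n s (un n) = s.

Lemma comul_slot0 n x k : gl n k -> 
  comuln H n.+1 ∘ (H ⊗ k) = (H ⊗ k ⊗ H ⊗ k) ∘ Δ.
Proof.
case=> hk gk; have hc := hom_comuln H n.
rewrite /= /tensor_comul.
transitivity ((H ⊗ braid H (tpow H n) ⊗ tpow H n) ∘ (Δ ⊗ (comuln H n ∘ k))).
  by planar.
rewrite gk; transitivity ((H ⊗ (braid H (tpow H n) ∘ (H ⊗ k)) ⊗ k) ∘ Δ).
  by planar.
by rewrite braid_elr //; planar.
Qed.

Lemma comul_slotS n h f : grouplike h -> hom H (tpow H n) f ->
  comuln H n ∘ f = (f ⊗ f) ∘ Δ ->
  comuln H n.+1 ∘ (h ⊗ f) = (h ⊗ f ⊗ h ⊗ f) ∘ Δ.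
Proof.
case=> hh gh hf e; have hc := hom_comuln H n.
rewrite /= /tensor_comul.
transitivity ((H ⊗ braid H (tpow H n) ⊗ tpow H n) ∘ ((Δ ∘ h) ⊗ (comuln H n ∘ f))).
  by planar.
rewrite gh e.
transitivity ((h ⊗ (braid H (tpow H n) ∘ (h ⊗ f)) ⊗ f) ∘ Δ).
  by planar.
rewrite (braid_nat hh hf) braid_K_A; planar.
Qed.

Lemma supported_slot n s f : supported n s -> hom H (tpow H n) f ->
  comuln H n ∘ f = (f ⊗ f) ∘ Δ ->
  s ∘ f = μ ∘ ((s ∘ f) ⊗ (un n ∘ f)) ∘ Δ.
Proof.
case=> hs e hf ef; have hc := hom_comuln H n; have hu := hom_u hφ n.
rewrite -{1}e /conv /convol.
transitivity (μ ∘ (s ⊗ un n) ∘ (comuln H n ∘ f)); first by planar.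
by rewrite ef; planar.
Qed.

Lemma supported2_0 s k : supported 2 s -> grouplike k ->
  s ∘ (η ⊗ k) = s ∘ (P k ⊗ k).
Proof.
move=> hs gk; have [hk _] := gk; have [/hom_tpow2 hs' _] := hs.
have hf : hom H (tpow H 2) (H ⊗ k) by rewrite /tpow /= otensAK; typecheck.
have g1 : gl 1 k by apply/gl1.
have := supported_slot hs hf.
rewrite comul_slot0 // (_ : un 2 ∘ (H ⊗ k) = u ∘ rt k); last first.
  by rewrite /u_ /= /rt; planar.
have -> : (H ⊗ k ⊗ H ⊗ k) ∘ Δ = ((H ⊗ k) ⊗ (H ⊗ k)) ∘ Δ by planar.
move=> /(_ erefl) e.
transitivity ((s ∘ (H ⊗ k)) ∘ η); first by planar.
by rewrite (unit_right gk _ _ e) //; planar.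
Qed.

Lemma supported2_1 s h : supported 2 s -> grouplike h ->
  s ∘ (h ⊗ η) = s ∘ (h ⊗ (PiR H ∘ h)).
Proof.
move=> hs gh; have [hh _] := gh; have [/hom_tpow2 hs' _] := hs.
have hf : hom H (tpow H 2) (h ⊗ H) by rewrite /tpow /= otensAK; typecheck.
have := supported_slot hs hf.
rewrite (comul_slotS (n := 1) gh); first last.
- by rewrite comuln1; planar.
- by rewrite /tpow /= otensAK.
rewrite (_ : un 2 ∘ (h ⊗ H) = u ∘ lt h); last first.
  by rewrite /u_ /= /lt; planar.
have -> : (h ⊗ H ⊗ h ⊗ H) ∘ Δ = ((h ⊗ H) ⊗ (h ⊗ H)) ∘ Δ by planar.
move=> /(_ erefl) e.
transitivity ((s ∘ (h ⊗ H)) ∘ η); first by planar.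
by rewrite (unit_left gh _ _ e) //; planar.
Qed.

Lemma supported3_0 s k l : supported 3 s -> grouplike k -> grouplike l ->
  s ∘ (η ⊗ k ⊗ l) = s ∘ (P k ⊗ k ⊗ l).
Proof.
move=> hs gk gl; have [hk _] := gk; have [hl _] := gl.
have [/hom_tpow3 hs' _] := hs.
have hf : hom H (tpow H 3) (H ⊗ (k ⊗ l)) by rewrite /tpow /= otensAK; typecheck.
have g2 := gl2 gk gl.
have := supported_slot hs hf.
rewrite comul_slot0 // (_ : un 3 ∘ (H ⊗ (k ⊗ l)) = (u ∘ rt l) ∘ rt k); last first.
  transitivity (u ∘ (mul_of H ∘ (H ⊗ mul_of H)) ∘ (H ⊗ k ⊗ l)).
    by rewrite /u_ /=; planar.
  by rewrite -mul_assoc /rt; planar.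
have -> : (H ⊗ (k ⊗ l) ⊗ H ⊗ (k ⊗ l)) ∘ Δ
   = ((H ⊗ (k ⊗ l)) ⊗ (H ⊗ (k ⊗ l))) ∘ Δ by planar.
move=> /(_ erefl) e.
transitivity ((s ∘ (H ⊗ (k ⊗ l))) ∘ η); first by planar.
by rewrite (unit_right gk _ _ e) //; planar.
Qed.

Lemma supported3_1 s h l : supported 3 s -> grouplike h -> grouplike l ->
  s ∘ (h ⊗ η ⊗ l) = s ∘ (h ⊗ (PiR H ∘ h) ⊗ l).
Proof.
move=> hs gh gl; have [hh _] := gh; have [hl _] := gl.
have [/hom_tpow3 hs' _] := hs.
have hf : hom H (tpow H 3) (h ⊗ (H ⊗ l)) by rewrite /tpow /= otensAK; typecheck.
have := supported_slot hs hf.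
have g1 : grouplike_tuple H 1 l by apply/gl1.
rewrite (comul_slotS (n := 2) gh); first last.
- by rewrite comul_slot0 //; planar.
- by rewrite /tpow /= otensAK.
rewrite (_ : un 3 ∘ (h ⊗ (H ⊗ l)) = (u ∘ rt l) ∘ lt h); last first.
  transitivity (u ∘ (mul_of H ∘ (H ⊗ mul_of H)) ∘ (h ⊗ H ⊗ l)).
    by rewrite /u_ /=; planar.
  by rewrite -mul_assoc /rt /lt; planar.
have -> : (h ⊗ (H ⊗ l) ⊗ h ⊗ (H ⊗ l)) ∘ Δ
   = ((h ⊗ (H ⊗ l)) ⊗ (h ⊗ (H ⊗ l))) ∘ Δ by planar.
move=> /(_ erefl) e.
transitivity ((s ∘ (h ⊗ (H ⊗ l))) ∘ η); first by planar.
by rewrite (unit_left gh _ _ e) //; planar.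
Qed.

Lemma supported3_2 s h k : supported 3 s -> grouplike h -> grouplike k ->
  s ∘ (h ⊗ k ⊗ η) = s ∘ (h ⊗ k ⊗ (PiR H ∘ k)).
Proof.
move=> hs gh gk; have [hh _] := gh; have [hk _] := gk.
have [/hom_tpow3 hs' _] := hs.
have hf : hom H (tpow H 3) (h ⊗ (k ⊗ H)) by rewrite /tpow /= otensAK; typecheck.
have := supported_slot hs hf.
rewrite (comul_slotS (n := 2) gh); first last.
- rewrite (comul_slotS (n := 1) gk); first by planar.
    by rewrite /tpow /= otensAK.
  by rewrite comuln1; planar.
- by rewrite /tpow /= otensAK.
rewrite (_ : un 3 ∘ (h ⊗ (k ⊗ H)) = (u ∘ lt h) ∘ lt k); last first.
  by rewrite /u_ /= /lt; planar.
have -> : (h ⊗ (k ⊗ H) ⊗ h ⊗ (k ⊗ H)) ∘ Δ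
   = ((h ⊗ (k ⊗ H)) ⊗ (h ⊗ (k ⊗ H))) ∘ Δ by planar.
move=> /(_ erefl) e.
transitivity ((s ∘ (h ⊗ (k ⊗ H))) ∘ η); first by planar.
by rewrite (unit_left gk _ _ e) //; planar.
Qed.

Definition degen n i : Mor C := tpow H i ⊗ η ⊗ tpow H (n.-1 - i).

Lemma degen20 k : hom K H k -> degen 2 0 ∘ k = η ⊗ k.
Proof. by move=> hk; rewrite /degen /tpow /=; planar. Qed.
Lemma degen21 k : hom K H k -> degen 2 1 ∘ k = k ⊗ η.
Proof. by move=> hk; rewrite /degen /tpow /=; planar. Qed.
Lemma degen30 h k : hom K H h -> hom K H k -> degen 3 0 ∘ (h ⊗ k) = η ⊗ h ⊗ k.
Proof. by move=> hh hk; rewrite /degen /tpow /=; planar. Qed.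
Lemma degen31 h k : hom K H h -> hom K H k -> degen 3 1 ∘ (h ⊗ k) = h ⊗ η ⊗ k.
Proof. by move=> hh hk; rewrite /degen /tpow /=; planar. Qed.
Lemma degen32 h k : hom K H h -> hom K H k -> degen 3 2 ∘ (h ⊗ k) = h ⊗ k ⊗ η.
Proof. by move=> hh hk; rewrite /degen /tpow /=; planar. Qed.

(** Inserting 1 does not preserve group-like tuples, but on supported
    morphisms it has the effect of inserting the identity of a neighbour,
    which does. *)
Lemma degen_at (n i : nat) x : (n == 2) || (n == 3) -> i < n -> gl n.-1 x ->
  exists2 y, gl n y & forall s, supported n s -> s ∘ (degen n i ∘ x) = s ∘ y.
Proof.
case/orP=> /eqP->; move=> lin.
  move=> /gl1 gx; have [hx _] := gx.
  case: i lin => [|[|//]] _.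
    rewrite degen20 //; exists (P x ⊗ x) => [|s hs]; last exact: supported2_0.
    by apply: gl2 => //; apply: grouplike_PiL.
  rewrite degen21 //; exists (x ⊗ (PiR H ∘ x)) => [|s hs]; last exact: supported2_1.
  by apply: gl2 => //; apply: grouplike_PiR.
move=> /(gl2P hcc) [h [k [gh gk ->]]]; have [hh _] := gh; have [hk _] := gk.
case: i lin => [|[|[|//]]] _.
- rewrite degen30 //; exists (P h ⊗ h ⊗ k) => [|s hs]; last exact: supported3_0.
  by apply: gl3 => //; apply: grouplike_PiL.
- rewrite degen31 //.
  exists (h ⊗ (PiR H ∘ h) ⊗ k) => [|s hs]; last exact: supported3_1.
  by apply: gl3 => //; apply: grouplike_PiR.
rewrite degen32 //.
exists (h ⊗ k ⊗ (PiR H ∘ k)) => [|s hs]; last exact: supported3_2.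
by apply: gl3 => //; apply: grouplike_PiR.
Qed.

Lemma mulr_unit x : hom K H x -> x · η = x.
Proof.
move=> hx; transitivity (mul_of H ∘ (H ⊗ η) ∘ x); first by planar.
by rewrite mul_unitr; planar.
Qed.
Lemma mull_unit x : hom K H x -> η · x = x.
Proof.
move=> hx; transitivity (mul_of H ∘ (η ⊗ H) ∘ x); first by planar.
by rewrite mul_unitl; planar.
Qed.

Lemma un_degen_at (n i : nat) x : (n == 2) || (n == 3) -> i < n -> gl n.-1 x ->
  un n ∘ (degen n i ∘ x) = un n.-1 ∘ x.
Proof.
case/orP=> /eqP->; move=> lin.
  move=> /gl1 gx; have [hx _] := gx; rewrite [un 2.-1 ∘ x]un_at; last first.
    by rewrite /tpow /= otensAK.
  rewrite muln_of1 //; case: i lin => [|[|//]] _.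
    by rewrite degen20 // un_at ?muln_of2 ?mull_unit // /tpow /= otensAK; typecheck.
  by rewrite degen21 // un_at ?muln_of2 ?mulr_unit // /tpow /= otensAK; typecheck.
move=> gx; have [hx' _] := gx; rewrite [un 3.-1 ∘ x]un_at //.
move: gx => /(gl2P hcc) [h [k [gh gk e]]]; have [hh _] := gh; have [hk _] := gk.
rewrite e muln_of2 //; case: i lin => [|[|[|//]]] _.
- by rewrite degen30 // un_at ?muln_of3 ?mull_unit // /tpow /= otensAK; typecheck.
- by rewrite degen31 // un_at ?muln_of3 ?mull_unit // /tpow /= otensAK; typecheck.
by rewrite degen32 // un_at ?muln_of3 ?mulr_unit // /tpow /= otensAK; typecheck.
Qed.

Lemma conv_degen_at (n i : nat) s t x :
  (n == 2) || (n == 3) -> i < n -> supported n s -> supported n t ->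
  supported n (cv n s t) -> gl n.-1 x ->
  cv n s t ∘ (degen n i ∘ x)
  = (s ∘ (degen n i ∘ x)) ⋆ (t ∘ (degen n i ∘ x)).
Proof.
move=> n23 lin hs ht' hst gx; have [y gy e] := degen_at n23 lin gx.
have [h1 _] := hs; have [h2 _] := ht'.
by rewrite !e // conv_at.
Qed.

End CofaceElements.

(** * The groups of regular morphisms *)

Section Regular.
Variables (C : smc) (H : weak_hopf C) (hcc : cocommutative H).
Variables (B : algebra C) (φ : Mor C) (hB : weak_module_algebra H B φ).
Implicit Types (s t : Mor C) (n i : nat).
Local Notation cv := (conv H B).
Local Notation un := (u_ H B φ).
Local Notation cof := (coface H φ).
Local Notation degen := (degen H).

Let hφ : hom (H ⊠ B) B φ. Proof. by case: hB => -[]. Qed.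

Lemma hom_degen n i : i < n -> hom (tpow H n.-1) (tpow H n) (degen n i).
Proof. exact: hom_degeneracy. Qed.

Lemma embed_degen (G : comonoid C) n i :
  embed G (degen n i) = Submission.degen (embed_wh G H) n i.
Proof. by rewrite /degen !embed_tens !embed_idm. Qed.

Lemma coface_conv n i s t : (n == 2) || (n == 3) ->
  hom (tpow H n) B s -> hom (tpow H n) B t ->
  cof n i (cv n s t) = cv n.+1 (cof n i s) (cof n i t).
Proof.
move=> n23 hs ht'; have n0 : 0 < n by case/orP: n23 => /eqP->.
have h1 := hom_coface hφ i n0 hs; have h2 := hom_coface hφ i n0 ht'.
have h3 := hom_conv hs ht'.
apply: (tuple_ext0 hcc (hom_coface hφ i n0 h3) (hom_conv h1 h2)) => x gx.
rewrite (embed_coface _ hφ) // embed_conv // embed_conv // !(embed_coface _ hφ) //.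
apply: (coface_conv_at (embed_cocomm _ hcc) (embed_wma _ hφ hB)) => //.
Qed.

Lemma coface_un n i : (n == 2) || (n == 3) -> cof n i (un n) = un n.+1.
Proof.
move=> n23; have n0 : 0 < n by case/orP: n23 => /eqP->.
have hu := hom_u hφ n.
apply: (tuple_ext0 hcc (hom_coface hφ i n0 hu) (hom_u hφ n.+1)) => x gx.
rewrite (embed_coface _ hφ) // !(embed_u _ hφ).
exact: (coface_un_at (embed_cocomm _ hcc) (embed_wma _ hφ hB)).
Qed.

Lemma un_idem n : cv n.+1 (un n.+1) (un n.+1) = un n.+1.
Proof.
have hu := hom_u hφ n.+1.
apply: (tuple_ext0 hcc (hom_conv hu hu) hu) => x gx.
rewrite embed_conv // !(embed_u _ hφ).
exact: (un_idem_at (embed_cocomm _ hcc) (embed_wma _ hφ hB)).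
Qed.

Lemma embed_supported (G : comonoid C) n s : supported H B φ n s ->
  supported (embed_wh G H) (embed_alg G B) (embed G φ) n (embed G s).
Proof.
case=> hs e; split; first exact: embed_hom.
by rewrite -(embed_u _ hφ) -embed_conv ?e //; apply: hom_u.
Qed.

Lemma conv_degen n i s t : (n == 2) || (n == 3) -> i < n ->
  supported H B φ n s -> supported H B φ n t -> supported H B φ n (cv n s t) ->
  cv n s t ∘ degen n i = cv n.-1 (s ∘ degen n i) (t ∘ degen n i).
Proof.
move=> n23 lin hs ht' hst; have [h1 _] := hs; have [h2 _] := ht'.
have hd := hom_degen lin; have hc := hom_conv h1 h2.
have h3 : hom (tpow H n.-1) B (s ∘ degen n i) by apply: hom_mcomp hd h1 _.
have h4 : hom (tpow H n.-1) B (t ∘ degen n i) by apply: hom_mcomp hd h2 _.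
have h5 : hom (tpow H n.-1) B (cv n s t ∘ degen n i) by apply: hom_mcomp hd hc _.
apply: (tuple_ext0 hcc h5 (hom_conv h3 h4)) => x gx; have [hx _] := gx.
have hd' : hom (tpow (embed_wh (power hcc n.-1) H) n.-1) (tpow (embed_wh (power hcc n.-1) H) n)
  (Submission.degen (embed_wh (power hcc n.-1) H) n i) by apply: hom_degeneracy.
have as_ f : hom (tpow H n) B f ->
    embed (power hcc n.-1) (f ∘ degen n i) ∘ x = embed (power hcc n.-1) f ∘ (Submission.degen (embed_wh (power hcc n.-1) H) n i ∘ x).
  move=> hf; rewrite embed_comp ?embed_degen; last exact: composable hd hf _.
  have hf' := embed_hom (power hcc n.-1) hf.
  by rewrite mcompA.
rewrite as_ // embed_conv // [embed _ (cv n.-1 _ _)]embed_conv // [RHS]conv_at // !as_ //.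
apply: (conv_degen_at (embed_cocomm _ hcc) (embed_wma _ hφ hB)) => //.
- exact: embed_supported.
- exact: embed_supported.
by rewrite -embed_conv //; apply: embed_supported.
Qed.

Lemma un_degen n i : (n == 2) || (n == 3) -> i < n ->
  un n ∘ degen n i = un n.-1.
Proof.
move=> n23 lin; have hu := hom_u hφ n; have hd := hom_degen lin.
have h : hom (tpow H n.-1) B (un n ∘ degen n i) by apply: hom_mcomp hd hu _.
apply: (tuple_ext0 hcc h (hom_u hφ n.-1)) => x gx; have [hx _] := gx.
have hu' := embed_hom (power hcc n.-1) hu.
have hd' := embed_hom (power hcc n.-1) hd.
rewrite embed_comp; last exact: composable hd hu _.
rewrite -mcompA; first last.
- exact: composable hd' hu' _.
- exact: composable hx hd' _.
rewrite embed_degen !(embed_u _ hφ).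
exact: (un_degen_at (embed_cocomm _ hcc) (embed_wma _ hφ hB)).
Qed.

Definition regular n s t := hom (tpow H n) B s /\ reg_inverse H B φ n s t.

Lemma regular_sym n s t : regular n s t -> regular n t s.
Proof. by case=> hs [ht' a b c d]; split=> //; split. Qed.

Lemma regular_ur n s t : regular n s t -> cv n s (un n) = s.
Proof. by case=> hs [ht' a b c d]; rewrite -b convA. Qed.

Lemma regular_ul n s t : regular n s t -> cv n (un n) s = s.
Proof. by case=> hs [ht' a b c d]; rewrite -a. Qed.

Lemma regular_uniq n s t t' : regular n s t -> regular n s t' -> t = t'.
Proof.
move=> r r'; have [hs [ht' a b c d]] := r; have [_ [ht2 a' b' c' d']] := r'.
have -> : t = cv n (un n) t by rewrite (regular_ul (regular_sym r)).
have -> : t' = cv n t' (un n) by rewrite (regular_ur (regular_sym r')).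
by rewrite -{1}b' -a convA.
Qed.

Lemma Reg_regular n s : Reg H B φ n s -> regular n s (reg_inv H B φ n s).
Proof.
case=> hs ex; split=> //; rewrite /reg_inv.
exact: (epsilon_spec (inhabits s) (reg_inverse H B φ n s) ex).
Qed.

Lemma regular_Reg n s t : regular n s t -> Reg H B φ n s.
Proof. by case=> hs h; split=> //; exists t. Qed.

Lemma regular_inv n s t : regular n s t -> reg_inv H B φ n s = t.
Proof.
by move=> r; exact: (regular_uniq (Reg_regular (regular_Reg r)) r).
Qed.

Lemma regular_mul n s t s' t' : regular n s t -> regular n s' t' ->
  regular n (cv n s s') (cv n t' t).
Proof.
move=> r r'; have [hs [ht' a b c d]] := r; have [hs' [ht2 a' b' c' d']] := r'.
have h1 := hom_conv hs hs'; have h2 := hom_conv ht2 ht'.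
have hu := hom_u hφ n.
have e1 : cv n (cv n s s') (cv n t' t) = un n.
  by rewrite convA // -[cv n (cv n s s') t']convA // a' (regular_ur r).
have e2 : cv n (cv n t' t) (cv n s s') = un n.
  by rewrite convA // -[cv n (cv n t' t) s]convA // b (regular_ur (regular_sym r')).
split=> //; split=> //; rewrite ?e1 ?e2 convA //.
  by rewrite (regular_ul r).
by rewrite (regular_ul (regular_sym r')).
Qed.

Lemma regular_un n : regular n.+1 (un n.+1) (un n.+1).
Proof.
have hu := hom_u hφ n.+1; have e := un_idem n.
by split=> //; split; rewrite ?e.
Qed.

Lemma regular_coface n i s t : (n == 2) || (n == 3) -> regular n s t ->
  regular n.+1 (cof n i s) (cof n i t).
Proof.
move=> n23 [hs [ht' a b c d]]; have n0 : 0 < n by case/orP: n23 => /eqP->.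
have h1 := hom_coface hφ i n0 hs; have h2 := hom_coface hφ i n0 ht'.
have h3 := hom_conv hs ht'; have h4 := hom_conv ht' hs.
split=> //; split=> //.
- by rewrite -coface_conv // a coface_un.
- by rewrite -coface_conv // b coface_un.
- by rewrite -!coface_conv // c.
by rewrite -!coface_conv // d.
Qed.

Lemma regular_supported n s t : regular n s t -> supported H B φ n s.
Proof. by move=> r; split; [case: r | exact: regular_ur r]. Qed.

Lemma regular_conv_degen n i s t s' t' : (n == 2) || (n == 3) -> i < n ->
  regular n s t -> regular n s' t' ->
  cv n s s' ∘ degen n i = cv n.-1 (s ∘ degen n i) (s' ∘ degen n i).
Proof.
move=> n23 lin r r'; apply: conv_degen => //; apply: regular_supported => //.
- exact: r.
- exact: r'.
exact: regular_mul r r'.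
Qed.

Definition normalized n s := forall i, i < n -> s ∘ degen n i = un n.-1.

Lemma RegPlusP n s t : regular n s t -> RegPlus H B φ n s <-> normalized n s.
Proof.
by move=> r; split=> [[]//|h]; split=> //; apply: regular_Reg r.
Qed.

Lemma normalized_mul n s t s' t' : (n == 2) || (n == 3) ->
  regular n s t -> regular n s' t' ->
  normalized n s -> normalized n s' -> normalized n (cv n s s').
Proof.
move=> n23 r r' h h' i lin.
rewrite (regular_conv_degen n23 lin r r') h // h' //.
by case/orP: n23 => /eqP->; apply: un_idem.
Qed.

Lemma normalized_inv n s t : (n == 2) || (n == 3) ->
  regular n s t -> normalized n s -> normalized n t.
Proof.
move=> n23 r h i lin; have rt' := regular_sym r.
have ru : regular n (un n) (un n) by case/orP: n23 => /eqP->; apply: regular_un.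
have := regular_conv_degen n23 lin r rt'; have := regular_conv_degen n23 lin ru rt'.
rewrite (regular_ul rt') h // un_degen // => <-.
by have [_ [_ -> _ _ _]] := r; rewrite un_degen.
Qed.

End Regular.

(** * The twisted and cocycle conditions *)

Section TwistedElements.
Variables (C : smc) (H : weak_hopf C) (hcc : cocommutative H).
Variables (B : algebra C) (φ : Mor C) (hB : weak_module_algebra H B φ).
Implicit Types (h k l m x y a b s t : Mor C).
Local Notation Δ := (comul H).
Local Notation ε := (counit H).
Local Notation μ := (mul_of B).
Local Notation "h · k" := (mul_of H ∘ (h ⊗ k)) (at level 39, left associativity).
Local Notation "a ⋆ b" := (μ ∘ (a ⊗ b)) (at level 39, left associativity).
Local Notation "h ▹ b" := (φ ∘ (h ⊗ b)) (at level 37, right associativity).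
Local Notation u := (u1 H B φ).
Local Notation P h := (PiL H ∘ h).
Local Notation grouplike := (grouplike H).
Local Notation cv := (conv H B).
Local Notation un := (u_ H B φ).
Local Notation lm := (lm B).
Local Notation rm := (rm B).
Local Notation ac := (ac B φ).

Let hφ : hom (H ⊠ B) B φ. Proof. by case: hB => -[]. Qed.

Lemma P_mor_at h : grouplike h -> P_mor H B φ ∘ (h ⊗ B) = ac h ⊗ h.
Proof.
case=> hh gh; rewrite /P_mor.
transitivity ((φ ⊗ H) ∘ (H ⊗ braid H B) ∘ ((Δ ∘ h) ⊗ B)); first by planar.
rewrite gh; transitivity ((φ ⊗ H) ∘ (h ⊗ (braid H B ∘ (h ⊗ B)))); first by planar.
by rewrite (braid_ell B hh) /ac; planar.
Qed.

Lemma F_mor_at s h k : hom (tpow H 2) B s -> grouplike h -> grouplike k ->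
  F_mor H s ∘ (h ⊗ k) = (s ∘ (h ⊗ k)) ⊗ (h · k).
Proof.
move=> /hom_tpow2 hs [hh gh] [hk gk]; rewrite /F_mor /comul2 /tensor_comul.
transitivity ((s ⊗ mul_of H) ∘ (H ⊗ braid H H ⊗ H) ∘ ((Δ ∘ h) ⊗ (Δ ∘ k))).
  by planar.
rewrite gh gk.
transitivity ((s ⊗ mul_of H) ∘ (h ⊗ (braid H H ∘ (h ⊗ k)) ⊗ k)); first by planar.
by rewrite braid_el //; planar.
Qed.

Definition twistL s : Mor C :=
  μ ∘ (B ⊗ s) ∘ (P_mor H B φ ⊗ H) ∘ (H ⊗ P_mor H B φ).
Definition twistR s : Mor C := μ ∘ (B ⊗ φ) ∘ (F_mor H s ⊗ B).
Definition cocyL s : Mor C :=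
  μ ∘ (B ⊗ s) ∘ (P_mor H B φ ⊗ H) ∘ (H ⊗ F_mor H s).
Definition cocyR s : Mor C := μ ∘ (B ⊗ s) ∘ (F_mor H s ⊗ H).

Lemma twistL_at s h k : hom (tpow H 2) B s -> grouplike h -> grouplike k ->
  twistL s ∘ (h ⊗ k ⊗ B) = rm (s ∘ (h ⊗ k)) ∘ ac h ∘ ac k.
Proof.
move=> /hom_tpow2 hs gh gk; have [hh _] := gh; have [hk _] := gk.
have hP := hom_P_mor hφ.
rewrite /twistL.
transitivity (μ ∘ (B ⊗ s) ∘ (P_mor H B φ ⊗ H) ∘ (h ⊗ (P_mor H B φ ∘ (k ⊗ B)))).
  by planar.
rewrite P_mor_at //.
transitivity (μ ∘ (B ⊗ s) ∘ ((P_mor H B φ ∘ (h ⊗ B)) ⊗ H) ∘ (ac k ⊗ k)).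
  by rewrite /ac; planar.
by rewrite P_mor_at // /rm /ac; planar.
Qed.

Lemma twistR_at s h k : hom (tpow H 2) B s -> grouplike h -> grouplike k ->
  twistR s ∘ (h ⊗ k ⊗ B) = lm (s ∘ (h ⊗ k)) ∘ ac (h · k).
Proof.
move=> hs gh gk; have [hh _] := gh; have [hk _] := gk.
have hF := hom_F_mor hs; have hs' := hom_tpow2 hs.
rewrite /twistR.
transitivity (μ ∘ (B ⊗ φ) ∘ ((F_mor H s ∘ (h ⊗ k)) ⊗ B)); first by planar.
by rewrite F_mor_at // /lm /ac; planar.
Qed.

Lemma cocyL_at s h k l :
  hom (tpow H 2) B s -> grouplike h -> grouplike k -> grouplike l ->
  cocyL s ∘ (h ⊗ k ⊗ l) = (h ▹ (s ∘ (k ⊗ l))) ⋆ (s ∘ (h ⊗ (k · l))).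
Proof.
move=> hs gh gk gl; have [hh _] := gh; have [hk _] := gk; have [hl _] := gl.
have hF := hom_F_mor hs; have hs' := hom_tpow2 hs; have hP := hom_P_mor hφ.
rewrite /cocyL.
transitivity (μ ∘ (B ⊗ s) ∘ (P_mor H B φ ⊗ H) ∘ (h ⊗ (F_mor H s ∘ (k ⊗ l)))).
  by planar.
rewrite F_mor_at //.
transitivity (μ ∘ (B ⊗ s) ∘ ((P_mor H B φ ∘ (h ⊗ B)) ⊗ H)
   ∘ ((s ∘ (k ⊗ l)) ⊗ (k · l))); first by planar.
by rewrite P_mor_at // /ac; planar.
Qed.

Lemma cocyR_at s h k l :
  hom (tpow H 2) B s -> grouplike h -> grouplike k -> grouplike l ->
  cocyR s ∘ (h ⊗ k ⊗ l) = (s ∘ (h ⊗ k)) ⋆ (s ∘ ((h · k) ⊗ l)).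
Proof.
move=> hs gh gk gl; have [hh _] := gh; have [hk _] := gk; have [hl _] := gl.
have hF := hom_F_mor hs; have hs' := hom_tpow2 hs.
rewrite /cocyR.
transitivity (μ ∘ (B ⊗ s) ∘ ((F_mor H s ∘ (h ⊗ k)) ⊗ l)); first by planar.
by rewrite F_mor_at //; planar.
Qed.

Lemma twisted_at s h k : hom (tpow H 2) B s -> twisted H B φ s ->
  grouplike h -> grouplike k ->
  rm (s ∘ (h ⊗ k)) ∘ ac h ∘ ac k = lm (s ∘ (h ⊗ k)) ∘ ac (h · k).
Proof.
move=> hs tw gh gk; rewrite -twistL_at // -twistR_at //.
by rewrite [twistL s]tw.
Qed.

Lemma supported_at s h k : supported H B φ 2 s -> grouplike h -> grouplike k ->
  (s ∘ (h ⊗ k)) ⋆ (u ∘ (h · k)) = s ∘ (h ⊗ k).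
Proof.
case=> hs e gh gk; have [hh _] := gh; have [hk _] := gk.
have g2 := gl2 gh gk; have [hhk _] := g2; have hu := hom_u hφ 2.
by rewrite -{2}e conv_at // (un_at hB) // muln_of2.
Qed.

(** The left-hand side vanishes unless k and l are composable, which is what
    the last coface tests. *)
Lemma cocyR_coface_at s h k l :
  supported H B φ 2 s -> grouplike h -> grouplike k -> grouplike l ->
  (s ∘ (h ⊗ k)) ⋆ (s ∘ ((h · k) ⊗ l))
  = (s ∘ (h ⊗ (k · P l))) ⋆ (s ∘ ((h · k) ⊗ l)).
Proof.
move=> sp gh gk gl; have [hs0 _] := sp; have hs := hom_tpow2 hs0.
have [hh _] := gh; have [hk _] := gk; have [hl _] := gl.
have ghk := grouplike_mul gh gk; have [hhk _] := ghk.
have gkl := grouplike_mul gk gl; have [hkl ekl] := gkl.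
rewrite mul_PiL_el //.
have e : k · l = (k · l) ⊗ (ε ∘ (k · l)).
  transitivity ((H ⊗ ε) ∘ Δ ∘ (k · l)); first by rewrite comul_counitr; planar.
  by rewrite -mcompA // ekl; planar.
have e2 : s ∘ ((h · k) ⊗ l) = (s ∘ ((h · k) ⊗ l)) ⊗ (ε ∘ (k · l)).
  rewrite -{1}(supported_at sp ghk gl) el_mulA // {1}e.
  transitivity (((s ∘ ((h · k) ⊗ l)) ⋆ (u ∘ (h · (k · l)))) ⊗ (ε ∘ (k · l))).
    by rewrite /u1; planar.
  by rewrite -el_mulA // supported_at.
rewrite {1}e2; planar.
Qed.

Lemma ac_u h : grouplike h -> lm (u ∘ h) ∘ ac h = ac h.
Proof.
move=> gh; have [hh _] := gh; rewrite (uE hB) // -(ac_lm hB) //.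
transitivity (ac h ∘ (μ ∘ (unit_of B ⊗ B))); first by rewrite /lm /ac; planar.
by rewrite mul_unitl /ac; planar.
Qed.

Lemma rm_lm_u h : grouplike h -> rm (u ∘ h) = lm (u ∘ h).
Proof. by move=> gh; rewrite (rm_u hcc hB) // (lm_u hcc hB). Qed.

(** Let b be the ratio at (h, k) and g = h k. Comparing the two twisted
    conditions shows that b commutes with the image of the action of g. The
    twisted condition for s at (g, λ(g)) shows that this image contains all
    multiples of u(g), and b is one of them. *)
Lemma twisted_ratio_at s s' a h k :
  hom (tpow H 2) B s -> hom (tpow H 2) B s' -> hom (tpow H 2) B a ->
  cv 2 s s' = un 2 -> cv 2 s' s = un 2 -> cv 2 s (un 2) = s ->
  cv 2 (un 2) s' = s' ->
  cv 2 a (un 2) = a -> cv 2 (un 2) a = a ->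
  twisted H B φ s -> twisted H B φ a -> grouplike h -> grouplike k ->
  lm (cv 2 s' a ∘ (h ⊗ k)) = rm (cv 2 s' a ∘ (h ⊗ k)).
Proof.
move=> hs hs' ha e1 e2 e3 e4 e5 e6 ts ta gh gk.
have [hh _] := gh; have [hk _] := gk; have hu := hom_u hφ 2.
have conv2 p q x y : hom (tpow H 2) B p -> hom (tpow H 2) B q ->
    grouplike x -> grouplike y ->
    cv 2 p q ∘ (x ⊗ y) = (p ∘ (x ⊗ y)) ⋆ (q ∘ (x ⊗ y)).
  by move=> hp hq gx gy; apply: conv_at => //; apply: gl2.
have un2 x y : grouplike x -> grouplike y -> un 2 ∘ (x ⊗ y) = u ∘ (x · y).
  move=> gx gy; have [hx _] := gx; have [hy _] := gy.
  by have [hxy _] := gl2 gx gy; rewrite (un_at hB) // muln_of2.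
have h2 p x y : hom (tpow H 2) B p -> grouplike x -> grouplike y ->
    hom K B (p ∘ (x ⊗ y)).
  by move=> hp gx gy; have [hxy _] := gl2 gx gy; apply: hom_mcomp hxy hp _.
rewrite conv2 //.
pose g := h · k; have gg : grouplike g by apply: grouplike_mul.
have [hg _] := gg.
have a1 := h2 _ _ _ hs gh gk; have a2 := h2 _ _ _ hs' gh gk.
have a3 := h2 _ _ _ ha gh gk.
move: (conv2 _ _ _ _ hs hs' gh gk) (conv2 _ _ _ _ hs' hs gh gk)
  (conv2 _ _ _ _ hu ha gh gk) (conv2 _ _ _ _ ha hu gh gk)
  (conv2 _ _ _ _ hu hs' gh gk).
rewrite e1 e2 e4 e5 e6 !un2 // -/g.
have := twisted_at hs ts gh gk; have := twisted_at ha ta gh gk; rewrite -/g.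
move: (s ∘ (h ⊗ k)) (s' ∘ (h ⊗ k)) (a ∘ (h ⊗ k)) a1 a2 a3 => s1 s1' b1 a1 a2 a3.
move=> tb ts1 f1 f2 f3 f4 f5.
pose U := u ∘ g; have hU : hom K B U by rewrite /U; typecheck.
rewrite -/U in f1 f2 f3 f4 f5.
have hb : hom K B (s1' ⋆ b1) by typecheck.
have c1 : rm (s1' ⋆ b1) ∘ ac g = lm (s1' ⋆ b1) ∘ ac g.
  have k1 : rm s1' ∘ lm s1 ∘ ac g = rm U ∘ ac h ∘ ac k.
    transitivity (rm s1' ∘ (lm s1 ∘ ac g)); first by planar.
    by rewrite -ts1 f1 rm_mul //; planar.
  have k2 : rm (s1' ⋆ b1) ∘ lm s1 ∘ ac g = lm b1 ∘ ac g.
    rewrite rm_mul //.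
    transitivity (rm b1 ∘ (rm s1' ∘ lm s1 ∘ ac g)); first by planar.
    rewrite k1 -tb {2}f3 rm_mul //; planar.
  rewrite [RHS](_ : _ = lm s1' ∘ (lm b1 ∘ ac g)); last by rewrite lm_mul //; planar.
  rewrite -k2.
  transitivity (lm s1' ∘ rm (s1' ⋆ b1) ∘ lm s1 ∘ ac g); last by planar.
  rewrite lm_rm //.
  transitivity (rm (s1' ⋆ b1) ∘ (lm s1' ∘ lm s1) ∘ ac g); last by planar.
  rewrite -lm_mul // -f2.
  transitivity (rm (s1' ⋆ b1) ∘ (lm U ∘ ac g)); last by planar.
  by rewrite /U ac_u.
have [Y hY c2] : exists2 Y, hom B B Y & ac g ∘ Y = lm U.
  have gl := grouplike_antipode hcc gg; have [hl _] := gl.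
  pose L := antipode H ∘ g; rewrite -/L in gl hl.
  have b1' := h2 _ _ _ hs gg gl; have b2' := h2 _ _ _ hs' gg gl.
  have uL : u ∘ (g · L) = U by rewrite mul_antipode // (u_PiL hcc hB).
  move: (conv2 _ _ _ _ hs hs' gg gl) (conv2 _ _ _ _ hs hu gg gl).
  rewrite e1 e3 un2 // uL.
  have := twisted_at hs ts gg gl; rewrite mul_antipode // -(lm_u hcc hB) // -/U.
  move: (s ∘ (g ⊗ L)) (s' ∘ (g ⊗ L)) b1' b2' => t1 t1' b1' b2' tt g1 g2.
  (* Y conjugates by s(g, λ(g)) and then acts by λ(g). *)
  exists (ac L ∘ (lm t1' ∘ rm t1)); first by typecheck.
  have k1 : rm t1 ∘ (ac g ∘ (ac L ∘ (lm t1' ∘ rm t1))) = lm U ∘ rm t1.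
    transitivity ((rm t1 ∘ ac g ∘ ac L) ∘ (lm t1' ∘ rm t1)); first by planar.
    rewrite tt -lm_mul // -g2 mcompA; [|compose_ok|compose_ok].
    by rewrite -lm_mul // -g1.
  transitivity (rm U ∘ (ac g ∘ (ac L ∘ (lm t1' ∘ rm t1)))).
    rewrite {1}/U rm_lm_u // -/U.
    transitivity ((lm U ∘ ac g) ∘ (ac L ∘ (lm t1' ∘ rm t1))); last by planar.
    by rewrite /U ac_u.
  rewrite {1}g1 rm_mul //.
  transitivity (rm t1' ∘ (rm t1 ∘ (ac g ∘ (ac L ∘ (lm t1' ∘ rm t1))))).
    by planar.
  rewrite k1 mcompA; [|compose_ok|compose_ok].
  rewrite -lm_rm // -mcompA; [|compose_ok|compose_ok].
  rewrite -rm_mul // -g1 {2}/U rm_lm_u // -lm_mul //.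
  by rewrite /U (u_idem hB).
have c3 : rm (s1' ⋆ b1) ∘ lm U = lm (s1' ⋆ b1) ∘ lm U.
  rewrite -c2 mcompA; [|compose_ok|compose_ok].
  by rewrite c1 -mcompA; [|compose_ok|compose_ok].
rewrite [LHS](_ : _ = lm (s1' ⋆ b1) ∘ lm U); last first.
  by rewrite -lm_mul // el_mulA // -f4.
rewrite -c3 {1}/U -rm_lm_u // -/U -rm_mul //.
by rewrite -el_mulA // -f5.
Qed.

Lemma twisted_mul_central_at s t h k :
  hom (tpow H 2) B s -> hom (tpow H 2) B t -> twisted H B φ s ->
  grouplike h -> grouplike k -> lm (t ∘ (h ⊗ k)) = rm (t ∘ (h ⊗ k)) ->
  twistL (cv 2 s t) ∘ (h ⊗ k ⊗ B) = twistR (cv 2 s t) ∘ (h ⊗ k ⊗ B).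
Proof.
move=> hs ht' ts gh gk e; have hst := hom_conv hs ht'.
rewrite twistL_at // twistR_at // conv_at //; last exact: gl2.
have [hxy _] := gl2 gh gk; have := twisted_at hs ts gh gk.
have b1 : hom K B (s ∘ (h ⊗ k)) by apply: hom_mcomp hxy hs _.
have b2 : hom K B (t ∘ (h ⊗ k)) by apply: hom_mcomp hxy ht' _.
have ghk := grouplike_mul gh gk; have [hhk _] := ghk.
have [hh _] := gh; have [hk _] := gk.
have a1 := hom_ac hB hh; have a2 := hom_ac hB hk; have a3 := hom_ac hB hhk.
move: (s ∘ (h ⊗ k)) (t ∘ (h ⊗ k)) b1 b2 e => s1 t1 b1 b2 e tw.
have [[l1 l2] [r1 r2]] := ((hom_lm b1, hom_lm b2), (hom_rm b1, hom_rm b2)).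
rewrite rm_mul // lm_mul //.
transitivity (rm t1 ∘ (rm s1 ∘ ac h ∘ ac k)); first by planar.
rewrite tw -e.
transitivity ((lm t1 ∘ lm s1) ∘ ac (h · k)); first by planar.
by rewrite e -lm_rm // -e.
Qed.

End TwistedElements.

Section Central.
Variables (C : smc) (B : algebra C).
Implicit Types (f x b : Mor C).

Lemma central_rm A f b : hom A B f -> hom K B b -> central B f ->
  rm B b ∘ f = lm B b ∘ f.
Proof.
move=> hf hb e; rewrite /rm /lm.
transitivity (mul_of B ∘ (B ⊗ f) ∘ (b ⊗ A)); last by planar.
rewrite e.
transitivity (mul_of B ∘ (braid B B ∘ (b ⊗ B)) ∘ f); last by planar.
by rewrite braid_ell //; planar.
Qed.

Lemma central_el A f x : hom A B f -> hom K A x -> central B f ->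
  lm B (f ∘ x) = rm B (f ∘ x).
Proof.
move=> hf hx e; rewrite /rm /lm.
transitivity (mul_of B ∘ (B ⊗ f) ∘ (B ⊗ x)); last by planar.
rewrite e.
transitivity (mul_of B ∘ (braid B B ∘ (B ⊗ (f ∘ x)))); last by planar.
by rewrite braid_elr //; typecheck.
Qed.

Lemma lm_rm_braid A f x : hom A B f -> hom K A x ->
  lm B (f ∘ x) = rm B (f ∘ x) ->
  mul_of B ∘ (f ⊗ B) ∘ (x ⊗ B) = mul_of B ∘ braid B B ∘ (f ⊗ B) ∘ (x ⊗ B).
Proof.
move=> hf hx e; have hfx : hom K B (f ∘ x) by typecheck.
transitivity (lm B (f ∘ x)); first by rewrite /lm; planar.
rewrite e /rm -(braid_ell B hfx); planar.
Qed.

Lemma embed_central (G : comonoid C) A f : hom A B f -> central B f ->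
  central (embed_alg G B) (embed G f).
Proof.
move=> hf e; rewrite /central; move: (congr1 (embed G) e).
by rewrite !embed_comp // !embed_tens !embed_idm.
Qed.

End Central.

Section TwistedMorphisms.
Variables (C : smc) (H : weak_hopf C) (hcc : cocommutative H).
Variables (B : algebra C) (φ : Mor C) (hB : weak_module_algebra H B φ).
Implicit Types (s t a : Mor C) (n i : nat).
Local Notation cv := (conv H B).
Local Notation un := (u_ H B φ).
Local Notation cof := (coface H φ).
Local Notation μ := (mul_of B).
Local Notation regular := (regular H B φ).

Let hφ : hom (H ⊠ B) B φ. Proof. by case: hB => -[]. Qed.

Lemma twisted_ratio_central s s' a a' :
  regular 2 s s' -> regular 2 a a' -> twisted H B φ s -> twisted H B φ a ->
  central B (cv 2 s' a).
Proof.
move=> rs ra ts ta; have [hs [hs' e1 e2 _ _]] := rs; have [ha _] := ra.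
have hb := hom_conv hs' ha; have hu := hom_u hφ 2.
have e3 := regular_ur hcc rs; have e4 := regular_ul (regular_sym rs).
have e5 := regular_ur hcc ra; have e6 := regular_ul ra.
have e : μ ∘ (cv 2 s' a ⊗ B) = μ ∘ braid B B ∘ (cv 2 s' a ⊗ B).
  apply: (tuple_ext hcc B (n := 2) (X := B)); [by typecheck|by typecheck|] => x gx.
  have [h [k [gh gk ->]]] := gl2P (embed_cocomm _ hcc) gx.
  have := @twisted_ratio_at _ _ (embed_cocomm (power hcc 2) hcc) _ _
    (embed_wma (power hcc 2) hφ hB) (embed _ s) (embed _ s') (embed _ a) h k
    (embed_hom _ hs) (embed_hom _ hs') (embed_hom _ ha).
  rewrite -!(embed_u _ hφ) -!embed_conv // e1 e2 e3 e4 e5 e6.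
  move=> /(_ erefl erefl erefl erefl erefl erefl).
  move=> /(_ (embed_twisted _ hφ hs ts) (embed_twisted _ hφ ha ta) gh gk).
  have [hx _] := gl2 gh gk.
  move: (cv 2 s' a) hb => b' hb; have hb' := embed_hom (power hcc 2) hb.
  rewrite !embed_comp // !embed_tens embed_idm.
  move: (embed _ b') hb' => b hb' e.
  exact: (@lm_rm_braid _ (embed_alg (power hcc 2) B) _ _ _ hb' hx e).
rewrite /central.
transitivity (μ ∘ (B ⊗ cv 2 s' a) ∘ (braid (tpow H 2) B ∘ braid B (tpow H 2))).
  by rewrite braidK; planar.
transitivity (μ ∘ (braid B B ∘ (cv 2 s' a ⊗ B)) ∘ braid B (tpow H 2)).
  by rewrite (braid_natl B hb); planar.
transitivity (μ ∘ (cv 2 s' a ⊗ B) ∘ braid B (tpow H 2)).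
  by rewrite e; planar.
transitivity (μ ∘ ((cv 2 s' a ⊗ B) ∘ braid B (tpow H 2))); first by planar.
by rewrite -(braid_natr B hb); planar.
Qed.

Lemma twisted_mul_central s t : hom (tpow H 2) B s -> hom (tpow H 2) B t ->
  twisted H B φ s -> central B t -> twisted H B φ (cv 2 s t).
Proof.
move=> hs ht' ts ct; have hst := hom_conv hs ht'.
have hP := hom_P_mor hφ; have hF := hom_F_mor hst.
have hst' := hom_tpow2 hst.
have hL : hom (tpow H 2 ⊠ B) B (twistL H B φ (cv 2 s t)).
  by rewrite /twistL /tpow /= otensAK; move: (cv 2 s t) hst' => b hb; typecheck.
have hR : hom (tpow H 2 ⊠ B) B (twistR H B φ (cv 2 s t)).
  by rewrite /twistR /tpow /= otensAK; move: (F_mor _ _) hF => b hb; typecheck.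
rewrite /twisted -/(twistL H B φ (cv 2 s t)) -/(twistR H B φ (cv 2 s t)).
apply: (tuple_ext hcc B hL hR) => x gx.
have [h [k [gh gk ->]]] := gl2P (embed_cocomm _ hcc) gx.
have hs1 := embed_hom_power (power hcc 2) hs; have ht1 := embed_hom_power (power hcc 2) ht'.
have [hx _] := gl2 gh gk.
have := @twisted_mul_central_at _ _ _ _ (embed_wma (power hcc 2) hφ hB)
  (embed _ s) (embed _ t) h k hs1 ht1 (embed_twisted _ hφ hs ts) gh gk.
have cc : central (embed_alg (power hcc 2) B) (embed (power hcc 2) t).
  exact: (embed_central _ ht').
move=> /(_ (central_el ht1 hx cc)).
rewrite /twistL /twistR -(embed_P _ hφ) -embed_conv // -(embed_F (power hcc 2) hst).
move: (cv 2 s t) hst' hF (P_mor H B φ) hP => b hb; move: (F_mor H b) => F hF P hP.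
by rewrite !embed_comp // !embed_tens !embed_idm.
Qed.

Lemma cocyL_coface s : hom (tpow H 2) B s ->
  cocyL H B φ s = cv 3 (cof 2 0 s) (cof 2 2 s).
Proof.
move=> hs; have hs' := hom_tpow2 hs; have hP := hom_P_mor hφ; have hF := hom_F_mor hs.
have hL : hom (tpow H 3) B (cocyL H B φ s).
  rewrite /cocyL /tpow /= otensAK otensA.
  by move: (F_mor _ _) (P_mor _ _ _) hF hP => F P hF hP; typecheck.
have [h0 h2] := (hom_coface hφ 0 (isT : 0 < 2) hs, hom_coface hφ 2 (isT : 0 < 2) hs).
apply: (tuple_ext0 hcc hL (hom_conv h0 h2)) => x gx.
rewrite embed_conv // !(embed_coface _ hφ) //.
have [h [k [l [gh gk gl ->]]]] := gl3P (embed_cocomm _ hcc) gx.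
have hs1 := embed_hom_power (power hcc 3) hs.
have hφ1 : hom (embed_wh (power hcc 3) H ⊠ embed_alg (power hcc 3) B)
  (embed_alg (power hcc 3) B) (embed (power hcc 3) φ) by exact: embed_hom.
have [h01 h21] := (hom_coface hφ1 0 (isT : 0 < 2) hs1, hom_coface hφ1 2 (isT : 0 < 2) hs1).
have [hh _] := gh; have [hk _] := gk; have [hl _] := gl.
have hb1 := embed_wma (power hcc 3) hφ hB.
rewrite conv_at //; last exact: gl3.
rewrite (coface20 hb1) // (coface22 _ hs1) //.
rewrite -(cocyL_at hb1) // /cocyL -(embed_F (power hcc 3) hs) -(embed_P _ hφ).
move: (F_mor _ _) (P_mor _ _ _) hF hP => F P hF hP.
by rewrite !embed_comp // !embed_tens !embed_idm.
Qed.

Lemma cocyR_coface s : supported H B φ 2 s ->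
  cocyR H B s = cv 3 (cof 2 3 s) (cof 2 1 s).
Proof.
move=> ss; have [hs _] := ss; have hs' := hom_tpow2 hs; have hF := hom_F_mor hs.
have hL : hom (tpow H 3) B (cocyR H B s).
  rewrite /cocyR /tpow /= otensAK otensA.
  by move: (F_mor _ _) hF => F hF; typecheck.
have [h0 h2] := (hom_coface hφ 3 (isT : 0 < 2) hs, hom_coface hφ 1 (isT : 0 < 2) hs).
apply: (tuple_ext0 hcc hL (hom_conv h0 h2)) => x gx.
rewrite embed_conv // !(embed_coface _ hφ) //.
have [h [k [l [gh gk gl ->]]]] := gl3P (embed_cocomm _ hcc) gx.
have hs1 := embed_hom_power (power hcc 3) hs.
have hφ1 : hom (embed_wh (power hcc 3) H ⊠ embed_alg (power hcc 3) B)
  (embed_alg (power hcc 3) B) (embed (power hcc 3) φ) by exact: embed_hom.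
have [h01 h21] := (hom_coface hφ1 3 (isT : 0 < 2) hs1, hom_coface hφ1 1 (isT : 0 < 2) hs1).
have [hh _] := gh; have [hk _] := gk; have [hl _] := gl.
have hb1 := embed_wma (power hcc 3) hφ hB.
rewrite conv_at //; last exact: gl3.
rewrite (coface23 _ _ hs1) // (coface21 _ hs1) // -(cocyR_coface_at (embed_cocomm _ hcc) hb1) //.
  rewrite -cocyR_at // /cocyR -(embed_F (power hcc 3) hs).
  move: (F_mor _ _) hF => F hF.
  by rewrite !embed_comp // !embed_tens !embed_idm.
exact: embed_supported.
Qed.

Lemma pre_obstructionE s s' : regular 2 s s' ->
  pre_obstruction H B φ s
  = cv 3 (cv 3 (cv 3 (cof 2 0 s) (cof 2 2 s)) (cof 2 1 s')) (cof 2 3 s').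
Proof.
move=> r; rewrite /pre_obstruction.
rewrite (regular_inv hcc (regular_coface hcc hB 1 (isT : (2 == 2) || (2 == 3)) r)).
by rewrite (regular_inv hcc (regular_coface hcc hB 3 (isT : (2 == 2) || (2 == 3)) r)).
Qed.

(** The two sides of the cocycle condition are the products of the cofaces 0,
    2 and of the cofaces 3, 1. *)
Lemma cocycle_iff s s' : regular 2 s s' ->
  cocycle_condition H B φ s <-> pre_obstruction H B φ s = un 3.
Proof.
move=> r; rewrite (pre_obstructionE r).
have r0 := regular_coface hcc hB 0 (isT : (2 == 2) || (2 == 3)) r.
have r1 := regular_coface hcc hB 1 (isT : (2 == 2) || (2 == 3)) r.
have r2 := regular_coface hcc hB 2 (isT : (2 == 2) || (2 == 3)) r.
have r3 := regular_coface hcc hB 3 (isT : (2 == 2) || (2 == 3)) r.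
have r02 := regular_mul hcc hB r0 r2.
have r31 := regular_mul hcc hB r3 r1.
rewrite /cocycle_condition -/(cocyL H B φ s) -/(cocyR H B s).
have [hs _] := r.
rewrite (cocyL_coface hs) (cocyR_coface (regular_supported hcc r)).
move: r02 r31 r1 r3; set X := cv 3 (cof 2 0 s) _; set Y := cv 3 (cof 2 3 s) _.
move=> rX rY r1 r3; have [hX _] := rX; have [_ [hY' e1 e2 _ _]] := rY.
have [h1 [h1' _ _ _ _]] := r1; have [h3 [h3' _ _ _ _]] := r3.
have hY : hom (tpow H 3) B Y by case: rY.
split=> e.
  by rewrite e -convA // e1.
have e3 : cv 3 X (cv 3 (cof 2 1 s') (cof 2 3 s')) = un 3 by rewrite convA.
rewrite -(regular_ur hcc rX) -e2 convA // e3.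
exact: regular_ul rY.
Qed.

End TwistedMorphisms.

(** * Cochains with values in a commutative module algebra *)

Section CofaceDegen.
Variables (C : smc) (H : weak_hopf C) (hcc : cocommutative H).
Variables (B : algebra C) (φ : Mor C) (hB : weak_module_algebra H B φ).
Implicit Types (h k l m x y a b s t : Mor C).
Local Notation η := (unit_of H).
Local Notation ε := (counit H).
Local Notation "h · k" := (mul_of H ∘ (h ⊗ k)) (at level 39, left associativity).
Local Notation "h ▹ b" := (φ ∘ (h ⊗ b)) (at level 37, right associativity).
Local Notation u := (u1 H B φ).
Local Notation P h := (PiL H ∘ h).
Local Notation grouplike := (grouplike H).
Local Notation un := (u_ H B φ).
Local Notation cof := (coface H φ).
Local Notation degen := (degen H).

Let hφ : hom (H ⊠ B) B φ. Proof. by case: hB => -[]. Qed.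

Definition normal_at s := forall h, hom K H h ->
  s ∘ (η ⊗ h) = u ∘ h /\ s ∘ (h ⊗ η) = u ∘ h.

Lemma normal_atP s : hom (tpow H 2) B s ->
  s ∘ (η ⊗ H) = u -> s ∘ (H ⊗ η) = u -> normal_at s.
Proof.
by move=> /hom_tpow2 hs e1 e2 h hh; rewrite -{1}e1 -{1}e2; split; planar.
Qed.

(** A normalized cochain takes the value u(h) at (h, x) when x is the identity
    composable with h; here x is Π^L(l), and both sides vanish unless h and l
    are composable. *)
Lemma coface23_degen1_at s h l : supported H B φ 2 s ->
  supported H B φ 3 (cof 2 3 s) -> normal_at s -> grouplike h -> grouplike l ->
  cof 2 3 s ∘ (h ⊗ η ⊗ l) = u ∘ (h · l).
Proof.
move=> ss ss3 ns gh gl; have [hs0 _] := ss; have hs := hom_tpow2 hs0.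
have [hh _] := gh; have [hl _] := gl.
have gr := grouplike_PiR hcc gh; have [hom_infer _] := gr.
have [hp _] := grouplike_PiL hcc gl.
rewrite (supported3_1 hcc hB ss3 gh gl) (coface23 _ 0 hs0) //.
have e := mul_PiL_el hcc gr hl.
rewrite e.
transitivity ((s ∘ (h ⊗ (PiR H ∘ h))) ⊗ (ε ∘ ((PiR H ∘ h) · l))); first by planar.
rewrite -(supported2_1 hcc hB ss gh); have [_ ->] := ns h hh.
transitivity (u ∘ (h ⊗ (ε ∘ ((PiR H ∘ h) · l)))); first by rewrite /u1; planar.
rewrite -{1}(mul_PiR_self hcc gh).
transitivity (u ∘ (h · ((PiR H ∘ h) ⊗ (ε ∘ ((PiR H ∘ h) · l))))).
  by rewrite /u1; planar.
by rewrite -e -el_mulA // mul_PiR_self // (u_mul_PiL hcc hB).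
Qed.

(** The two cofaces that survive a degeneracy have consecutive indices, so
    they cancel in the alternating product. *)
Definition coface_degen_value s (i j : nat) : Mor C :=
  match j, i with
  | 0, 0 | 0, 1 | 1, 1 | 1, 2 | 2, 2 | 2, 3 => s
  | _, _ => un 2
  end.

Lemma coface_degen_at s (i j : nat) x : i <= 3 -> j < 3 ->
  supported H B φ 2 s -> supported H B φ 3 (cof 2 3 s) -> normal_at s ->
  grouplike_tuple H 2 x ->
  cof 2 i s ∘ (degen 3 j ∘ x) = coface_degen_value s i j ∘ x.
Proof.
move=> li lj ss ss3 ns /(gl2P hcc) [h [k [gh gk ->]]].
have [hh _] := gh; have [hk _] := gk; have [hs0 _] := ss; have hs := hom_tpow2 hs0.
have [hp _] := grouplike_PiL hcc gk; have [hq _] := grouplike_PiL hcc gh.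
have [hhk _] := grouplike_mul gh gk; have [g2 _] := gl2 gh gk.
have eu : un 2 ∘ (h ⊗ k) = u ∘ (h · k) by rewrite (un_at hB) // muln_of2.
case: j lj => [|[|[|//]]] _; rewrite ?degen30 ?degen31 ?degen32 //.
- case: i li => [|[|[|[|//]]]] _ /=.
  + by rewrite (coface20 hB hs0) // (act1 hB) //; typecheck.
  + by rewrite (coface21 _ hs0) // mull_unit.
  + by rewrite (coface22 _ hs0) //; have [-> _] := ns _ hhk; rewrite eu.
  + rewrite (coface23 _ 0 hs0) //.
    have [hhp _] := grouplike_mul gh (grouplike_PiL hcc gk).
    by have [-> _] := ns _ hhp; rewrite (u_mul_PiL hcc hB) // eu.
- case: i li => [|[|[|[|//]]]] _ /=.
  + by rewrite (coface20 hB hs0) //; have [-> _] := ns _ hk; rewrite eu (u_mul hB).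
  + by rewrite (coface21 _ hs0) // mulr_unit.
  + by rewrite (coface22 _ hs0) // mull_unit.
  + by rewrite coface23_degen1_at // eu.
- case: i li => [|[|[|[|//]]]] _ /=.
  + by rewrite (coface20 hB hs0) //; have [_ ->] := ns _ hk; rewrite eu (u_mul hB).
  + by rewrite (coface21 _ hs0) //; have [_ ->] := ns _ hhk; rewrite eu.
  + by rewrite (coface22 _ hs0) // mulr_unit.
  + by rewrite (coface23 _ 0 hs0) // PiL_unit // mulr_unit.
Qed.

(** The identity between the first two cofaces is the associativity of the
    action; the one between the last two is Π^L(l Π^L(m)) = Π^L(l m). *)
Lemma coface_coface_at s (i j : nat) x :
  φ ∘ (mul_of H ⊗ B) = φ ∘ (H ⊗ φ) -> i < j -> j <= 4 ->
  hom (tpow H 2) B s -> grouplike_tuple H 4 x ->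
  cof 3 j (cof 2 i s) ∘ x = cof 3 i (cof 2 j.-1 s) ∘ x.
Proof.
move=> ha ij j4 hs /(gl4P hcc) [h [k [l [m [gh gk gl gm ->]]]]].
have [hh _] := gh; have [hk _] := gk; have [hl _] := gl; have [hm _] := gm.
have [hhk _] := grouplike_mul gh gk.
have gkl := grouplike_mul gk gl; have [hkl _] := gkl.
have [hlm _] := grouplike_mul gl gm.
have [hpm _] := grouplike_PiL hcc gm.
have [hlp _] := grouplike_mul gl (grouplike_PiL hcc gm).
have hs' := hom_tpow2 hs.
have hc n : hom (tpow H 3) B (cof 2 n s) by apply: hom_coface.
case: j ij j4 => [//|[|[|[|[|//]]]]]; case: i => [|[|[|[|//]]]] // _ _ /=.
- rewrite (coface31 _ (hc 0)) // (coface30 hB (hc 0)) // !(coface20 hB hs) //.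
  transitivity (φ ∘ (mul_of H ⊗ B) ∘ (h ⊗ k ⊗ (s ∘ (l ⊗ m)))); first by planar.
  by rewrite ha; planar.
- rewrite (coface32 _ (hc 0)) // (coface30 hB (hc 1)) //.
  by rewrite (coface20 hB hs) // (coface21 _ hs).
- rewrite (coface32 _ (hc 1)) // (coface31 _ (hc 1)) // !(coface21 _ hs) //.
  by rewrite el_mulA.
- rewrite (coface33 _ (hc 0)) // (coface30 hB (hc 2)) //.
  by rewrite (coface20 hB hs) // (coface22 _ hs).
- rewrite (coface33 _ (hc 1)) // (coface31 _ (hc 2)) //.
  by rewrite (coface21 _ hs) // (coface22 _ hs).
- rewrite (coface33 _ (hc 2)) // (coface32 _ (hc 2)) // !(coface22 _ hs) //.
  by rewrite el_mulA.
- rewrite (coface34 _ 0 (hc 0)) // (coface30 hB (hc 3)) //.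
  by rewrite (coface20 hB hs) // (coface23 _ 0 hs).
- rewrite (coface34 _ 0 (hc 1)) // (coface31 _ (hc 3)) //.
  by rewrite (coface21 _ hs) // (coface23 _ 0 hs).
- rewrite (coface34 _ 0 (hc 2)) // (coface32 _ (hc 3)) //.
  by rewrite (coface22 _ hs) // (coface23 _ 0 hs) // el_mulA.
- rewrite (coface34 _ 0 (hc 3)) // (coface33 _ (hc 3)) // !(coface23 _ 0 hs) //.
  by rewrite PiL_mul_PiL.
Qed.

End CofaceDegen.

Section Cancellation.
Variables (T : Type) (op : T -> T -> T) (e : T).
Hypotheses (opA : associative op) (opC : commutative op) (op1 : left_id e op).
HB.instance Definition _ := Monoid.isComLaw.Build T e op opA opC op1.
Local Notation "x * y" := (op x y).

(** In the square of the coboundary, q_ij and r_ij are the common value of two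
    iterated cofaces, of indices i < j, and its inverse. *)
Lemma double_coboundary_cancel (q01 q02 q03 q04 q12 q13 q14 q23 q24 q34
    r01 r02 r03 r04 r12 r13 r14 r23 r24 r34 : T) :
  q01 * r01 = e -> q02 * r02 = e -> q03 * r03 = e -> q04 * r04 = e ->
  q12 * r12 = e -> q13 * r13 = e -> q14 * r14 = e -> q23 * r23 = e ->
  q24 * r24 = e -> q34 * r34 = e ->
  (q01 * r02 * q03 * r04) * (r01 * q12 * r13 * q14) * (q02 * r12 * q23 * r24)
  * (r03 * q13 * r23 * q34) * (q04 * r14 * q24 * r34) = e.
Proof.
move=> e01 e02 e03 e04 e12 e13 e14 e23 e24 e34.
rewrite op.[AC (4*4*4*4*4) ((1*5)*(9*2)*(3*13)*(17*4)*(6*10)*(14*7)*(8*18)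
  *(11*15)*(19*12)*(16*20))].
by rewrite e01 e02 e03 e04 e12 e13 e14 e23 e24 e34 !op1.
Qed.
End Cancellation.

Section Cochains.
Variables (C : smc) (H : weak_hopf C) (hcc : cocommutative H).
Variables (B : algebra C) (φ : Mor C) (hB : weak_module_algebra H B φ).
Implicit Types (s t : Mor C).
Local Notation cv := (conv H B).
Local Notation un := (u_ H B φ).
Local Notation cof := (coface H φ).
Local Notation degen := (degen H).
Local Notation regular := (regular H B φ).
Local Notation r23 := (isT : (2 == 2) || (2 == 3)).
Local Notation r33 := (isT : (3 == 2) || (3 == 3)).

Let hφ : hom (H ⊠ B) B φ. Proof. by case: hB => -[]. Qed.

Definition cobound2 s s' : Mor C :=
  cv 3 (cv 3 (cv 3 (cof 2 0 s) (cof 2 1 s')) (cof 2 2 s)) (cof 2 3 s').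

Definition cobound3 s s' : Mor C :=
  cv 4 (cv 4 (cv 4 (cv 4 (cof 3 0 s) (cof 3 1 s')) (cof 3 2 s)) (cof 3 3 s'))
    (cof 3 4 s).

Lemma Dk2E s s' : regular 2 s s' -> Dk H B φ 2 s = cobound2 s s'.
Proof.
move=> r; have inv i := regular_inv hcc (regular_coface hcc hB i r23 r).
by rewrite /cobound2 -(inv 1) -(inv 3).
Qed.

Lemma Dk3E s s' : regular 3 s s' -> Dk H B φ 3 s = cobound3 s s'.
Proof.
move=> r; have inv i := regular_inv hcc (regular_coface hcc hB i r33 r).
by rewrite /cobound3 -(inv 1) -(inv 3).
Qed.

Lemma cobound3_un : cobound3 (un 3) (un 3) = un 4.
Proof.
by rewrite /cobound3 !(coface_un hcc hB _ r33) !(un_idem hcc hB 3).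
Qed.

Lemma normalized_un n : (n == 2) || (n == 3) -> normalized H B φ n (un n).
Proof. by move=> n23 i lin; apply: un_degen. Qed.

Lemma normalized_normal s : hom (tpow H 2) B s -> normalized H B φ 2 s ->
  s ∘ (unit_of H ⊗ H) = u1 H B φ /\ s ∘ (H ⊗ unit_of H) = u1 H B φ.
Proof.
move=> hs n; have := n 0 isT; have := n 1 isT; have hs' := hom_tpow2 hs.
rewrite /degen /u_ /= /tpow /=.
have -> : u1 H B φ ∘ H = u1 H B φ by rewrite /u1; planar.
by move=> e1 e0; split; [rewrite -e0 | rewrite -e1]; planar.
Qed.

Lemma coface_degen s s' (i j : nat) : i <= 3 -> j < 3 ->
  regular 2 s s' -> normalized H B φ 2 s ->
  cof 2 i s ∘ degen 3 j = coface_degen_value H B φ s i j.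
Proof.
move=> li lj r ns; have hd := hom_degen H lj; have [hs _] := r.
have hc := hom_coface hφ i (isT : 0 < 2) hs; have hu := hom_u hφ 2.
have hL : hom (tpow H 2) B (cof 2 i s ∘ degen 3 j) by apply: hom_mcomp hd hc _.
have hR : hom (tpow H 2) B (coface_degen_value H B φ s i j).
  by case: j {lj hd hL} => [|[|[|j]]] /=; case: i {li hc} => [|[|[|[|i]]]].
apply: (tuple_ext0 hcc hL hR) => x gx; have [hx _] := gx.
have hb1 := embed_wma (power hcc 2) hφ hB.
have ss := embed_supported hB (power hcc 2) (regular_supported hcc r).
have ss3 := embed_supported hB (power hcc 2)
  (regular_supported hcc (regular_coface hcc hB 3 r23 r)).
rewrite (embed_coface _ hφ) // in ss3.
have hd' := embed_hom (power hcc 2) hd.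
have hc' := embed_hom (power hcc 2) hc.
rewrite embed_comp; last exact: composable hd hc _.
rewrite -mcompA; [|exact: composable hx hd' _|exact: composable hd' hc' _].
rewrite embed_degen (embed_coface _ hφ) //.
rewrite (coface_degen_at (embed_cocomm _ hcc) hb1) //.
  congr (_ ∘ x).
  by case: j {lj hd hL hR hd'} => [|[|[|j]]] /=; case: i {li hc hc'} => [|[|[|[|i]]]];
     rewrite ?(embed_u _ hφ).
have hs1 := embed_hom_power (power hcc 2) hs.
have [e1 e2] := normalized_normal hs ns; have hs' := hom_tpow2 hs.
apply: (normal_atP hs1).
  by move: (congr1 (embed (power hcc 2)) e1);
     rewrite /u1 !embed_comp // !embed_tens !embed_idm.
by move: (congr1 (embed (power hcc 2)) e2);
   rewrite /u1 !embed_comp // !embed_tens !embed_idm.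
Qed.

Hypothesis comm : mul_of B ∘ braid B B = mul_of B.
Hypothesis hact : φ ∘ (mul_of H ⊗ B) = φ ∘ (H ⊗ φ).

Lemma convC n s t : hom (tpow H n) B s -> hom (tpow H n) B t ->
  cv n s t = cv n t s.
Proof. by move=> hs ht'; apply: conv_comm => //; rewrite comm. Qed.

Lemma coface_coface s (i j : nat) : i < j -> j <= 4 -> hom (tpow H 2) B s ->
  cof 3 j (cof 2 i s) = cof 3 i (cof 2 j.-1 s).
Proof.
move=> ij j4 hs.
have hc n : hom (tpow H 3) B (cof 2 n s) by apply: hom_coface.
have hcc' n m : hom (tpow H 4) B (cof 3 m (cof 2 n s)) by apply: hom_coface.
apply: (tuple_ext0 hcc (hcc' _ _) (hcc' _ _)) => x gx.
rewrite !(embed_coface _ hφ) //.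
apply: (coface_coface_at (embed_cocomm _ hcc) (embed_wma _ hφ hB)) => //.
  move: (congr1 (embed (power hcc 4)) hact).
  by rewrite !embed_comp // !embed_tens !embed_idm.

Qed.

Lemma regular_cobound2 s s' : regular 2 s s' ->
  regular 3 (cobound2 s s') (cobound2 s' s).
Proof.
move=> r; have r' := regular_sym r.
have rc := fun i => regular_coface hcc hB i r23 r.
have rc' := fun i => regular_coface hcc hB i r23 r'.
have [[h0 [g0 _ _ _ _]] [h1 [g1 _ _ _ _]]] := (rc 0, rc 1).
have [[h2 [g2 _ _ _ _]] [h3 [g3 _ _ _ _]]] := (rc 2, rc 3).
have q1 := regular_mul hcc hB (rc 0) (rc' 1).
have q2 := regular_mul hcc hB q1 (rc 2).
have q3 := regular_mul hcc hB q2 (rc' 3).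
have [_ [a1 _ _ _ _]] := q1; have [_ [a2 _ _ _ _]] := q2.
suff -> : cobound2 s' s = cv 3 (cof 2 3 s) (cv 3 (cof 2 2 s') (cv 3 (cof 2 1 s) (cof 2 0 s'))).
  exact: q3.
rewrite /cobound2 convC //; last by do 2?apply: hom_conv.
congr (cv 3 _ _); rewrite convC //; last exact: hom_conv.
by congr (cv 3 _ _); rewrite convC.
Qed.

Lemma normalized_cobound2 s s' : regular 2 s s' -> normalized H B φ 2 s ->
  normalized H B φ 3 (cobound2 s s').
Proof.
move=> r ns j lj; have r' := regular_sym r.
have ns' := normalized_inv hcc hB r23 r ns.
have rc := fun i => regular_coface hcc hB i r23 r.
have rc' := fun i => regular_coface hcc hB i r23 r'.
have q1 := regular_mul hcc hB (rc 0) (rc' 1).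
have q2 := regular_mul hcc hB q1 (rc 2).
rewrite /cobound2.
rewrite (regular_conv_degen hcc hB r33 lj q2 (rc' 3)).
rewrite (regular_conv_degen hcc hB r33 lj q1 (rc 2)).
rewrite (regular_conv_degen hcc hB r33 lj (rc 0) (rc' 1)).
rewrite !(coface_degen _ lj r ns) // !(coface_degen _ lj r' ns') //=.
have [hs [hs' e1 e2 _ _]] := r; have uu := un_idem hcc hB 1.
have ul := regular_ul r; have ul' := regular_ul r'.
by case: j lj => [|[|[|//]]] _ /=; rewrite ?e1 ?uu ?ul ?ul' ?e1 ?e2 ?uu ?ul ?e1 ?e2.
Qed.

Lemma cobound3_cobound2 s s' : regular 2 s s' ->
  cobound3 (cobound2 s s') (cobound2 s' s) = un 4.
Proof.
move=> r; have r' := regular_sym r; have [hs [hs' _ _ _ _]] := r.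
have rr i j := regular_coface hcc hB j r33 (regular_coface hcc hB i r23 r).
have hu := hom_u hφ 4.
have hc i : hom (tpow H 3) B (cof 2 i s) by apply: hom_coface.
have hc' i : hom (tpow H 3) B (cof 2 i s') by apply: hom_coface.
rewrite /cobound3 /cobound2.
rewrite !(coface_conv hcc hB _ r33);
  try solve [repeat first [exact: hc | exact: hc' | apply: hom_conv]].
have cc t i j : hom (tpow H 2) B t -> i < j -> j <= 4 ->
    cof 3 j (cof 2 i t) = cof 3 i (cof 2 j.-1 t).
  by move=> *; apply: coface_coface.
rewrite -!(cc _ 0 1) // -!(cc _ 0 2) // -!(cc _ 0 3) // -!(cc _ 0 4) //.
rewrite -!(cc _ 1 2) // -!(cc _ 1 3) // -!(cc _ 1 4) // -!(cc _ 2 3) //.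
rewrite -!(cc _ 2 4) // -!(cc _ 3 4) //.
have [q E] : exists q, forall i j, cof 3 j (cof 2 i s) = q i j.
  by exists (fun i j => cof 3 j (cof 2 i s)).
have [q' E'] : exists q', forall i j, cof 3 j (cof 2 i s') = q' i j.
  by exists (fun i j => cof 3 j (cof 2 i s')).
rewrite !E !E'.
(* The calculation takes place in the commutative monoid of all morphisms
   absorbed by the unit. *)
pose T := {f | hom (tpow H 4) B f /\ cv 4 (un 4) f = f}.
have opP (x y : T) : hom (tpow H 4) B (cv 4 (sval x) (sval y)) /\
    cv 4 (un 4) (cv 4 (sval x) (sval y)) = cv 4 (sval x) (sval y).
  by case: x y => [x [hx ex]] [y [hy ey]]; split;
     [apply: hom_conv | rewrite /= convA // ex].
pose op (x y : T) : T := exist _ (cv 4 (sval x) (sval y)) (opP x y).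
have Teq (x y : T) : sval x = sval y -> x = y.
  case: x y => [x px] [y py] /= exy; subst y.
  by rewrite (proof_irrelevance _ px py).
have opA : associative op.
  move=> [x [hx ex]] [y [hy ey]] [z [hz ez]]; apply: Teq.
  by rewrite /op /sval convA.
have opC : commutative op.
  move=> [x [hx ex]] [y [hy ey]]; apply: Teq.
  by rewrite /op /sval convC.
pose e : T := exist _ (un 4) (conj hu (un_idem hcc hB 3)).
have op1 : left_id e op by move=> [x [hx ex]]; apply: Teq.
have qP i j : hom (tpow H 4) B (q i j) /\ cv 4 (un 4) (q i j) = q i j.
  by rewrite -E; split; [case: (rr i j) | exact: regular_ul (rr i j)].
have qP' i j : hom (tpow H 4) B (q' i j) /\ cv 4 (un 4) (q' i j) = q' i j.
  rewrite -E'; have rs := regular_sym (rr i j).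
  by split; [case: rs | exact: regular_ul rs].
pose Q i j : T := exist _ _ (qP i j).
pose Q' i j : T := exist _ _ (qP' i j).
have QQ i j : op (Q i j) (Q' i j) = e.
  by apply: Teq; rewrite /= -E -E'; have [_ [_ -> _ _ _]] := rr i j.
exact: (congr1 sval (double_coboundary_cancel opA opC op1
  (QQ 0 1) (QQ 0 2) (QQ 0 3) (QQ 0 4) (QQ 1 2) (QQ 1 3) (QQ 1 4) (QQ 2 3)
  (QQ 2 4) (QQ 3 4))).
Qed.

End Cochains.

(** * The center *)

Section CenterElements.
Variables (C : smc) (H : weak_hopf C) (hcc : cocommutative H).
Variables (B : algebra C) (φ : Mor C) (hB : weak_module_algebra H B φ).
Local Notation μ := (mul_of B).
Local Notation "h · k" := (mul_of H ∘ (h ⊗ k)) (at level 39, left associativity).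
Local Notation u := (u1 H B φ).
Local Notation grouplike := (grouplike H).
Local Notation cv := (conv H B).
Local Notation un := (u_ H B φ).
Local Notation lm := (lm B).
Local Notation rm := (rm B).
Local Notation ac := (ac B φ).

Let hφ : hom (H ⊠ B) B φ. Proof. by case: hB => -[]. Qed.

(** Central values are not affected by conjugation with s(h, k), so on them
    the twisted condition says that the action is associative. *)
Lemma center_act_at (Z : Ob C) (z φZ s s' h k : Mor C) :
  hom Z B z -> central B z -> hom (H ⊠ Z) Z φZ -> z ∘ φZ = φ ∘ (H ⊗ z) ->
  hom (tpow H 2) B s -> hom (tpow H 2) B s' -> cv 2 s' s = un 2 ->
  twisted H B φ s -> grouplike h -> grouplike k ->
  φ ∘ (mul_of H ⊗ z) ∘ (h ⊗ k ⊗ Z) = φ ∘ (H ⊗ (φ ∘ (H ⊗ z))) ∘ (h ⊗ k ⊗ Z).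
Proof.
move=> hz cz hφZ ez hs hs' e ts gh gk; have [hh _] := gh; have [hk _] := gk.
have g2 := gl2 gh gk; have [hx _] := g2.
have ghk := grouplike_mul gh gk; have [hhk _] := ghk.
have ha : hom K B (s ∘ (h ⊗ k)) by apply: hom_mcomp hx hs _.
have ha' : hom K B (s' ∘ (h ⊗ k)) by apply: hom_mcomp hx hs' _.
have := conv_at hs' hs g2; rewrite e (un_at hB) // muln_of2 //.
have := twisted_at hB hs ts gh gk.
move: (s ∘ (h ⊗ k)) (s' ∘ (h ⊗ k)) ha ha' => a a' ha ha' tw eu.
have [[a1 a2] a3] := (hom_ac hB hh, hom_ac hB hk, hom_ac hB hhk).
have [l1 l2] := (hom_lm ha, hom_lm ha'); have r1 := hom_rm ha.
transitivity (ac (h · k) ∘ z); first by rewrite /ac; planar.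
transitivity (ac h ∘ ac k ∘ z); last by rewrite /ac; planar.
pose ζ := φZ ∘ (H ⊗ φZ) ∘ (h ⊗ k ⊗ Z).
have hζ : hom Z Z ζ by rewrite /ζ; typecheck.
have e1 : ac h ∘ ac k ∘ z = z ∘ ζ.
  transitivity ((z ∘ φZ) ∘ (H ⊗ φZ) ∘ (h ⊗ k ⊗ Z)); last by rewrite /ζ; planar.
  rewrite ez; transitivity (φ ∘ (H ⊗ (z ∘ φZ)) ∘ (h ⊗ k ⊗ Z)); last by planar.
  by rewrite ez /ac; planar.
have e2 : lm a ∘ (ac h ∘ ac k ∘ z) = lm a ∘ (ac (h · k) ∘ z).
  transitivity ((lm a ∘ z) ∘ ζ); first by rewrite e1; planar.
  rewrite -(central_rm hz ha cz).
  transitivity (rm a ∘ (ac h ∘ ac k ∘ z)); first by rewrite e1; planar.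
  transitivity ((rm a ∘ ac h ∘ ac k) ∘ z); first by planar.
  by rewrite tw; planar.
have e3 : lm (u ∘ (h · k)) ∘ (ac h ∘ ac k ∘ z) = lm (u ∘ (h · k)) ∘ (ac (h · k) ∘ z).
  rewrite eu lm_mul //.
  transitivity (lm a' ∘ (lm a ∘ (ac h ∘ ac k ∘ z))); first by planar.
  by rewrite e2; planar.
have hu : hom B B (lm (u ∘ (h · k))) by apply: hom_lm; typecheck.
have hu' : hom B B (lm (u ∘ k)) by apply: hom_lm; typecheck.
transitivity (lm (u ∘ (h · k)) ∘ ac (h · k) ∘ z); first by rewrite (ac_u hB).
rewrite -mcompA; [|compose_ok|compose_ok].
rewrite -e3 (u_mul hB) //.
have hu2 : hom B B (lm (φ ∘ (h ⊗ (u ∘ k)))) by apply: hom_lm; typecheck.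
transitivity ((lm (φ ∘ (h ⊗ (u ∘ k))) ∘ ac h) ∘ ac k ∘ z); first by planar.
rewrite -(ac_lm hB) //.
transitivity (ac h ∘ (lm (u ∘ k) ∘ ac k) ∘ z); first by planar.
by rewrite (ac_u hB) //; planar.
Qed.

End CenterElements.

Section CenterMorphisms.
Variables (C : smc) (H : weak_hopf C) (hcc : cocommutative H).
Variables (B : algebra C) (φ : Mor C) (hB : weak_module_algebra H B φ).
Variables (Z : center B) (φZ : Mor C) (hZ : center_action H φ Z φZ).
Implicit Types (f g s t : Mor C) (n i : nat).
Local Notation z := (center_mor Z).
Local Notation μ := (mul_of B).
Local Notation cv := (conv H B).
Local Notation cvZ := (conv H Z).
Local Notation un := (u_ H B φ).
Local Notation unZ := (u_ H Z φZ).
Local Notation cof := (coface H φ).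
Local Notation cofZ := (coface H φZ).

Let hφ : hom (H ⊠ B) B φ. Proof. by case: hB => -[]. Qed.
Let hφZ : hom (H ⊠ Z) Z φZ. Proof. by case: hZ. Qed.
Let hz : hom Z B z. Proof. exact: hom_center. Qed.

Lemma center_ext X f g : hom X Z f -> hom X Z g -> z ∘ f = z ∘ g -> f = g.
Proof.
move=> [f1 f2] [g1 g2] e; have [z1 _] := hz.
by apply: (mono_center (c := Z)) => //; rewrite ?z1 ?f1.
Qed.

Lemma center_act : z ∘ φZ = φ ∘ (H ⊗ z). Proof. by case: hZ. Qed.

Lemma center_commutative : mul_of Z ∘ braid Z Z = mul_of Z.
Proof.
apply: (@center_ext (Z ⊠ Z)); [by typecheck|by typecheck|].
rewrite mcompA // center_mul.
transitivity (μ ∘ ((z ⊗ z) ∘ braid Z Z)); first by planar.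
rewrite -(braid_nat hz hz).
transitivity (μ ∘ braid B B ∘ (B ⊗ z) ∘ (z ⊗ Z)); first by planar.
by rewrite -central_center; planar.
Qed.

Lemma center_wma : weak_module_algebra H Z φZ.
Proof.
have eu : z ∘ u1 H Z φZ = u1 H B φ.
  rewrite /u1 mcompA // center_act -(center_unit Z); planar.
case: hB => -[_ b1] b2 b3; split; first split=> //.
- apply: (@center_ext (H ⊠ Z ⊠ Z)); [by typecheck|by typecheck|].
  rewrite mcompA // center_act.
  transitivity (φ ∘ (H ⊗ (z ∘ mul_of Z))); first by planar.
  rewrite center_mul.
  transitivity (φ ∘ (H ⊗ μ) ∘ (H ⊗ z ⊗ z)); first by planar.
  rewrite b1.
  transitivity (μ ∘ (φ ⊗ φ) ∘ (H ⊗ (braid H B ∘ (H ⊗ z)) ⊗ z) ∘ (comul H ⊗ Z ⊗ Z)).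
    by planar.
  rewrite (braid_natr H hz).
  transitivity (μ ∘ ((φ ∘ (H ⊗ z)) ⊗ (φ ∘ (H ⊗ z)))
     ∘ (H ⊗ braid H Z ⊗ Z) ∘ (comul H ⊗ Z ⊗ Z)); first by planar.
  rewrite -center_act.
  transitivity (μ ∘ (z ⊗ z) ∘ (φZ ⊗ φZ) ∘ (H ⊗ braid H Z ⊗ Z) ∘ (comul H ⊗ Z ⊗ Z)).
    by planar.
  by rewrite -center_mul; planar.
- apply: (@center_ext Z); [by typecheck|by typecheck|].
  rewrite mcompA // center_act.
  transitivity (φ ∘ (unit_of H ⊗ B) ∘ z); first by planar.
  by rewrite b2; planar.
have hu : hom H Z (u1 H Z φZ) by rewrite /u1; typecheck.
apply: (@center_ext (H ⊠ H)); [by typecheck|by typecheck|].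
rewrite mcompA // eu b3 -eu [RHS]mcompA // center_act; planar.
Qed.

Lemma center_act_assoc s s' : regular H B φ 2 s s' -> twisted H B φ s ->
  φZ ∘ (mul_of H ⊗ Z) = φZ ∘ (H ⊗ φZ).
Proof.
move=> [hs [hs' _ e _ _]] ts; apply: (@center_ext (H ⊠ H ⊠ Z)); [by typecheck|by typecheck|].
rewrite !mcompA // center_act.
transitivity (φ ∘ (mul_of H ⊗ z)); first by planar.
transitivity (φ ∘ (H ⊗ (z ∘ φZ))); last by planar.
rewrite center_act.
have e2 : tpow H 2 = H ⊠ H by rewrite /tpow /= otensAK.
apply: (tuple_ext hcc Z (n := 2) (X := B)); [by rewrite e2; typecheck|by rewrite e2; typecheck|].
move=> x gx; have [h [k [gh gk ->]]] := gl2P (embed_cocomm _ hcc) gx.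
have hs1 := embed_hom_power (power hcc 2) hs; have hs1' := embed_hom_power (power hcc 2) hs'.
have hb1 := embed_wma (power hcc 2) hφ hB.
have := @center_act_at _ _ _ _ hb1 (Z : Ob C) (embed _ z) (embed _ φZ)
  (embed _ s) (embed _ s') h k (embed_hom _ hz)
  (embed_central _ hz (central_center Z)) (embed_hom _ hφZ).
rewrite !embed_comp // !embed_tens !embed_idm !embed_comp // !embed_tens !embed_idm.
move=> E; apply: E => //.
- move: (congr1 (embed (power hcc 2)) center_act).
  by rewrite !embed_comp // !embed_tens !embed_idm.
- by rewrite -(embed_u _ hφ) -embed_conv // e.
exact: embed_twisted.
Qed.

Lemma center_u n : z ∘ unZ n = un n.
Proof.
have hm := hom_muln H n.
transitivity ((z ∘ φZ) ∘ (H ⊗ unit_of Z) ∘ muln_of H n); first by rewrite /u_ /u1; planar.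
rewrite center_act.
transitivity (φ ∘ (H ⊗ (z ∘ unit_of Z)) ∘ muln_of H n); first by planar.
by rewrite center_unit /u_ /u1.
Qed.

Lemma center_conv n s t : hom (tpow H n) Z s -> hom (tpow H n) Z t ->
  z ∘ cvZ n s t = cv n (z ∘ s) (z ∘ t).
Proof.
move=> hs ht'; have hc := hom_comuln H n; rewrite /conv /convol.
transitivity ((z ∘ mul_of Z) ∘ (s ⊗ t) ∘ comuln H n); first by planar.
by rewrite center_mul; planar.
Qed.

Lemma hom_z X f : hom X Z f -> hom X B (z ∘ f). Proof. by move=> hf; typecheck. Qed.

Lemma center_coface n i s : 0 < n -> hom (tpow H n) Z s ->
  z ∘ cofZ n i s = cof n i (z ∘ s).
Proof.
case: n => // n _ hs; case: i => [|i].
  rewrite /coface; transitivity ((z ∘ φZ) ∘ (H ⊗ s)); first by planar.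
  by rewrite center_act; planar.
have := hom_coface hφZ i.+1 (isT : 0 < n.+1) hs.
rewrite /coface; case: ifP => [le_in|_] hc.
  have e : i + (n.+1 - i.+1) = n by rewrite subSS subnKC.
  rewrite mcompA //.
  eapply composable; [hom_infer | exact: hs |].
  by rewrite -otensA -[_ ⊠ tpow H _]/(tpow H (n.+1 - i.+1).+1) -tpowD addnS e.
have eS m : tpow H m.+1 = tpow H m ⊠ H.
  by rewrite -addn1 tpowD /tpow /= otensAK.
rewrite mcompA //.
by eapply composable; [hom_infer | exact: hs | rewrite eS].
Qed.

Lemma center_regular n s s' : regular H Z φZ n s s' ->
  regular H B φ n (z ∘ s) (z ∘ s').
Proof.
move=> [hs [hs' a b c d]]; have [h1 h2] := (hom_z hs, hom_z hs').
have [h3 h4] := (hom_conv hs hs', hom_conv hs' hs).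
split=> //; split=> //; rewrite -!center_conv ?a ?b ?c ?d ?center_u //.
- by rewrite -a c.
by rewrite -b d.
Qed.

Lemma center_central X f : hom X Z f -> central B (z ∘ f).
Proof.
move=> hf; rewrite /central.
transitivity (μ ∘ (B ⊗ z) ∘ (B ⊗ f)); first by planar.
by rewrite central_center; planar.
Qed.

Lemma central_conv n f s : hom (tpow H n) Z f -> hom (tpow H n) B s ->
  cv n (z ∘ f) s = cv n s (z ∘ f).
Proof.
move=> hf hs; have hzf := hom_z hf; apply: (conv_comm hcc) => //.
transitivity (μ ∘ (B ⊗ (z ∘ f)) ∘ (s ⊗ tpow H n)); first by planar.
by rewrite (center_central hf); planar.
Qed.

Lemma conv_swap n s t f g : hom (tpow H n) B s -> hom (tpow H n) B t ->
  hom (tpow H n) Z f -> hom (tpow H n) Z g ->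
  cv n (cv n s (z ∘ f)) (cv n t (z ∘ g)) = cv n (cv n s t) (z ∘ cvZ n f g).
Proof.
move=> hs ht' hf hg; have [h1 h2] := (hom_z hf, hom_z hg).
have [[h3 h4] h5] := (hom_conv hs h1, hom_conv ht' h2, hom_conv hs ht').
rewrite center_conv // (convA hcc h3 ht' h2) -(convA hcc hs h1 ht').
by rewrite (central_conv hf ht') (convA hcc hs ht' h1) -(convA hcc h5 h1 h2).
Qed.

(** The cofaces of a central cochain are central, so its contribution to the
    product can be collected at the end. *)
Lemma pre_obstruction_mul s s' t t' :
  regular H B φ 2 s s' -> regular H Z φZ 2 t t' ->
  pre_obstruction H B φ (cv 2 s (z ∘ t))
  = cv 3 (pre_obstruction H B φ s) (z ∘ Dk H Z φZ 2 t).
Proof.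
move=> r rt; have [hs [hs' _ _ _ _]] := r; have [ht1 [ht1' _ _ _ _]] := rt.
have rz := center_regular rt; have [hz1 [hz1' _ _ _ _]] := rz.
rewrite (pre_obstructionE hcc hB (regular_mul hcc hB r rz)).
rewrite (pre_obstructionE hcc hB r) (Dk2E hcc center_wma rt).
rewrite (central_conv ht1' hs').
rewrite !(coface_conv hcc hB _ (isT : (2 == 2) || (2 == 3))) // -!center_coface //.
have hc i : hom (tpow H 3) B (cof 2 i s) by apply: hom_coface.
have hc' i : hom (tpow H 3) B (cof 2 i s') by apply: hom_coface.
have hd i : hom (tpow H 3) Z (cofZ 2 i t) by apply: hom_coface.
have hd' i : hom (tpow H 3) Z (cofZ 2 i t') by apply: hom_coface.
have k1 := hom_conv (hc 0) (hc 2); have k2 := hom_conv k1 (hc' 1).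
have l1 := hom_conv (hd 0) (hd 2); have l2 := hom_conv l1 (hd' 1).
have m1 := hom_conv (hd 0) (hd' 1).
rewrite (conv_swap (hc 0) (hc 2) (hd 0) (hd 2)) (conv_swap k1 (hc' 1) l1 (hd' 1)).
rewrite (conv_swap k2 (hc' 3) l2 (hd' 3)); congr (cv 3 _ (z ∘ cvZ 3 _ _)).
rewrite -(convA hcc (hd 0) (hd 2) (hd' 1)).
by rewrite (convC hcc center_commutative (hd 2) (hd' 1)) convA.
Qed.

End CenterMorphisms.

Theorem corollary5p16 (C : smc) (hC : idempotents_split C)
    (H : weak_hopf C) (hH : cocommutative H)
    (B : algebra C) (phiB : Mor C) (hB : weak_module_algebra H B phiB)
    (Z : center B)
    (sigma : Mor C) (hsigma : RegPlus H B phiB 2 sigma)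
    (htwisted : twisted H B phiB sigma)
    (phiZ : Mor C) (hphiZ : center_action H phiB Z phiZ)
    (theta : Mor C) (htheta : obstruction H phiB Z sigma theta) :
  class_trivial H Z phiZ 3 theta <->
  exists alpha : Mor C,
    [/\ RegPlus H B phiB 2 alpha, twisted H B phiB alpha,
        cocycle_condition H B phiB alpha & normal_condition H B phiB alpha].
Proof.
have hφ : hom (H ⊠ B) B phiB by case: hB => -[].
have hZ := center_wma hB hphiZ.
have hφZ : hom (H ⊠ Z) Z phiZ by case: hphiZ.
have com := center_commutative Z.
have [hθ eθ] := htheta; have [rs0 ns] := hsigma.
have rs := Reg_regular rs0; move: (reg_inv _ _ _ _ _) rs => sigma' rs.
have ass := center_act_assoc hH hB hphiZ rs htwisted.
have r23 : (2 == 2) || (2 == 3) by []; have r33 : (3 == 2) || (3 == 3) by [].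
have [hs [hs' e1 e2 _ _]] := rs; have hz := hom_center Z.
split.
  case=> _ _ [β [τ [rτ0 nτ] eβ] eθβ].
  have rτ := Reg_regular rτ0; move: (reg_inv _ _ _ _ _) rτ => τ' rτ.
  have [hτ [hτ' _ _ _ _]] := rτ.
  have nτ' := normalized_inv hH hZ r23 rτ nτ.
  have rD := regular_cobound2 hH hZ com rτ.
  rewrite -(Dk2E hH hZ rτ) -(Dk2E hH hZ (regular_sym rτ)) -eβ in rD.
  rewrite (regular_ul rD) in eθβ.
  have rzτ' := center_regular hB hphiZ (regular_sym rτ).
  have ra := regular_mul hH hB rs rzτ'.
  exists (conv H B 2 sigma (center_mor Z ∘ τ')).
  have na : normalized H B phiB 2 (conv H B 2 sigma (center_mor Z ∘ τ')).
    apply: (normalized_mul hH hB r23 rs rzτ') => // i lin.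
    have hd := hom_degen H lin.
    rewrite -mcompA; [|exact: composable hd hτ' _|exact: composable hτ' hz _].
    by rewrite nτ' // (center_u hB hphiZ).
  have hzτ' : hom (tpow H 2) B (center_mor Z ∘ τ') by case: rzτ'.
  split.
  - by apply/(RegPlusP ra).
  - apply: (twisted_mul_central hH hB hs hzτ' htwisted).
    exact: center_central hτ'.
  - apply/(cocycle_iff hH hB ra).
    rewrite (pre_obstruction_mul hH hB hphiZ rs (regular_sym rτ)).
    rewrite -eθ eθβ.
    have [hβ [hβ' eD _ _ _]] := rD.
    by rewrite -(center_conv) // eD (center_u hB hphiZ).
  by apply: normalized_normal => //; case: ra.
case=> α [[rα0 nα] tα cα _].
have rα := Reg_regular rα0; move: (reg_inv _ _ _ _ _) rα => α' rα.
have [hα [hα' a1 a2 _ _]] := rα.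
(* alpha^-1 sigma and sigma^-1 alpha factor through the center, as mutually
   inverse cochains. *)
have r1 := regular_mul hH hB (regular_sym rα) rs.
have c1 := twisted_ratio_central hH hB rα rs tα htwisted.
have c2 := twisted_ratio_central hH hB rs rα htwisted tα.
have [h1 [h2 _ _ _ _]] := r1.
have [τ [[hτ eτ] _]] := @center_factor _ _ Z _ _ h1 c1.
have [τ' [[hτ' eτ'] _]] := @center_factor _ _ Z _ _ h2 c2.
have rτ : regular H Z phiZ 2 τ τ'.
  have [h3 h4] := (hom_conv hτ hτ', hom_conv hτ' hτ).
  have hu := hom_u hφZ 2.
  move: r1; rewrite -eτ -eτ' => -[_ [_ b1 b2 b3 b4]].
  split=> //; split=> //; apply: (center_ext (Z := Z) (X := tpow H 2)) => //.
  - by rewrite center_conv // b1 (center_u hB hphiZ).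
  - by rewrite center_conv // b2 (center_u hB hphiZ).
  - exact: hom_conv.
  - by rewrite !center_conv // b3.
  - exact: hom_conv.
  by rewrite !center_conv // b4.
have nτ : normalized H Z phiZ 2 τ.
  move=> i lin; have hd := hom_degen H lin.
  apply: (center_ext (Z := Z) (X := tpow H 2.-1)); first exact: hom_mcomp hd hτ _.
    exact: hom_u.
  rewrite mcompA; [|exact: composable hd hτ _|exact: composable hτ hz _].
  rewrite eτ (center_u hB hphiZ).
  have nα' := normalized_inv hH hB r23 rα nα.
  exact: (normalized_mul hH hB r23 (regular_sym rα) rs nα' ns).
have eD : theta = Dk H Z phiZ 2 τ.
  have rD := regular_cobound2 hH hZ com rτ; rewrite -(Dk2E hH hZ rτ) in rD.
  have hD : hom (tpow H 3) Z (Dk H Z phiZ 2 τ) by case: rD.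
  apply: (center_ext (Z := Z)) => //; rewrite eθ.
  have -> : sigma = conv H B 2 α (center_mor Z ∘ τ).
    by rewrite eτ convA // a1 (regular_ul rs).
  rewrite (pre_obstruction_mul hH hB hphiZ rα rτ).
  have [/(_ cα) -> _] := cocycle_iff hH hB rα.
  have hu := hom_u hφZ 3; rewrite -(center_u hB hphiZ) -center_conv //.
  by rewrite (regular_ul rD).
have rD := regular_cobound2 hH hZ com rτ.
have rDk := rD; rewrite -(Dk2E hH hZ rτ) -eD in rDk.
have ru := regular_un hH hZ 2.
have dθ : KerDplus H Z phiZ 3 theta.
  split; first (apply/(RegPlusP rDk); rewrite eD (Dk2E hH hZ rτ)).
    exact: normalized_cobound2.
  rewrite (Dk3E hH hZ rDk) eD (Dk2E hH hZ rτ).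
  exact: cobound3_cobound2.
split=> //.
  split; first by apply/(RegPlusP ru); apply: normalized_un.
  by rewrite (Dk3E hH hZ ru) cobound3_un.
exists theta; last by rewrite (regular_ul rDk).
exists τ => //; apply/(RegPlusP rτ); exact: nτ.
Qed.
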